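(* Let $d\ge 2$, let $2\leq p<d$ and let $B$ be a smooth and closed magnetic field on $\mathbb{R}^d$ with $B\neq 0$ (i.e. $B$ is not identically zero). Then there exists a constant $c(p)>0$ such that for every vector field (magnetic potential) $A$ with $dA=B$ we have $$\int_{\mathbb{R}^d}|\nabla_A u|^p\,dx-\mu_{p,d}\int_{\mathbb{R}^d}\frac{|u|^p}{|x|^p}\,dx\;\geq\; c(p)\int_{\mathbb{R}^d}\left|\nabla_A\!\left(u|x|^{\frac{d-p}{p}}\right)\right|^p|x|^{p-d}\,dx,\qquad\forall u\in\mathcal{D}(h_{A,p}).$$ The constant $c(p)$ is explicitly given by $$c(p):=\inf_{(s,t)\in\mathbb{R}^2\setminus\{(0,0)\}}\frac{\left[t^2+s^2+2s+1\right]^{\frac p2}-1-ps}{\left[t^2+s^2\right]^{\frac p2}}\in(0,1].$$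
   Context: A magnetic field is a smooth function $B:\mathbb{R}^d\to\mathbb{R}^{d\times d}$ with skew-symmetric values, identified with a differential 2-form on $\mathbb{R}^d$; it is closed if its exterior derivative vanishes, $dB=0$. A magnetic potential for $B$ is a smooth vector field $A=(A_1,\dots,A_d):\mathbb{R}^d\to\mathbb{R}^d$, identified with a 1-form, such that $dA=B$, i.e. $B_{ij}=\partial A_j/\partial x^i-\partial A_i/\partial x^j$. The functions $u$ are complex-valued, and the magnetic gradient is $\nabla_A u:=\nabla u+iA(x)u$. The quadratic form is $h_{A,p}[u]:=\int_{\mathbb{R}^d}|\nabla_A u|^p\,dx$, and its domain $\mathcal{D}(h_{A,p})$ is the closure of $C_c^\infty(\mathbb{R}^d)$ with respect to the norm $\|u\|:=\left(h_{A,p}[u]+\|u\|_{L^p(\mathbb{R}^d)}^p\right)^{1/p}$. Moreover, $\mu_{p,d}:=\left(\frac{d-p}{p}\right)^p$. *)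

(* Defs.v *)
From HB Require Import structures.
From mathcomp Require Import all_boot all_order all_algebra.
From mathcomp Require Import all_classical all_reals all_analysis.
From mathcomp Require Import complex.

Set Implicit Arguments.
Unset Strict Implicit.
Unset Printing Implicit Defensive.

Import Order.TTheory GRing.Theory Num.Theory.
Import numFieldNormedType.Exports.

Local Open Scope classical_set_scope.
Local Open Scope ring_scope.

(* [Re], [Im], [%:C] and [+i*] below are those of [complex.v], on R[i]. *)
Local Open Scope complex_scope.
Local Notation Re := (@complex.Re _).
Local Notation Im := (@complex.Im _).
Notation normc := (@complex.ComplexField.Normc.normc _).

(* The points of R^n are the row vectors 'rV[R]_n, whose library norm is the
   sup norm; the Euclidean norm is [enorm] below. The sigma-algebra on R^n is
   the product one, generated by the coordinates, i.e. the Borel one. *)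
Section rV_measurable.
Context {R : realType}.
Variable n : nat.

Let coors : 'I_n -> 'rV[R]_n -> R := fun i x => x ord0 i.

Let rV_set0 : g_sigma_preimage coors set0.
Proof. exact: sigma_algebra0. Qed.

Let rV_setC A : g_sigma_preimage coors A -> g_sigma_preimage coors (~` A).
Proof. exact: sigma_algebraC. Qed.

Let rV_bigcup (F : (set 'rV[R]_n)^nat) :
  (forall i, g_sigma_preimage coors (F i)) ->
  g_sigma_preimage coors (\bigcup_i (F i)).
Proof. exact: sigma_algebra_bigcup. Qed.

HB.instance Definition _ := @isMeasurable.Build default_measure_display
  'rV[R]_n (g_sigma_preimage coors) rV_set0 rV_setC rV_bigcup.

Lemma measurable_coord (i : 'I_n) :
  measurable_fun setT (fun x : 'rV[R]_n => x ord0 i).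
Proof.
move=> _ Y mY; rewrite setTI; apply: sub_sigma_algebra => /=.
rewrite -bigcup_seq/=; exists i => /=; first by rewrite mem_index_enum.
by exists Y => //; rewrite setTI.
Qed.

Lemma measurable_fun_rVP d (T : measurableType d) (f : T -> 'rV[R]_n) :
  (forall i, measurable_fun setT (fun x => f x ord0 i)) ->
  measurable_fun setT f.
Proof.
move=> mf; apply: (@measurability _ _ _ _ setT f
  (\big[setU/set0]_(i < n)
    preimage_set_system setT (coors i) measurable)) => //.
move=> _ [A + <-]; rewrite -bigcup_seq/= => -[i _ [B mB <-]].
by rewrite setTI (_ : coors i @^-1` B = setT `&` coors i @^-1` B) ?setTI//;
  rewrite -[X in measurable X]setTI; exact: mf.
Qed.

End rV_measurable.

Section lebesgue_rV.
Context {R : realType}.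
Implicit Type n : nat.

Definition rV_cons n (z : measurableTypeR R * 'rV[R]_n) : 'rV[R]_n.+1 :=
  row_mx (const_mx (z.1 : R) : 'rV[R]_1) z.2.

Definition rV_uncons n (v : 'rV[R]_n.+1) : measurableTypeR R * 'rV[R]_n :=
  (v ord0 ord0, \row_j v ord0 (lift ord0 j)).

Lemma rV_consK n : cancel (@rV_cons n) (@rV_uncons n).
Proof.
move=> [a v]; rewrite /rV_uncons /rV_cons; congr pair.
  by rewrite mxE; case: splitP => // j _; rewrite mxE.
apply/rowP => j; rewrite !mxE; case: splitP => [k|k].
  by rewrite (ord1 k) /= /bump.
by rewrite /= /bump !add1n => -[/val_inj->].
Qed.

Lemma measurable_rV_cons n : measurable_fun setT (@rV_cons n).
Proof.
apply: measurable_fun_rVP => i.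
case: (unliftP ord0 i) => [j ->|->].
- rewrite (_ : (fun x => _) = (fun x : 'rV[R]_n => x ord0 j)
    \o snd); first exact: measurableT_comp (measurable_coord j) _.
  apply/funext => z /=.
  by move/(congr1 snd)/rowP/(_ j) : (rV_consK z); rewrite /= mxE.
- rewrite (_ : (fun x => _) = fst) //.
  by apply/funext => z; exact: (congr1 fst (rV_consK z)).
Qed.

Lemma measurable_rV_uncons n : measurable_fun setT (@rV_uncons n).
Proof.
apply: measurable_fun_pair; first exact: measurable_coord.
apply: measurable_fun_rVP => i.
by under eq_fun do rewrite mxE; exact: measurable_coord.
Qed.

Section lebesgue_consr.
Variable n : nat.
Variable nu : {sigma_finite_measure set 'rV[R]_n -> \bar R}.

Definition lebesgue_consr : set 'rV[R]_n.+1 -> \bar R :=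
  pushforward (lebesgue_measure \x nu)%E (@rV_cons n).

Let mrV_cons := @measurable_rV_cons n.

Let pushforward0 : lebesgue_consr set0 = 0%E.
Proof. exact: measure0. Qed.

Let pushforward_ge0 A : (0 <= lebesgue_consr A)%E.
Proof. exact: measure_ge0. Qed.

Let pushforward_sigma_additive : semi_sigma_additive lebesgue_consr.
Proof. exact: measure_semi_sigma_additive. Qed.

HB.instance Definition _ := isMeasure.Build _ _ _ lebesgue_consr
  pushforward0 pushforward_ge0 pushforward_sigma_additive.

Let pushforward_sigma_finite : sigma_finite setT lebesgue_consr.
Proof.
have /sigma_finiteP[F [FT ndF Foo]] := sigma_finiteT (@lebesgue_measure R).
have /sigma_finiteP[G [GT ndG Goo]] := sigma_finiteT nu.
exists (fun k => @rV_uncons n @^-1` (F k `*` G k)).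
  apply/seteqP; split=> // v _.
  have : setT (rV_uncons v).1 by [].
  have : setT (rV_uncons v).2 by [].
  rewrite FT GT => -[k _ Gk] [l _ Fl]; exists (maxn k l) => //; split.
  - by move: Fl; exact/subsetPset/ndF/leq_maxr.
  - by move: Gk; exact/subsetPset/ndG/leq_maxl.
move=> k; have [mF Fk] := Foo k; have [mG Gk] := Goo k; split.
  rewrite -[X in measurable X]setTI.
  by apply: measurable_rV_uncons => //; exact: measurableX.
rewrite /lebesgue_consr /pushforward (_ : _ @^-1` _ = F k `*` G k).
  by rewrite product_measure1E// lte_mul_pinfty// ge0_fin_numE.
by rewrite -comp_preimage (_ : _ \o _ = idfun)//; apply/funext/rV_consK.
Qed.

HB.instance Definition _ := Measure_isSigmaFinite.Build _ _ _
  lebesgue_consr pushforward_sigma_finite.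

End lebesgue_consr.

Fixpoint lebesgue_rV n : {sigma_finite_measure set 'rV[R]_n -> \bar R} :=
  if n is m.+1 then lebesgue_consr (lebesgue_rV m) else \d_(0 : 'rV[R]_0).

End lebesgue_rV.

Section calculus.
Context {R : realType} {d : nat}.
Implicit Types (f : 'rV[R]_d -> R) (u phi : 'rV[R]_d -> R[i]).
Implicit Types (A : 'rV[R]_d -> 'rV[R]_d) (B : 'rV[R]_d -> 'M[R]_d).

Definition enorm (x : 'rV[R]_d) : R := Num.sqrt (\sum_j x ord0 j ^+ 2).

Definition cenorm (z : 'rV[R[i]]_d) : R :=
  Num.sqrt (\sum_j normc (z ord0 j) ^+ 2).

Definition partial (j : 'I_d) f (x : 'rV[R]_d) : R := 'D_(delta_mx ord0 j) f x.

Definition cpartial (j : 'I_d) u (x : 'rV[R]_d) : R[i] :=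
  partial j (Re \o u) x +i* partial j (Im \o u) x.

Fixpoint Ck (k : nat) f : Prop :=
  continuous f /\
  if k is k'.+1 then
    forall j, (forall x, derivable f x (delta_mx ord0 j)) /\ Ck k' (partial j f)
  else True.

Definition smooth f := forall k, Ck k f.

Definition csmooth u := smooth (Re \o u) /\ smooth (Im \o u).

(* C_c^oo(R^d) *)
Definition test_function phi :=
  csmooth phi /\ compact (closure [set x | phi x != 0]).

Definition smooth_vector_field A := forall i, smooth (fun x => A x ord0 i).

Definition magnetic_field B :=
  (forall i j, smooth (fun x => B x i j)) /\ (forall x, (B x)^T = - B x).

Definition closed_field B := forall (i j k : 'I_d) (x : 'rV[R]_d),
  partial i (fun y => B y j k) x + partial j (fun y => B y k i) x
  + partial k (fun y => B y i j) x = 0.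

Definition dform A (x : 'rV[R]_d) : 'M[R]_d := \matrix_(i, j)
  (partial i (fun y => A y ord0 j) x - partial j (fun y => A y ord0 i) x).

Definition magnetic_potential B A :=
  smooth_vector_field A /\ (forall x, dform A x = B x).

End calculus.

Section magnetic_sobolev.
Context {R : realType} {d : nat}.
Implicit Types (u phi : 'rV[R]_d -> R[i]) (A : 'rV[R]_d -> 'rV[R]_d) (p : R).

Local Notation mu := (@lebesgue_rV R d).

Definition cmeasurable u :=
  measurable_fun setT (Re \o u) /\ measurable_fun setT (Im \o u).

Definition cintegral u : R[i] :=
  (\int[mu]_x Re (u x)) +i* (\int[mu]_x Im (u x)).

Definition clocally_integrable u := cmeasurable u /\
  forall K, compact K -> (\int[mu]_(x in K) (normc (u x))%:E < +oo)%E.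

(* G is the gradient of u in the sense of distributions. *)
Definition is_grad u (G : 'rV[R]_d -> 'rV[R[i]]_d) :=
  [/\ clocally_integrable u,
      forall j, clocally_integrable (fun x => G x ord0 j) &
      forall phi j, test_function phi ->
        cintegral (fun x => u x * cpartial j phi x) =
        - cintegral (fun x => G x ord0 j * phi x)].

Definition weakly_differentiable u := exists G, is_grad u G.

(* The distributional gradient is unique up to equality almost everywhere;
   [grad u] is an arbitrary representative of it, and is meaningful only when
   [weakly_differentiable u] holds. *)
Definition grad u : 'rV[R]_d -> 'rV[R[i]]_d :=
  if pselect (weakly_differentiable u) is left uP then projT1 (cid uP)
  else fun=> 0.

Definition mgrad A u (x : 'rV[R]_d) : 'rV[R[i]]_d :=
  \row_j (grad u x ord0 j + (0 +i* A x ord0 j) * u x).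

Definition mform A p u : \bar R :=
  (\int[mu]_x (cenorm (mgrad A u x) `^ p)%:E)%E.

Definition mform_norm A p u : \bar R :=
  ((mform A p u + \int[mu]_x (normc (u x) `^ p)%:E) `^ p^-1)%E.

(* The closure of C_c^oo(R^d) for [mform_norm], taken in the space of all
   (classes of) weakly differentiable functions whose norm is finite. *)
Definition mform_domain A p u :=
  [/\ weakly_differentiable u, (mform_norm A p u < +oo)%E &
      forall e : R, 0 < e -> exists2 phi, test_function phi &
        (mform_norm A p (fun x => u x - phi x)%R < e%:E)%E].

End magnetic_sobolev.

Definition hardy_cst {R : realType} (p : R) (d : nat) : R :=
  ((d%:R - p) / p) `^ p.

Definition remainder_cst {R : realType} (p : R) : R :=
  inf [set ((st.2 ^+ 2 + st.1 ^+ 2 + 2 * st.1 + 1) `^ (p / 2) - 1 - p * st.1)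
           / (st.2 ^+ 2 + st.1 ^+ 2) `^ (p / 2)
      | st in [set st : R * R | st <> (0, 0)]].

(* Main.v *)
(* For a test function u, apply the vector inequality
   |a + b|^p >= |a|^p + p |a|^(p-2) Re(a.b) + c(p) |b|^p to
   a = - k u x / |x|^2, with k = (d-p)/p, and b = grad_A u - a.  Since Re(a.b) does
   not see the magnetic potential, the middle term is - k^(p-1) times the
   divergence of |u|^p x / |x|^p; regularizing the weight |x|^(-p) into
   (|x|^2 + e)^(-p/2) only adds a term of the good sign.  As
   grad_A (u |x|^k) = |x|^k b, this is the theorem for test functions.
   Both sides pass to the closure: the regularized left-hand side is controlled
   by the norm of the domain, and e tends to 0 by Fatou.  The Hardy term so
   obtained makes |u| / |x| locally integrable, which is what the product rule
   for the weak gradient of u |x|^k requires near the origin. *)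

From HB Require Import structures.
Require Import Defs.
From mathcomp Require Import all_boot all_order all_algebra.
From mathcomp Require Import all_classical all_reals all_analysis.
From mathcomp Require Import measurable_realfun ring lra.
From mathcomp Require Import complex.

Set Implicit Arguments.
Unset Strict Implicit.
Unset Printing Implicit Defensive.

Import Order.TTheory GRing.Theory Num.Theory.
Import numFieldNormedType.Exports.

Local Open Scope classical_set_scope.
Local Open Scope complex_scope.
Local Open Scope ring_scope.

(** * Borel sets and integration on R^n *)

(** The vector inequality involves only X = |a|^2, Y = |b|^2 and Z = Re(a.b), tied by
    Cauchy-Schwarz. Dividing by |a|^p leaves s = Z/X and t^2 = Y/X - s^2, which is where the infimum
    over a plane in c(p) comes from; the bound c(p) <= 1 settles the case a = 0. Lengths are carried
    as squares raised to q = p/2. Since q >= 1, |u|^p has a continuous gradient even at the zeros of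
    u, so its divergence is integrated without smoothing the modulus. The passage to the closure
    cannot rely on linearity: the integrands are p-th powers, so u = phi + (u - phi) is split with a
    factor eta > 1 on the main part and a large constant on the error. That constant depends on eta
    and on e, and its bound grows like e^(-p/2) as e tends to 0. This fixes the order of the limits:
    phi to u, then eta to 1, then e to 0. A weak gradient is a chosen representative, so identities
    between weak gradients hold almost everywhere only and rest on uniqueness, that is on the du
    Bois-Reymond lemma. At the origin the convention [0^-1 = 0] gives every singular term a definite
    value. *)

Section measure_rV.
Context {R : realType}.
Implicit Types n : nat.

Definition obox n (a b : 'I_n -> R) : set 'rV[R]_n :=
  [set x | forall i, a i < x ord0 i < b i].

(** Closed sup-norm balls are compact, have finite measure and behave well when a coordinate is
    split off; vanishing outside some [cbox M] is the working form of compact support. *)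
Definition cbox n (M : R) : set 'rV[R]_n :=
  [set x | forall i, `|x ord0 i| <= M].

Lemma measurable_coord_preimage n (P : 'I_n -> set R) :
  (forall i, measurable (P i)) ->
  measurable [set x : 'rV[R]_n | forall i, P i (x ord0 i)].
Proof.
move=> mP.
rewrite (_ : [set x | _] =
    \bigcap_(i in [set: 'I_n]) ((fun x : 'rV[R]_n => x ord0 i) @^-1` P i)).
  apply: fin_bigcap_measurable; first exact: finite_finset.
  move=> i _; rewrite -[X in measurable X]setTI.
  exact: (measurable_coord i).
by apply/seteqP; split=> x /= h i; [move=> _; exact: h|exact: (h i)].
Qed.

Lemma measurable_obox n (a b : 'I_n -> R) : measurable (obox a b).
Proof.
rewrite (_ : obox a b =
    [set x : 'rV[R]_n | forall i, [set` `]a i, b i[] (x ord0 i)]).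
  apply: (measurable_coord_preimage (P := fun i => [set` `]a i, b i[])) => i.
  exact: measurable_itv.
by apply/seteqP; split=> x /= h i; have := h i; rewrite in_itv.
Qed.

Lemma measurable_cbox n M : measurable (@cbox n M).
Proof.
rewrite (_ : cbox M =
    [set x : 'rV[R]_n | forall i, [set` `[- M, M]] (x ord0 i)]).
  apply: (measurable_coord_preimage (P := fun=> [set` `[- M, M]])) => i.
  exact: measurable_itv.
by apply/seteqP; split=> x /= h i; have := h i; rewrite in_itv/= ler_norml.
Qed.

Definition rat_box n (q : {ffun 'I_n -> rat * rat}) : set 'rV[R]_n :=
  obox (fun i => ratr (q i).1) (fun i => ratr (q i).2).

(** The sigma-algebra is generated by coordinates, so open sets are reached through countable unions
    only. Boxes that are not inside [U] are replaced by [set0], so that the index runs over a whole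
    countable type. *)
Lemma open_rat_box n (U : set 'rV[R]_n) : open U ->
  U = \bigcup_(q in [set: {ffun 'I_n -> rat * rat}])
    (if pselect (rat_box q `<=` U) then rat_box q else set0).
Proof.
move=> oU; apply/seteqP; split=> [x Ux|x [q _]]; last first.
  by case: pselect => [qU /qU|].
have /nbhs_ballP[e /= e0 eU] := open_nbhs_nbhs (conj oU Ux).
have h (i : 'I_n) : exists q : rat * rat,
    [/\ x ord0 i - e < ratr q.1, ratr q.1 < x ord0 i,
     x ord0 i < ratr q.2 & ratr q.2 < x ord0 i + e :> R].
  have /rat_in_itvoo[a] : x ord0 i - e < x ord0 i by rewrite gtrBl.
  have /rat_in_itvoo[b] : x ord0 i < x ord0 i + e by rewrite ltrDl.
  rewrite !inE => /andP[? ?] /andP[? ?]; by exists (a, b).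
pose q := [ffun i => projT1 (cid (h i))].
have hq i : [/\ x ord0 i - e < ratr (q i).1, ratr (q i).1 < x ord0 i,
     x ord0 i < ratr (q i).2 & ratr (q i).2 < x ord0 i + e :> R].
  by rewrite ffunE; exact: (projT2 (cid (h i))).
exists q => //.
have qU : rat_box q `<=` U.
  move=> y yq; apply: eU; split=> // i j.
  rewrite !ord1; have /andP[? ?] := yq j; have [? ? ? ?] := hq j.
  rewrite /ball/= ltr_norml; lra.
by case: pselect => [{}qU|/(_ qU)//] i; have [_ -> -> _] := hq i.
Qed.

Lemma open_measurable_rV n (U : set 'rV[R]_n) : open U -> measurable U.
Proof.
move=> /open_rat_box ->; apply: countable_bigcupT_measurable => // q.
by case: pselect => [h|h]; [exact: measurable_obox|exact: measurable0].
Qed.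

Lemma closed_measurable_rV n (U : set 'rV[R]_n) : closed U -> measurable U.
Proof.
by move=> cU; rewrite -(setCK U); apply: measurableC;
  apply: open_measurable_rV; exact: closed_openC.
Qed.

Lemma continuous_measurable_rV n (f : 'rV[R]_n -> R) :
  continuous f -> measurable_fun setT f.
Proof.
move=> /continuousP cf; apply: (measurability _ (RGenOpens.measurableE R)).
move=> _ [_ [a [b ->]] <-]; rewrite setTI; apply: open_measurable_rV.
exact/cf/interval_open.
Qed.


Lemma pushforward_integrable n (f : 'rV[R]_n.+1 -> \bar R) :
  (lebesgue_rV n.+1).-integrable setT f ->
  (lebesgue_measure \x lebesgue_rV n)%E.-integrable setT (f \o @rV_cons R n).
Proof.
move=> /integrableP[mf fi]; apply/integrableP; split.
  by apply: measurableT_comp => //; exact: measurable_rV_cons.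
move: fi; rewrite /= /lebesgue_consr ge0_integral_pushforward//.
- exact: measurable_rV_cons.
- exact: measurableT_comp.
Qed.

Lemma integral_rVS n (f : 'rV[R]_n.+1 -> \bar R) :
  (lebesgue_rV n.+1).-integrable setT f ->
  (\int[lebesgue_rV n.+1]_x f x =
   \int[lebesgue_measure]_t \int[lebesgue_rV n]_y f (rV_cons (t, y)))%E.
Proof.
move=> fi; have /integrableP[mf _] := fi.
rewrite /= /lebesgue_consr integral_pushforward//.
- rewrite preimage_setT -integral12_prod_meas1//; exact: pushforward_integrable.
- exact: measurable_rV_cons.
- by rewrite preimage_setT; exact: pushforward_integrable.
Qed.

(** The order of integration needed when the first coordinate is the one differentiated. *)
Lemma integral_rVS_sym n (f : 'rV[R]_n.+1 -> \bar R) :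
  (lebesgue_rV n.+1).-integrable setT f ->
  (\int[lebesgue_rV n.+1]_x f x =
   \int[lebesgue_rV n]_y \int[lebesgue_measure]_t f (rV_cons (t, y)))%E.
Proof.
move=> fi; rewrite integral_rVS//.
apply: (Fubini (f := f \o @rV_cons R n)); exact: pushforward_integrable.
Qed.

Lemma rV_cons0 n t (y : 'rV[R]_n) : rV_cons (t, y) ord0 ord0 = t.
Proof. exact: (congr1 fst (rV_consK (t, y))). Qed.

Lemma rV_consS n t (y : 'rV[R]_n) i : rV_cons (t, y) ord0 (lift ord0 i) = y ord0 i.
Proof.
by move/(congr1 snd)/rowP/(_ i) : (rV_consK (t, y)); rewrite /= mxE.
Qed.

Lemma lebesgue_rV_cbox n M : (lebesgue_rV n (cbox M) < +oo)%E.
Proof.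
elim: n => [|n ih].
  by rewrite /= diracE; case: (_ \in _); rewrite ltry.
rewrite /= /lebesgue_consr /pushforward.
rewrite (_ : _ @^-1` _ = [set` `[- M, M]] `*` cbox M).
  rewrite product_measure1E//=; last exact: measurable_cbox.
  rewrite lte_mul_pinfty//.
  - rewrite ge0_fin_numE//.
    by rewrite lebesgue_measure_itv/=; case: ifP => // _; rewrite -EFinB ltry.
apply/seteqP; split=> -[t y] /=.
  move=> h; split=> [|i].
    by have := h ord0; rewrite rV_cons0 in_itv/= ler_norml.
  by have := h (lift ord0 i); rewrite rV_consS.
move=> -[/=]; rewrite in_itv/= -ler_norml => ht hy i.
by case: (unliftP ord0 i) => [j ->|->]; rewrite ?rV_cons0// rV_consS.
Qed.

Lemma integrable_bounded_support n (f : 'rV[R]_n -> R) M C :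
  measurable_fun setT f -> (forall x, `|f x| <= C) ->
  (forall x, ~ cbox M x -> f x = 0) ->
  (lebesgue_rV n).-integrable setT (EFin \o f).
Proof.
move=> mf fC f0.
apply: (@le_integrable _ _ _ _ _ _ _ (fun x => C%:E * (\1_(cbox M) x)%:E)%E) => //.
- exact/measurable_EFinP.
- move=> x _ /=; have C0 : 0 <= C by rewrite (le_trans _ (fC x)).
  rewrite indicE; have [xM|xM] := pselect (cbox M x).
    by rewrite mem_set// mulr1 lee_fin (ger0_norm C0).
  by rewrite f0// normr0 memNset// mulr0 normr0.
- apply: integrableZl => //; apply/integrableP; split.
    by apply/measurable_EFinP; apply: measurable_indic; exact: measurable_cbox.
  under eq_integral do rewrite gee0_abs ?lee_fin//.
  rewrite integral_indic ?setIT//; last exact: measurable_cbox.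
  exact: lebesgue_rV_cbox.
Qed.

Lemma compact_cbox n M : compact (@cbox n M).
Proof.
rewrite (_ : cbox M = [set x : 'rV[R]_n | forall i, [set` `[- M, M]] (x ord0 i)]).
  apply: (@rV_compact _ _ (fun=> [set` `[- M, M]])) => i.
  exact: segment_compact.
by apply/seteqP; split=> x /= h i; have := h i; rewrite /= in_itv/= ler_norml.
Qed.

Lemma continuous_bounded_cbox n (f : 'rV[R]_n -> R) M : continuous f ->
  exists C, forall x, cbox M x -> `|f x| <= C.
Proof.
move=> cf.
have : compact (f @` cbox M).
  by apply: continuous_compact; [exact: continuous_subspaceT|exact: compact_cbox].
move=> /compact_bounded[C [_ hC]].
exists (C + 1) => x xM; apply: hC; first by rewrite ltrDl.
by exists x.
Qed.

Lemma integrable_continuous n (f : 'rV[R]_n -> R) M : continuous f ->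
  (forall x, ~ cbox M x -> f x = 0) ->
  (lebesgue_rV n).-integrable setT (EFin \o f).
Proof.
move=> cf f0; have [C hC] := continuous_bounded_cbox M cf.
apply: (@integrable_bounded_support _ _ M `|C|) => //.
- exact: continuous_measurable_rV.
- move=> x; have [/hC h|/f0 ->] := pselect (cbox M x); last by rewrite normr0.
  by rewrite (le_trans h)// ler_norm.
Qed.

End measure_rV.

(** * Partial derivatives *)

Section partial_calculus.
Context {R : realType}.
Implicit Types n : nat.

Lemma continuous_rV (T : topologicalType) n (f : T -> 'rV[R]_n) :
  (forall i, continuous (fun x => f x ord0 i)) -> continuous f.
Proof.
move=> cf x A [P Px PA].
have : \forall y \near x, forall i, P ord0 i (f y ord0 i).
  by apply: filter_forall => i; apply: cf; exact: Px.
by apply: filterS => y h; apply: PA => i j; rewrite ord1.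
Qed.

Lemma continuous_rV_cons n (t : R) :
  continuous (fun y : 'rV[R]_n => rV_cons (t, y)).
Proof.
apply: continuous_rV => i; case: (unliftP ord0 i) => [j ->|->].
  by under eq_fun do rewrite rV_consS; exact: coord_continuous.
by under eq_fun do rewrite rV_cons0; exact: cst_continuous.
Qed.

Lemma continuous_rV_consl n (y : 'rV[R]_n) :
  continuous (fun t : R => rV_cons (t, y)).
Proof.
apply: continuous_rV => i; case: (unliftP ord0 i) => [j ->|->].
  by under eq_fun do rewrite rV_consS; exact: cst_continuous.
by under eq_fun do rewrite rV_cons0.
Qed.

Lemma closed_cbox n M : closed (@cbox R n M).
Proof. by apply: compact_closed; [exact: norm_hausdorff|exact: compact_cbox]. Qed.

(** The difference quotients along the line are literally those of [f] in the direction [v].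
    One-variable results (chain rule, fundamental theorem, test at a minimum) thus apply to partial
    derivatives with no total differentiability. *)
Lemma derive_shiftE (V : normedModType R) (W : normedModType R) (f : V -> W)
    x v (t : R) :
  'D_1 (fun t : R => f (t *: v + x)) t = 'D_v f (t *: v + x).
Proof.
have E : (fun h : R => h^-1 *: (((fun t : R => f (t *: v + x)) \o shift t) (h *: 1)
    - f (t *: v + x))) =
    (fun h => h^-1 *: ((f \o shift (t *: v + x)) (h *: v) - f (t *: v + x))).
  by apply/funext => h /=; rewrite scalerDl addrA -[h *: 1]/(h * 1) mulr1.
by rewrite /derive E.
Qed.

Lemma derivable_shiftE (V : normedModType R) (W : normedModType R) (f : V -> W)
    x v (t : R) :
  derivable (fun t : R => f (t *: v + x)) t 1 = derivable f (t *: v + x) v.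
Proof.
have E : (fun h : R => h^-1 *: (((fun t : R => f (t *: v + x)) \o shift t) (h *: 1)
    - f (t *: v + x))) =
    (fun h => h^-1 *: ((f \o shift (t *: v + x)) (h *: v) - f (t *: v + x))).
  by apply/funext => h /=; rewrite scalerDl addrA -[h *: 1]/(h * 1) mulr1.
by rewrite /derivable E.
Qed.

Lemma rV_lineE n (h : R) (e w : 'rV[R]_n) i :
  (h *: e + w) ord0 i = h * e ord0 i + w ord0 i.
Proof. by rewrite !mxE. Qed.

Lemma delta_rVE n (i j : 'I_n) :
  (delta_mx ord0 j : 'rV[R]_n) ord0 i = (i == j)%:R.
Proof. by rewrite mxE eqxx. Qed.

Lemma rV_consD n (t : R) (y : 'rV[R]_n) h j :
  rV_cons (t, h *: delta_mx ord0 j + y) =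
  h *: delta_mx ord0 (lift ord0 j) + rV_cons (t, y).
Proof.
apply/rowP => i; rewrite rV_lineE delta_rVE.
case: (unliftP ord0 i) => [k ->|->].
  by rewrite !rV_consS rV_lineE delta_rVE (inj_eq lift_inj).
by rewrite !rV_cons0 (negbTE (neq_lift _ _)) mulr0 add0r.
Qed.

Lemma rV_consD0 n (t : R) (y : 'rV[R]_n) :
  rV_cons (t, y) = t *: delta_mx ord0 ord0 + rV_cons (0, y).
Proof.
apply/rowP => i; rewrite rV_lineE delta_rVE.
case: (unliftP ord0 i) => [k ->|->].
  by rewrite !rV_consS eq_sym (negbTE (neq_lift _ _)) mulr0 add0r.
by rewrite !rV_cons0 eqxx mulr1 addr0.
Qed.

Lemma partial_cons n (f : 'rV[R]_n.+1 -> R) t j y :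
  partial j (fun y => f (rV_cons (t, y))) y =
  partial (lift ord0 j) f (rV_cons (t, y)).
Proof.
have E : (fun h : R => h^-1 *: (((fun y => f (rV_cons (t, y))) \o shift y)
    (h *: delta_mx ord0 j) - f (rV_cons (t, y)))) =
    (fun h => h^-1 *: ((f \o shift (rV_cons (t, y)))
      (h *: delta_mx ord0 (lift ord0 j)) - f (rV_cons (t, y)))).
  by apply/funext => h /=; rewrite rV_consD.
by rewrite /partial /derive E.
Qed.

Lemma derivable_cons n (f : 'rV[R]_n.+1 -> R) t j y :
  derivable (fun y => f (rV_cons (t, y))) y (delta_mx ord0 j) =
  derivable f (rV_cons (t, y)) (delta_mx ord0 (lift ord0 j)).
Proof.
have E : (fun h : R => h^-1 *: (((fun y => f (rV_cons (t, y))) \o shift y)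
    (h *: delta_mx ord0 j) - f (rV_cons (t, y)))) =
    (fun h => h^-1 *: ((f \o shift (rV_cons (t, y)))
      (h *: delta_mx ord0 (lift ord0 j)) - f (rV_cons (t, y)))).
  by apply/funext => h /=; rewrite rV_consD.
by rewrite /derivable E.
Qed.

Lemma partial_near_cst n (f : 'rV[R]_n -> R) j x (c : R) :
  (\forall y \near x, f y = c) -> partial j f x = 0.
Proof.
move=> fc; rewrite /partial (near_eq_derive _ (g := cst c)) ?derive_cst//.
Qed.

Lemma partial_outside n (f : 'rV[R]_n -> R) j M :
  (forall x, ~ cbox M x -> f x = 0) ->
  (forall x, ~ cbox M x -> partial j f x = 0).
Proof.
move=> f0 x xM; apply: (@partial_near_cst _ _ _ _ 0).
have : open_nbhs x (~` cbox M).
  by split => //; apply: closed_openC; exact: closed_cbox.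
by move=> /open_nbhs_nbhs; apply: filterS => y; exact: f0.
Qed.

Lemma integral_derive_compact (f g : R -> R) (M : R) :
  (forall t : R, is_derive t 1 f (g t)) -> continuous g ->
  (forall t, M < `|t| -> f t = 0) ->
  (\int[lebesgue_measure]_t (g t)%:E = 0)%E.
Proof.
(* The choice makes [a] positive and strictly above [M] even when [M] is negative: [f] vanishes at
   both endpoints and [g] outside the interval. *)
move=> fg cg f0; pose a : R := `|M| + 1.
have Ma : M < a by rewrite /a (le_lt_trans (ler_norm _))// ltrDl.
have a0 : 0 < a by rewrite /a ltr_wpDl.
have cf : continuous f.
  move=> t; apply: differentiable_continuous; apply/derivable1_diffP.
  by have [] := fg t.
have g0 t : M < `|t| -> g t = 0.
  move=> tM; have [_ <-] := fg t.
  rewrite (near_eq_derive _ (g := cst 0)) ?derive_cst//.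
  have : \forall s \near t, M < `|s|.
    by have /cvgr_gt/(_ _ tM) := @norm_continuous _ R t.
  by apply: filterS => s /f0.
transitivity (\int[lebesgue_measure]_(t in `[(- a)%R, a]) (g t)%:E)%E.
  rewrite [RHS]integral_mkcond; apply: eq_integral => t _.
  rewrite patchE; case: ifPn => //; rewrite notin_setE /= in_itv/= -ler_norml.
  by move=> /negP; rewrite -ltNge => ta; rewrite g0// (lt_trans Ma).
rewrite (@continuous_FTC2 _ g f).
- by rewrite !f0 ?normrN ?gtr0_norm// subee.
- by rewrite gtrN.
- exact: continuous_subspaceT.
- split.
  + by move=> t _; have [] := fg t.
  + by apply: cvg_at_right_filter; exact: cf.
  + by apply: cvg_at_left_filter; exact: cf.
- by move=> t _; rewrite derive1E; have [] := fg t.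
Qed.

(** Induction on the dimension. A direction other than the first is a direction of the slice,
    handled by the induction hypothesis at fixed first coordinate; for the first direction Fubini
    puts that coordinate innermost and the one-variable statement applies. *)
Lemma integral_partial n (j : 'I_n) (f : 'rV[R]_n -> R) M :
  (forall x, derivable f x (delta_mx ord0 j)) ->
  continuous (partial j f) ->
  (forall x, ~ cbox M x -> f x = 0) ->
  (\int[lebesgue_rV n]_x (partial j f x)%:E = 0)%E.
Proof.
elim: n j f => [[]//|n ih] j f df cf f0.
have fi := integrable_continuous cf (partial_outside j f0).
case: (unliftP ord0 j) => [k jk|j0].
  rewrite integral_rVS//.
  transitivity (\int[lebesgue_measure]_(t in [set: R]) (0 : \bar R))%E;
    last exact: integral0.
  apply: eq_integral => t _.
  transitivity (\int[lebesgue_rV n]_y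
      (partial k (fun y => f (rV_cons (t, y))) y)%:E)%E.
    by apply: eq_integral => y _; rewrite partial_cons jk.
  apply: ih.
  - by move=> y; rewrite derivable_cons -jk.
  - rewrite (_ : partial _ _ = partial j f \o (fun y => rV_cons (t, y))).
      move=> y; apply: continuous_comp; first exact: continuous_rV_cons.
      exact: cf.
    by apply/funext => y; rewrite partial_cons -jk.
  - move=> y yM; apply: f0 => h; apply: yM => i.
    by have := h (lift ord0 i); rewrite rV_consS.
subst j; rewrite integral_rVS_sym//.
transitivity (\int[lebesgue_rV n]_(y in [set: 'rV[R]_n]) (0 : \bar R))%E;
  last exact: integral0.
apply: eq_integral => y _.
apply: (@integral_derive_compact (fun t => f (rV_cons (t, y))) _ M).
- move=> t; under eq_fun do rewrite rV_consD0.
  apply: DeriveDef; first by rewrite derivable_shiftE -rV_consD0.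
  by rewrite derive_shiftE -rV_consD0.
- move=> t; apply: (@continuous_comp _ _ _ (fun t => rV_cons (t, y)) (partial ord0 f)).
    exact: continuous_rV_consl.
  exact: cf.
- move=> t tM; apply: f0 => /(_ ord0); rewrite rV_cons0 leNgt.
  by move=> /negP; apply.
Qed.

End partial_calculus.

(** * Smooth functions *)

Section smooth_functions.
Context {R : realType}.
Implicit Types n k : nat.

(** On the line [t *: v + x] this is the one-variable chain rule, so a derivative of [f] in the
    single direction [v] suffices. *)
Lemma is_derive_chain (V : normedModType R) (f : V -> R) (g : R -> R) x v df dg :
  is_derive x v f df -> is_derive (f x) 1 g dg ->
  is_derive x v (fun y => g (f y)) (dg * df).
Proof.
move=> [fx <-] gx.
pose F (t : R) := f (t *: v + x).
have FE : is_derive (0 : R) 1 F ('D_v f x).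
  by apply: DeriveDef; rewrite ?derivable_shiftE ?derive_shiftE scale0r add0r.
have gx' : is_derive (F 0) 1 g dg by rewrite /F scale0r add0r.
have [dGF eGF] := is_derive1_comp gx' FE.
apply: DeriveDef.
- by have := derivable_shiftE (fun y => g (f y)) x v 0;
    rewrite scale0r add0r => <-.
- by have := derive_shiftE (fun y => g (f y)) x v 0;
    rewrite scale0r add0r => <-.
Qed.

Lemma is_derive_mul (V : normedModType R) (f g : V -> R) x v df dg :
  is_derive x v f df -> is_derive x v g dg ->
  is_derive x v (fun y => f y * g y) (f x * dg + g x * df).
Proof. exact: is_deriveM. Qed.

Lemma CkW n k (f : 'rV[R]_n -> R) : Ck k.+1 f -> Ck k f.
Proof.
elim: k f => [|k ih] f [cf hf]; split => // j.
by have [df /ih] := hf j.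
Qed.

Lemma Ck_continuous n k (f : 'rV[R]_n -> R) : Ck k f -> continuous f.
Proof. by case: k => [|k] []. Qed.

Lemma partialD n (f g : 'rV[R]_n -> R) j x :
  derivable f x (delta_mx ord0 j) -> derivable g x (delta_mx ord0 j) ->
  partial j (fun x => f x + g x) x = partial j f x + partial j g x.
Proof. exact: deriveD. Qed.

Lemma partialM n (f g : 'rV[R]_n -> R) j x :
  derivable f x (delta_mx ord0 j) -> derivable g x (delta_mx ord0 j) ->
  partial j (fun x => f x * g x) x = f x * partial j g x + g x * partial j f x.
Proof. exact: deriveM. Qed.

Lemma partial_cst n (c : R) (j : 'I_n) x : partial j (fun=> c) x = 0.
Proof. exact: derive_cst. Qed.

Lemma is_derive_coord n (i j : 'I_n) (x : 'rV[R]_n) :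
  is_derive x (delta_mx ord0 j) (fun x : 'rV[R]_n => x ord0 i) (i == j)%:R.
Proof.
pose e : 'rV[R]_n := delta_mx ord0 j.
have h (t : R) : is_derive t 1 (fun t : R => (t *: e + x) ord0 i) (i == j)%:R.
  rewrite (_ : (fun _ => _) = (fun t : R => (i == j)%:R * t + x ord0 i)).
    by apply: is_derive_eq; rewrite addr0 [_%:A]mulr1.
  by apply/funext => s; rewrite rV_lineE delta_rVE mulrC.
have [h1 h2] := h 0.
apply: DeriveDef.
- by have := derivable_shiftE (fun x : 'rV[R]_n => x ord0 i) x e 0;
    rewrite scale0r add0r => <-.
- by have := derive_shiftE (fun x : 'rV[R]_n => x ord0 i) x e 0;
    rewrite scale0r add0r => <-.
Qed.

Lemma partial_coord n (i j : 'I_n) (x : 'rV[R]_n) :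
  partial j (fun x : 'rV[R]_n => x ord0 i) x = (i == j)%:R.
Proof. by have [_] := is_derive_coord i j x. Qed.

Lemma Ck_cst n k (c : R) : Ck k (fun _ : 'rV[R]_n => c).
Proof.
elim: k c => [|k ih] c; split; [exact: cst_continuous|by []|exact: cst_continuous|].
move=> j; split; first by move=> x; exact: derivable_cst.
by rewrite (_ : partial _ _ = fun=> 0)//; apply/funext => x; rewrite partial_cst.
Qed.

Lemma Ck_coord n k (i : 'I_n) : Ck k (fun x : 'rV[R]_n => x ord0 i).
Proof.
case: k => [|k]; split; [exact: coord_continuous|by []|exact: coord_continuous|].
move=> j; split; first by move=> x; have [] := is_derive_coord i j x.
rewrite (_ : partial _ _ = fun=> (i == j)%:R); first exact: Ck_cst.
by apply/funext => x; rewrite partial_coord.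
Qed.

Lemma CkD n k (f g : 'rV[R]_n -> R) :
  Ck k f -> Ck k g -> Ck k (fun x => f x + g x).
Proof.
elim: k f g => [|k ih] f g [cf hf] [cg hg].
  by split => // x; apply: continuousD; [exact: cf|exact: cg].
split; first by move=> x; apply: continuousD; [exact: cf|exact: cg].
move=> j; have [df pf] := hf j; have [dg pg] := hg j; split.
  by move=> x; apply: derivableD.
rewrite (_ : partial _ _ = fun x => partial j f x + partial j g x); first exact: ih.
by apply/funext => x; rewrite partialD.
Qed.

Lemma CkM n k (f g : 'rV[R]_n -> R) :
  Ck k f -> Ck k g -> Ck k (fun x => f x * g x).
Proof.
elim: k f g => [|k ih] f g Cf Cg.
  have [cf _] := Cf; have [cg _] := Cg.
  by split => // x; apply: continuousM; [exact: cf|exact: cg].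
have [cf hf] := Cf; have [cg hg] := Cg.
split; first by move=> x; apply: continuousM; [exact: cf|exact: cg].
move=> j; have [df pf] := hf j; have [dg pg] := hg j; split.
  by move=> x; apply: derivableM.
rewrite (_ : partial _ _ =
    fun x => f x * partial j g x + g x * partial j f x).
  by apply: CkD; apply: ih => //; exact: CkW.
by apply/funext => x; rewrite partialM.
Qed.

Lemma Ck_sum n k (I : Type) (s : seq I) (F : I -> 'rV[R]_n -> R) :
  (forall i, Ck k (F i)) -> Ck k (fun x => \sum_(i <- s) F i x).
Proof.
move=> CF; elim: s => [|i s ih].
  by under eq_fun do rewrite big_nil; exact: Ck_cst.
by under eq_fun do rewrite big_cons; exact: CkD.
Qed.

Lemma Ck_prod n k (I : Type) (s : seq I) (F : I -> 'rV[R]_n -> R) :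
  (forall i, Ck k (F i)) -> Ck k (fun x => \prod_(i <- s) F i x).
Proof.
move=> CF; elim: s => [|i s ih].
  by under eq_fun do rewrite big_nil; exact: Ck_cst.
by under eq_fun do rewrite big_cons; exact: CkM.
Qed.

Lemma derivable_continuous_at (g : R -> R) (t dg : R) :
  is_derive t 1 g dg -> {for t, continuous g}.
Proof.
by move=> [dg' _]; apply: differentiable_continuous; apply/derivable1_diffP.
Qed.

(** The derivative of a member of the family is a combination of two members, so induction on [k]
    never leaves the family. Two terms are what [theta] produces; powers need one, the other
    coefficient being 0. *)
Lemma Ck_comp_family n k (I : Type) (G : I -> R -> R) (D : set R) :
  (forall i, exists c1 i1 c2 i2, forall t, D t ->
    is_derive t 1 (G i) (c1 * G i1 t + c2 * G i2 t)) ->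
  forall (f : 'rV[R]_n -> R) i, (forall x, D (f x)) -> Ck k f ->
  Ck k (fun x => G i (f x)).
Proof.
move=> dG f i Df; elim: k i => [|k ih] i Cf.
  have cG j : continuous (fun x => G j (f x)).
    move=> x; apply: continuous_comp; first by have [cf _] := Cf; exact: cf.
    by have [c1 [i1 [c2 [i2 /(_ _ (Df x))]]]] := dG j; exact: derivable_continuous_at.
  by split.
have cG j : continuous (fun x => G j (f x)).
  move=> x; apply: continuous_comp; first by have [cf _] := Cf; exact: cf.
  by have [c1 [i1 [c2 [i2 /(_ _ (Df x))]]]] := dG j; exact: derivable_continuous_at.
split=> // j; have [_ /(_ j)[df pf]] := Cf.
have [c1 [i1 [c2 [i2 dGi]]]] := dG i.
have dGf x := is_derive_chain (derivableP (df x)) (dGi _ (Df x)).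
split; first by move=> x; have [] := dGf x.
rewrite (_ : partial _ _ = fun x =>
    (c1 * G i1 (f x) + c2 * G i2 (f x)) * partial j f x).
  apply: CkM => //; apply: CkD; apply: CkM; try exact: Ck_cst;
    by apply: ih; exact: CkW.
by apply/funext => x; have [_] := dGf x.
Qed.

(** The functions t^(-m) exp(-1/t), extended by 0. [theta 0] is the classical flat smooth function;
    the others are added so that the family is stable under differentiation. *)
Definition theta m (t : R) : R :=
  if 0 < t then t^-1 ^+ m * expR (- t^-1) else 0.

Lemma theta_ge0 m (t : R) : 0 <= theta m t.
Proof.
rewrite /theta; case: ifPn => // t0.
by rewrite mulr_ge0 ?expR_ge0// exprn_ge0// invr_ge0 ltW.
Qed.

(** With y = 1/t, the bound exp y >= y^(m+1) / (m+1)! comes from the exponential series. A bound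
    linear in t is just enough to get derivative 0 at the origin. *)
Lemma theta_le m (t : R) : 0 < t -> theta m t <= (m.+1)`!%:R * t.
Proof.
move=> t0; rewrite /theta t0 expRN.
have y0 : 0 < t^-1 by rewrite invr_gt0.
have := expR_ge1Dxn m (ltW y0); set y := t^-1 in y0 * => h.
have {}h : y ^+ m.+1 / m.+1`!%:R <= expR y by lra.
have f0 : 0 < m.+1`!%:R :> R by rewrite ltr0n fact_gt0.
rewrite ler_pdivrMr ?expR_gt0//.
have {h} : m.+1`!%:R * t * (y ^+ m.+1 / m.+1`!%:R) <= m.+1`!%:R * t * expR y.
  by rewrite ler_pM2l// mulr_gt0.
apply: le_trans; rewrite exprS.
have -> : m.+1`!%:R * t * (y * y ^+ m / m.+1`!%:R) =
  (m.+1`!%:R / m.+1`!%:R) * (t * y) * y ^+ m by ring.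
by rewrite divff ?gt_eqF// /y divff ?gt_eqF// !mul1r.
Qed.

Lemma is_derive_theta m (t : R) :
  is_derive t 1 (theta m) (- m%:R * theta m.+1 t + 1 * theta m.+2 t).
Proof.
have [t0|t0|->] := ltgtP t 0.
- rewrite /theta !ltNge (ltW t0)/= !mulr0 addr0.
  apply: (@near_eq_is_derive _ _ _ (cst 0)).
  near=> s; rewrite ltNge; suff /ltW -> : s < 0 by [].
  by near: s; exact: lt_nbhsl.
- rewrite /theta t0.
  apply: (near_eq_is_derive (f := fun t : R => t^-1 ^+ m * expR (- t^-1))).
    near=> s; suff -> : 0 < s by [].
    by near: s; exact: lt_nbhsr.
  have t1 : t != 0 by rewrite gt_eqF.
  have dV : is_derive t 1 (fun t : R => t^-1) (- t ^- 2).
    apply: DeriveDef; first exact: (derivableV (f := id)).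
    rewrite (deriveV (f := id))// derive_id.
    by rewrite [LHS]mulr1.
  have dE : is_derive t 1 (fun t : R => expR (- t^-1)) (expR (- t^-1) * t ^- 2).
    have dN : is_derive t 1 (fun t : R => - t^-1) (t ^- 2).
      by rewrite -[X in is_derive _ _ _ X]opprK; exact: is_deriveN dV.
    exact: (is_derive_chain dN (is_derive_expR _)).
  have dX : is_derive t 1 (fun t : R => t^-1 ^+ m)
      (m%:R * t^-1 ^+ m.-1 * - t ^- 2).
    apply: (is_derive_chain (f := fun t : R => t^-1) (g := fun y => y ^+ m)) => //.
    apply: DeriveDef; first exact: exprn_derivable.
    by rewrite exp_derive /GRing.scale/= mulr1.
  apply: is_derive_eq; rewrite /GRing.scale/= -exprVn; set E := expR _; set y := t^-1.
  case: m {dX} => [|m] /=; first by rewrite !expr2 expr0; ring.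
  by rewrite !exprS; ring.
- rewrite {2 3}/theta ltxx !mulr0 addr0.
  have h0 : (fun h : R => h^-1 *: ((theta m \o shift 0) (h *: 1) - theta m 0))
      @ 0^' --> (0 : R).
    apply/cvgrPdist_le => e e0.
    have f0 : 0 < m.+2`!%:R :> R by rewrite ltr0n fact_gt0.
    near=> h.
    rewrite /= addr0 [theta m 0]/theta ltxx subr0 sub0r normrN.
    rewrite -[h *: 1]/(h * 1) mulr1 -[_ *: _]/(h^-1 * theta m h).
    have [h0|h0] := leP h 0.
      by rewrite /theta ltNge h0/= mulr0 normr0 ltW.
    (* Dividing by [h] raises the index by one, so the difference quotient at 0 is itself bounded
       linearly by [theta_le]. *)
    have -> : h^-1 * theta m h = theta m.+1 h by rewrite /theta h0 exprS mulrA.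
    rewrite ger0_norm ?theta_ge0// (le_trans (theta_le _ h0))//.
    rewrite mulrC -ler_pdivlMr// (le_trans (ler_norm _))//.
    by near: h; apply: dnbhs0_le; rewrite divr_gt0.
  apply: DeriveDef; last exact: cvg_lim h0.
  by apply/cvg_ex; exists 0.
Unshelve. all: by end_near. Qed.

Lemma Ck_theta n k m (f : 'rV[R]_n -> R) : Ck k f -> Ck k (fun x => theta m (f x)).
Proof.
move=> Cf; apply: (@Ck_comp_family _ _ _ theta setT) => // i.
exists (- i%:R), i.+1, 1, i.+2 => t _; exact: is_derive_theta.
Qed.

Lemma Ck_powR n k a (f : 'rV[R]_n -> R) : (forall x, 0 < f x) ->
  Ck k f -> Ck k (fun x => f x `^ a).
Proof.
move=> f0 Cf.
apply: (@Ck_comp_family _ _ _ (fun a t => t `^ a) [set t | 0 < t]) => // i.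
exists i, (i - 1), 0, 0 => t /= t0; rewrite mul0r addr0.
exact: is_derive1_powR.
Qed.

Definition sqnorm n (x : 'rV[R]_n) : R := \sum_j x ord0 j ^+ 2.

Lemma sqnorm_ge0 n (x : 'rV[R]_n) : 0 <= sqnorm x.
Proof. by apply: sumr_ge0 => i _; exact: sqr_ge0. Qed.

Lemma Ck_sqnorm n k : Ck k (@sqnorm n).
Proof.
apply: Ck_sum => i; under eq_fun do rewrite expr2.
by apply: CkM; exact: Ck_coord.
Qed.

Lemma is_derive_sqnorm n j (x : 'rV[R]_n) :
  is_derive x (delta_mx ord0 j) (@sqnorm n) (2 * x ord0 j).
Proof.
rewrite (_ : @sqnorm n = \sum_(i < n) (fun x : 'rV[R]_n => x ord0 i ^+ 2)); last first.
  by apply/funext => y; rewrite fct_sumE.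
have h (i : 'I_n) : is_derive x (delta_mx ord0 j)
    (fun x : 'rV[R]_n => x ord0 i ^+ 2) (2 * x ord0 i * (i == j)%:R).
  have := is_derive_chain (g := fun y => y ^+ 2) (is_derive_coord i j x).
  apply; apply: is_derive_eq.
  by rewrite /GRing.scale/= mulr1 -mulr2n mulr_natl.
apply: is_derive_eq; rewrite (bigD1 j)//= eqxx mulr1 big1 ?addr0// => i ij.
by rewrite (negbTE ij) mulr0.
Qed.

Lemma is_derive_powR_sqnorm n j (x : 'rV[R]_n) e a : 0 < e ->
  is_derive x (delta_mx ord0 j) (fun x : 'rV[R]_n => (sqnorm x + e) `^ a)
    (a * (sqnorm x + e) `^ (a - 1) * (2 * x ord0 j)).
Proof.
move=> e0.
apply: (is_derive_chain (f := fun x => sqnorm x + e) (g := fun t => t `^ a)).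
  apply: is_derive_eq; last exact: addr0.
  by apply: is_deriveD; exact: is_derive_sqnorm.
by apply: is_derive1_powR; rewrite ltr_wpDl// sqnorm_ge0.
Qed.

Lemma Ck_powR_sqnorm n k e a : 0 < e ->
  Ck k (fun x : 'rV[R]_n => (sqnorm x + e) `^ a).
Proof.
move=> e0; apply: Ck_powR; first by move=> x; rewrite ltr_wpDl// sqnorm_ge0.
by apply: CkD; [exact: Ck_sqnorm|exact: Ck_cst].
Qed.

(** Smooth, between 0 and 1, and zero off the open box; the scaling by [m.+1] steepens the sides, so
    that as m grows the bumps converge pointwise to the indicator of the box, under a bound fit for
    dominated convergence. *)
Definition box_bump n (a b : 'I_n -> R) m (x : 'rV[R]_n) : R :=
  \prod_i (theta 0 (m.+1%:R * (x ord0 i - a i)) *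
           theta 0 (m.+1%:R * (b i - x ord0 i))).

Lemma smooth_box_bump n (a b : 'I_n -> R) m : smooth (box_bump a b m).
Proof.
move=> k; apply: Ck_prod => i; apply: CkM; apply: Ck_theta; apply: CkM;
  try exact: Ck_cst.
  by apply: CkD; [exact: Ck_coord|exact: Ck_cst].
apply: CkD; first exact: Ck_cst.
under eq_fun do rewrite -mulN1r.
by apply: CkM; [exact: Ck_cst|exact: Ck_coord].
Qed.

Lemma theta0_le1 (t : R) : theta 0 t <= 1.
Proof.
rewrite /theta; case: ifPn => // t0.
by rewrite expr0 mul1r -expR0 ler_expR oppr_le0 invr_ge0 ltW.
Qed.

Lemma theta_le0 m (t : R) : t <= 0 -> theta m t = 0.
Proof. by rewrite /theta ltNge => ->. Qed.

Lemma box_bump_ge0 n (a b : 'I_n -> R) m x : 0 <= box_bump a b m x.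
Proof. by apply: prodr_ge0 => i _; rewrite mulr_ge0// theta_ge0. Qed.

Lemma box_bump_le1 n (a b : 'I_n -> R) m x : box_bump a b m x <= 1.
Proof.
apply: prodr_ile1 => i _; rewrite mulr_ge0 ?theta_ge0//=.
by rewrite mulr_ile1 ?theta_ge0// theta0_le1.
Qed.

Lemma box_bump_out n (a b : 'I_n -> R) m x :
  ~ obox a b x -> box_bump a b m x = 0.
Proof.
move=> /existsNP[i /negP]; rewrite negb_and -!leNgt => h.
rewrite /box_bump (bigD1 i)//= [X in X * _](_ : _ = 0) ?mul0r//.
case/orP: h => h.
  by rewrite theta_le0 ?mul0r// mulr_ge0_le0// subr_le0.
by rewrite [X in _ * X]theta_le0 ?mulr0// mulr_ge0_le0// subr_le0.
Qed.

Lemma cvg_theta0 (t : R) : 0 < t -> theta 0 (m.+1%:R * t) @[m --> \oo] --> (1 : R).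
Proof.
move=> t0.
rewrite (_ : (fun m => _) = (fun m : nat => expR (- (m.+1%:R^-1 * t^-1)))).
  rewrite -[X in _ --> X]expR0; apply: (@continuous_cvg _ _ _ _ _ _ expR); first exact: continuous_expR.
  rewrite -[X in _ --> X]oppr0; apply: cvgN.
  rewrite -(mul0r t^-1); apply: cvgMl; exact: cvg_harmonic.
apply/funext => m; rewrite /theta mulr_gt0// expr0 mul1r.
by rewrite invfM.
Qed.

Lemma cvg_prod_seq (I : Type) (s : seq I) (F : I -> nat -> R) (l : I -> R) :
  (forall i, F i m @[m --> \oo] --> l i) ->
  \prod_(i <- s) F i m @[m --> \oo] --> \prod_(i <- s) l i.
Proof.
move=> h; elim: s => [|i s ih].
  by under eq_fun do rewrite big_nil; rewrite big_nil; exact: cvg_cst.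
by under eq_fun do rewrite big_cons; rewrite big_cons; exact: cvgM.
Qed.

Lemma cvg_box_bump n (a b : 'I_n -> R) x :
  box_bump a b m x @[m --> \oo] --> (\1_(obox a b) x : R).
Proof.
rewrite indicE; have [xab|xab] := pselect (obox a b x); last first.
  rewrite memNset//.
  by under eq_fun do rewrite box_bump_out//; exact: cvg_cst.
rewrite mem_set//.
rewrite [X in _ --> X](_ : _ = \prod_(i < n) (1 * 1)); last first.
  by rewrite big1// => i _; rewrite mulr1.
apply: cvg_prod_seq => i; have /andP[ai bi] := xab i.
by apply: cvgM; apply: cvg_theta0; rewrite subr_gt0.
Qed.

End smooth_functions.

(** * The du Bois-Reymond lemma *)

Section test_functions.
Context {R : realType}.
Implicit Types n : nat.

Lemma norm_coord_le n (x : 'rV[R]_n) i : `|x ord0 i| <= `|x|.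
Proof.
rewrite [leRHS]/Num.Def.normr/= mx_normrE.
exact: (le_bigmax _ (fun i : 'I_1 * 'I_n => `|x i.1 i.2|) (ord0, i)).
Qed.

Lemma test_function_support n (phi : 'rV[R]_n -> R[i]) : test_function phi ->
  exists M, forall x, ~ cbox M x -> phi x = 0.
Proof.
move=> [_ /compact_bounded[M [_ hM]]]; exists (M + 1) => x xM.
apply/eqP; apply: contrapT => /negP phix; apply: xM => i.
rewrite (le_trans (norm_coord_le _ _))//; apply: hM; first by rewrite ltrDl.
exact: subset_closure.
Qed.

Lemma test_function_cbox n (phi : 'rV[R]_n -> R[i]) M : csmooth phi ->
  (forall x, ~ cbox M x -> phi x = 0) -> test_function phi.
Proof.
move=> sphi phi0; split => //.
apply: (subclosed_compact _ (compact_cbox (M := M))); first exact: closed_closure.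
rewrite (closure_id (cbox M)).1; last exact: closed_cbox.
apply: closure_subset => x /= phix; apply: contrapT => /phi0 /eqP.
by apply/negP.
Qed.

Lemma smooth_cst n (c : R) : smooth (fun _ : 'rV[R]_n => c).
Proof. by move=> k; exact: Ck_cst. Qed.

Lemma test_function_real n (f : 'rV[R]_n -> R) M : smooth f ->
  (forall x, ~ cbox M x -> f x = 0) -> test_function (fun x => (f x)%:C).
Proof.
move=> sf f0; apply: (@test_function_cbox _ _ M); last by move=> x /f0 ->.
by split => //; exact: smooth_cst.
Qed.

End test_functions.

Section density.
Context d (T : measurableType d) {R : realType} (mu : {measure set T -> \bar R}).
Variable f : T -> \bar R.
Hypotheses (mf : measurable_fun setT f) (f0 : forall x, (0 <= f x)%E).

(** The proofs of measurability and nonnegativity are arguments so that the measure structure, which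
    depends on them, can be inferred from the term. *)
Definition density of measurable_fun setT f & (forall x, (0 <= f x)%E) :=
  fun A => (\int[mu]_(t in A) f t)%E.

Let density0 : density mf f0 set0 = 0%E.
Proof. exact: integral_set0. Qed.

Let density_ge0 A : (0 <= density mf f0 A)%E.
Proof. exact: integral_ge0. Qed.

Let density_sigma_additive : semi_sigma_additive (density mf f0).
Proof. exact: semi_sigma_additive_nng_induced. Qed.

HB.instance Definition _ := isMeasure.Build _ _ _ (density mf f0)
  density0 density_ge0 density_sigma_additive.

End density.

Section du_bois_reymond.
Context {R : realType}.
Variable n : nat.

Definition oboxes : set (set 'rV[R]_n) := [set A | exists a b, A = obox a b].

Lemma oboxes_setI : setI_closed oboxes.
Proof.
move=> _ _ [a [b ->]] [a' [b' ->]].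
exists (fun i => Num.max (a i) (a' i)), (fun i => Num.min (b i) (b' i)).
apply/seteqP; split => x /=.
  move=> [h h'] i; have /andP[? ?] := h i; have /andP[? ?] := h' i.
  by rewrite gt_max lt_min; apply/andP; split; apply/andP.
move=> h; split=> i; have := h i; rewrite gt_max lt_min.
  by move=> /andP[/andP[? ?] /andP[? ?]]; apply/andP.
by move=> /andP[/andP[? ?] /andP[? ?]]; apply/andP.
Qed.

Lemma coord_bound (x : 'rV[R]_n) : exists k : nat, forall i, `|x ord0 i| < k.+1%:R.
Proof.
exists (Num.trunc `|x|) => i.
by rewrite (le_lt_trans (norm_coord_le _ _))// truncnS_gt.
Qed.

(** Open boxes form a pi-system generating the sigma-algebra, which is what uniqueness of measures
    asks for. *)
Lemma measurable_oboxes : @measurable _ 'rV[R]_n = <<s oboxes >>.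
Proof.
apply/seteqP; split; last first.
  apply: smallest_sub; first exact: sigma_algebra_measurable.
  by move=> _ [a [b ->]]; exact: measurable_obox.
have mcoord (i : 'I_n) : measurable_fun setT
    (fun x : g_sigma_algebraType oboxes => (x : 'rV[R]_n) ord0 i).
  apply: (measurability _ (RGenOpens.measurableE R)).
  move=> _ [_ [a [b ->]] <-]; rewrite setTI.
  (* A slab constrains one coordinate only, hence is not a box; it is the increasing union of boxes
     whose other sides are ]-(k+1), k+1[. *)
  pose A k : set (g_sigma_algebraType oboxes) := obox
    (fun j => if j == i then a else - k.+1%:R)
    (fun j => if j == i then b else k.+1%:R).
  rewrite (_ : _ @^-1` _ = \bigcup_k A k).
    apply: bigcupT_measurable => k; apply: sub_sigma_algebra.
    by do 2 eexists; reflexivity.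
  apply/seteqP; split=> x /=.
    rewrite in_itv/= => xab; have [k xk] := coord_bound x.
    exists k => // j; case: ifPn => [/eqP->//|_].
    by rewrite -ltr_norml.
  by move=> [k _ /(_ i)]; rewrite eqxx in_itv.
apply: smallest_sub; first exact: smallest_sigma_algebra.
move=> A; rewrite -bigcup_seq/= => -[i _ [B mB <-]].
by have := mcoord i measurableT _ mB.
Qed.

Local Notation mu := (@lebesgue_rV R n).

Variable g : 'rV[R]_n -> R.
Hypothesis mg : measurable_fun setT g.
Hypothesis ig : forall M, mu.-integrable (cbox M) (EFin \o g).

Lemma obox_cbox (a b : 'I_n -> R) :
  obox a b `<=` cbox (\sum_i (`|a i| + `|b i|)).
Proof.
set M := \sum_i _.
move=> x xab i; have /andP[ax xb] := xab i.
have : `|a i| + `|b i| <= M.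
  by rewrite /M (bigD1 i)//= lerDl sumr_ge0// => j _; rewrite addr_ge0.
have := ler_norm (b i); have := ler_norm (- a i); rewrite normrN.
by have := normr_ge0 (b i); have := normr_ge0 (a i); rewrite ler_norml; lra.
Qed.

Lemma integrable_obox (a b : 'I_n -> R) : mu.-integrable (obox a b) (EFin \o g).
Proof.
apply: (integrableS _ _ _ (ig _)); [exact: measurable_cbox|exact: measurable_obox|].
exact: obox_cbox.
Qed.

Hypothesis test0 : forall f M, smooth f ->
  (forall x, ~ cbox M x -> f x = 0) -> \int[mu]_x (g x * f x) = 0.

Lemma integral_obox0 (a b : 'I_n -> R) : (\int[mu]_(x in obox a b) (g x)%:E = 0)%E.
Proof.
pose f m x := (g x * box_bump a b m x)%:E.
have mb m : measurable_fun setT (box_bump a b m).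
  by apply: continuous_measurable_rV; exact: (Ck_continuous (smooth_box_bump a b m 0)).
have mf m : measurable_fun setT (f m).
  by apply/measurable_EFinP; exact: measurable_funM.
have mG : measurable_fun setT (fun x => (g x * \1_(obox a b) x)%:E).
  apply/measurable_EFinP; apply: measurable_funM => //.
  by apply: measurable_indic; exact: measurable_obox.
have ia := integrable_obox a b.
have igr : mu.-integrable setT (fun x => (`|g x * \1_(obox a b) x|)%:E).
  have := ia; rewrite integrable_mkcond; last exact: measurable_obox.
  move=> /integrable_abse; apply: eq_integrable => // x _ /=.
  rewrite patchE indicE; case: ifPn => _; first by rewrite mulr1.
  by rewrite mulr0 normr0 abse0.
have cf x : f m x @[m --> \oo] --> (g x * \1_(obox a b) x)%:E.
  apply: cvg_EFin; first exact: nearW.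
  by apply: cvgM; [exact: cvg_cst|exact: cvg_box_bump].
have fG m x : (`|f m x| <= (`|g x * \1_(obox a b) x|)%:E)%E.
  rewrite /f abse_EFin lee_fin !normrM ler_wpM2l//.
  rewrite ger0_norm ?box_bump_ge0// indicE.
  have [xab|xab] := pselect (obox a b x).
    by rewrite mem_set// normr1 box_bump_le1.
  by rewrite box_bump_out.
have [_ _] := dominated_convergence measurableT mf mG
  (aeW _ (fun x _ => cf x)) igr (aeW _ (fun x m _ => fG m x)).
(* [test0] concerns the real-valued integral, the [fine] part of the extended one; integrability is
   needed to conclude that the latter is 0, not infinite. *)
have f0 m : (\int[mu]_x f m x = 0)%E.
  pose M := \sum_i (`|a i| + `|b i|).
  have := @test0 (box_bump a b m) M (smooth_box_bump a b m).
  rewrite /Rintegral => t0; rewrite -[LHS]fineK.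
    rewrite t0// => x xM; apply: box_bump_out => xab; apply: xM.
    exact: obox_cbox.
  apply: integrable_fin_num => //; apply: le_integrable igr => //.
  by move=> x _; rewrite (le_trans (fG m x))// abse_EFin normr_id.
rewrite (_ : (fun m => _) = fun=> 0%E); last by apply/funext => m; exact: f0.
move=> /cvg_lim h; transitivity (\int[mu]_x (g x * \1_(obox a b) x)%:E)%E.
  rewrite integral_mkcond; apply: eq_integral => x _.
  rewrite patchE indicE; case: ifPn => _; first by rewrite mulr1.
  by rewrite mulr0.
by rewrite -h// lim_cst.
Qed.

(** The positive and negative parts of [g] are densities of two measures that agree on open boxes
    and are finite on an exhausting sequence of them. They agree on all measurable sets, so [g] has
    zero integral on every measurable part of each [cbox k] and vanishes almost everywhere. *)
Lemma du_bois_reymond : {ae mu, forall x, g x = 0}.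
Proof.
have mp : measurable_fun setT (EFin \o g)^\+%E.
  by apply: measurable_funepos; exact/measurable_EFinP.
have mn : measurable_fun setT (EFin \o g)^\-%E.
  by apply: measurable_funeneg; exact/measurable_EFinP.
pose mup : {measure set 'rV[R]_n -> \bar R} :=
  density mu mp (fun x => funepos_ge0 _ x).
pose mun : {measure set 'rV[R]_n -> \bar R} :=
  density mu mn (fun x => funeneg_ge0 _ x).
have pn A : oboxes A -> mup A = mun A.
  move=> [a [b ->]]; have iab := integrable_obox a b.
  have := integral_obox0 a b; rewrite [X in X = _ -> _]integralE.
  move/eqP; rewrite sube_eq ?add0e; first by move/eqP.
    by apply: integrable_pos_fin_num => //; exact: measurable_obox.
  by rewrite fin_num_adde_defr//.
have pnoo k : (mup (obox (fun=> (- k.+1%:R)%R) (fun=> k.+1%:R%R)) < +oo)%E.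
  rewrite /mup /= /density; apply: integral_funepos_lt_pinfty.
    exact: measurable_obox.
  exact: integrable_obox.
have mupn := @measure_unique _ _ _ oboxes
  (fun k => obox (fun=> (- k.+1%:R)%R) (fun=> k.+1%:R%R)) measurable_oboxes oboxes_setI
  _ _ mup mun pn pnoo.
have {}mupn A : measurable A -> mup A = mun A.
  apply: mupn; first by move=> k; do 2 eexists; reflexivity.
  apply/seteqP; split => // x _; have [k xk] := coord_bound x.
  by exists k => // i; rewrite -ltr_norml.
have gk k : {ae mu, forall x, cbox k%:R x -> g x = 0}.
  have mk := @measurable_cbox R n k%:R.
  have : ae_eq mu (cbox k%:R) (EFin \o g) (cst 0%E).
    apply: integral_ae_eq => // E EK mE; rewrite integral0 integralE.
    have := mupn _ mE; rewrite /mup /mun /= /density => ->; rewrite subee//.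
    by apply: integrable_neg_fin_num => //; exact: integrableS (ig k%:R).
  by apply: filterS => x h /h [].
have := ae_foralln gk; apply: filterS => x h.
have [k xk] := coord_bound x; apply: (h k.+1) => i; exact/ltW.
Qed.

End du_bois_reymond.

(** * Power inequalities *)

Section power_inequalities.
Context {R : realType}.
Implicit Types (q X Y a b m x y : R).

(** Write y^q = y exp((q-1) ln y), then use ln y >= 1 - 1/y and exp z >= 1 + z: the product y (1 +
    (q-1)(1 - 1/y)) is exactly the left-hand side. *)
Lemma powR_bernoulli q y : 1 <= q -> 0 <= y -> 1 + q * (y - 1) <= y `^ q.
Proof.
move=> q1; rewrite le_eqVlt => /predU1P[<-|y0].
  by rewrite powR0 ?gt_eqF//; lra.
have h : 1 - y^-1 <= ln y.
  have /le_ln1Dx : -1 < y^-1 - 1 by rewrite ltrBrDl subrr invr_gt0.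
  by rewrite addrC subrK lnV ?posrE//; lra.
rewrite -(mulr_powRB1 (ltW y0))//; last lra.
have -> : y `^ (q - 1) = expR ((q - 1) * ln y) by rewrite /powR gt_eqF.
have h1 : 1 + (q - 1) * (1 - y^-1) <= expR ((q - 1) * ln y).
  rewrite (le_trans _ (expR_ge1Dx _))// lerD2l ler_wpM2l//; lra.
have : y * (1 + (q - 1) * (1 - y^-1)) <= y * expR ((q - 1) * ln y).
  by rewrite ler_pM2l.
apply: le_trans.
have -> : y * (1 + (q - 1) * (1 - y^-1)) = y + (q - 1) * (y - y * y^-1) by ring.
by rewrite divff ?gt_eqF//; lra.
Qed.

(** X^q = X X^(q-1) <= X (X+Y)^(q-1), and likewise for Y. *)
Lemma powR_superadditive q X Y : 1 <= q -> 0 <= X -> 0 <= Y ->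
  X `^ q + Y `^ q <= (X + Y) `^ q.
Proof.
move=> q1 X0 Y0; have q0 : 0 < q by lra.
have q0' : 0 <= q - 1 by lra.
rewrite -!(mulr_powRB1 _ q0)// ?addr_ge0// mulrDl lerD// ler_wpM2l//;
  apply: (ge0_ler_powR q0'); rewrite ?nnegrE ?addr_ge0//; lra.
Qed.

(** Bernoulli at y = x/m, multiplied by m^q. *)
Lemma powR_tangent q x m : 1 <= q -> 0 <= x -> 0 < m ->
  m `^ q + q * m `^ (q - 1) * (x - m) <= x `^ q.
Proof.
move=> q1 x0 m0.
have := powR_bernoulli q1 (divr_ge0 x0 (ltW m0)).
rewrite -(ler_pM2l (powR_gt0 q m0)) -powRM ?divr_ge0 ?(ltW m0)//.
rewrite mulrCA divff ?gt_eqF// mulr1; apply: le_trans.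
rewrite -[m `^ q](mulr_powRB1 (ltW m0)); last lra.
have -> : m * m `^ (q - 1) * (1 + q * (x / m - 1)) =
  m * m `^ (q - 1) + q * m `^ (q - 1) * (m / m * x - m) by ring.
by rewrite divff ?gt_eqF// mul1r.
Qed.

(** Tangent inequalities taken at the mean [m] and averaged: the linear terms cancel. *)
Lemma powR_convex q a b t : 1 <= q -> 0 <= a -> 0 <= b -> 0 <= t <= 1 ->
  (t * a + (1 - t) * b) `^ q <= t * a `^ q + (1 - t) * b `^ q.
Proof.
move=> q1 a0 b0 /andP[t0 t1]; set m := t * a + _.
have t1' : 0 <= 1 - t by lra.
have : 0 <= m by rewrite addr_ge0 ?mulr_ge0.
rewrite le_eqVlt => /predU1P[<-|m0].
  rewrite powR0 ?gt_eqF//; last lra.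
  by rewrite addr_ge0 ?mulr_ge0 ?powR_ge0.
have := ler_wpM2l t0 (powR_tangent q1 a0 m0).
have := ler_wpM2l t1' (powR_tangent q1 b0 m0).
set A := a `^ q; set B := b `^ q; set M := m `^ q; set N := m `^ (q - 1).
move=> h1 h2; have := lerD h2 h1; apply: le_trans.
have E m' : t * (M + q * N * (a - m')) + (1 - t) * (M + q * N * (b - m')) =
  M + q * N * (t * a + (1 - t) * b - m') by ring.
rewrite E.
by rewrite /m subrr mulr0 addr0.
Qed.

(* The vectors [e], [e + b] and their half sum [e + b/2], half difference [b/2]:
   Clarkson's inequality for the latter two, Bernoulli's for [e + b/2]. *)
Lemma remainder_lower_bound q s t : 1 <= q ->
  2 * (4^-1) `^ q * (t ^+ 2 + s ^+ 2) `^ q <=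
  (t ^+ 2 + s ^+ 2 + 2 * s + 1) `^ q - 1 - 2 * q * s.
Proof.
move=> q1; set Y := t ^+ 2 + s ^+ 2.
have Y0 : 0 <= Y by rewrite addr_ge0// sqr_ge0.
have m0 : 0 <= 1 + s + Y / 4.
  (* For a unit vector e and b with Re(e.b) = s and |b|^2 = Y, this is |e + b/2|^2; [Z0] below
     concerns |e + b|^2. *)
  rewrite (_ : _ + _ = (1 + s / 2) ^+ 2 + (t / 2) ^+ 2); last by rewrite /Y; field.
  by rewrite addr_ge0// sqr_ge0.
have Z0 : 0 <= Y + 2 * s + 1.
  rewrite (_ : _ + _ = (1 + s) ^+ 2 + t ^+ 2); last by rewrite /Y; ring.
  by rewrite addr_ge0// sqr_ge0.
have h1 := powR_bernoulli q1 m0.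
have h2 : (1 + s + Y / 4) `^ q + (Y / 4) `^ q <= (1 + s + Y / 4 + Y / 4) `^ q.
  by apply: powR_superadditive => //; rewrite divr_ge0.
(* By the parallelogram identity the mean of |e|^2 = 1 and |e+b|^2 is |e+b/2|^2 + |b/2|^2, the sum
   in [h2]; the two facts together are Clarkson's inequality. *)
have h3 : (2^-1 * 1 + (1 - 2^-1) * (Y + 2 * s + 1)) `^ q <=
    2^-1 * 1 `^ q + (1 - 2^-1) * (Y + 2 * s + 1) `^ q.
  by apply: powR_convex => //; lra.
rewrite (_ : 2^-1 * 1 + _ = 1 + s + Y / 4 + Y / 4) in h3; last by field.
rewrite powR1 in h3.
rewrite (powRM _ Y0) ?invr_ge0// in h2.
have h4 : q * s <= q * (s + Y / 4) by rewrite ler_wpM2l//; lra.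
move: h1 h2 h3 h4; rewrite (_ : 1 + s + Y / 4 - 1 = s + Y / 4); last by ring.
set A := (_ + _ + Y / 4) `^ q; set B := (_ + Y / 4) `^ q.
set C := (_ + 1) `^ q; set D := Y `^ q; set E := _ `^ q.
by move=> *; lra.
Qed.

(** The infimum cleared of its denominator; the excluded point (0, 0) is added back, where both
    sides are 0. *)
Lemma remainder_cst_le (p s t : R) : 2 <= p ->
  remainder_cst p * (t ^+ 2 + s ^+ 2) `^ (p / 2) <=
  (t ^+ 2 + s ^+ 2 + 2 * s + 1) `^ (p / 2) - 1 - p * s.
Proof.
move=> p2; have q1 : 1 <= p / 2 by lra.
have pq : p = 2 * (p / 2) by field.
have [st0|st0] := eqVneq (s, t) (0, 0).
  case: st0 => -> ->; rewrite !mulr0 !expr0n/= !addr0 !add0r powR0 ?gt_eqF//; last lra.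
  by rewrite mulr0 powR1 !subrr.
have Y0 : 0 < t ^+ 2 + s ^+ 2.
  rewrite lt0r addr_ge0 ?sqr_ge0// andbT paddr_eq0 ?sqr_ge0//.
  rewrite !expf_eq0/= andbC; apply: contra st0 => /andP[/eqP-> /eqP->].
  exact/eqP.
rewrite -ler_pdivlMr ?powR_gt0//; apply: ge_inf; last first.
  by exists (s, t) => //=; exact/eqP.
(* An infimum is below the members of its set only if the set is bounded below; nonnegativity of the
   quotients comes from [remainder_lower_bound]. *)
exists 0 => _ [[s' t'] /= _ <-]; apply: divr_ge0; last exact: powR_ge0.
rewrite {2}pq; apply: le_trans (remainder_lower_bound _ _ q1).
by rewrite !mulr_ge0// powR_ge0.
Qed.

(** The explicit bound 2 4^(-p/2) of [remainder_lower_bound] is uniform in (s, t), hence passes to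
    the infimum. *)
Lemma remainder_cst_gt0 (p : R) : 2 <= p -> 0 < remainder_cst p.
Proof.
move=> p2; have q1 : 1 <= p / 2 by lra.
have pq : p = 2 * (p / 2) by field.
apply: (@lt_le_trans _ _ (2 * (4^-1) `^ (p / 2))).
  by rewrite mulr_gt0// powR_gt0// invr_gt0.
apply: lb_le_inf; first by eexists; exists (1, 0) => //= -[] /eqP; rewrite oner_eq0.
move=> _ [[s t] /= st0 <-].
have Y0 : 0 < t ^+ 2 + s ^+ 2.
  rewrite lt0r addr_ge0 ?sqr_ge0// andbT paddr_eq0 ?sqr_ge0//.
  rewrite !expf_eq0/= andbC; apply/negP => /andP[/eqP s0 /eqP t0].
  by apply: st0; rewrite s0 t0.
rewrite ler_pdivlMr ?powR_gt0//.
by have := remainder_lower_bound s t q1; rewrite -pq.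
Qed.

Lemma remainder_cst_le1 (p : R) : 2 <= p -> remainder_cst p <= 1.
Proof.
move=> p2; have q1 : 1 <= p / 2 by lra.
(* The test point b = -2e, for which |e + b| = |e|: the numerator reduces to 2p and the quotient to
   2p / 2^p. *)
have := remainder_cst_le (- 2) 0 p2.
rewrite (_ : 0 ^+ 2 + (- 2) ^+ 2 = 4); last by ring.
rewrite (_ : 4 + 2 * - 2 + 1 = 1); last by ring.
rewrite powR1 subrr sub0r mulrN opprK.
(* 2p <= 2^p, with equality at p = 2: write 4^(p/2) = 4 exp((p/2 - 1) ln 4) and use ln 4 >= 1 with
   exp z >= 1 + z. *)
move=> h; have h4 : p * 2 <= 4 `^ (p / 2).
  have ln2 : 1 <= ln 4 :> R.
    rewrite (_ : 4 = 2 ^+ 2 :> R); last by ring.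
    rewrite lnXn// -[leRHS]mulr_natl.
    have /le_ln1Dx : -1 < 2^-1 - 1 :> R by lra.
    by rewrite addrC subrK lnV ?posrE//; lra.
  rewrite -(mulr_powRB1 (ltW _))//; last lra.
  rewrite /powR gt_eqF//.
  have := expR_ge1Dx ((p / 2 - 1) * ln 4).
  have : (p / 2 - 1) * 1 <= (p / 2 - 1) * ln 4 :> R by rewrite ler_wpM2l//; lra.
  by move=> *; lra.
have : remainder_cst p * 4 `^ (p / 2) <= 1 * 4 `^ (p / 2) by rewrite mul1r (le_trans h).
by rewrite ler_pM2r// powR_gt0.
Qed.

(** Here X = |a|^2, Y = |b|^2, Z = Re(a.b). Homogeneity reduces to |a| = 1 by s = Z/X;
    Cauchy-Schwarz makes Y/X - s^2 nonnegative, so it is the square of a real t and the defining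
    inequality of c(p) applies. *)
Lemma vector_remainder (p X Y Z : R) : 2 <= p -> 0 <= X -> 0 <= Y ->
  Z ^+ 2 <= X * Y ->
  X `^ (p / 2) + p * X `^ (p / 2 - 1) * Z + remainder_cst p * Y `^ (p / 2) <=
  (X + 2 * Z + Y) `^ (p / 2).
Proof.
move=> p2; have q0 : 0 < p / 2 by lra.
rewrite le_eqVlt => /predU1P[<-|X0] Y0.
  rewrite mul0r => Z0; have -> : Z = 0.
    by apply/eqP; rewrite -sqrf_eq0 eq_le Z0 sqr_ge0.
  rewrite !mulr0 !addr0 !add0r powR0 ?gt_eqF// add0r ler_piMl ?powR_ge0//.
  exact: remainder_cst_le1.
move=> ZXY; pose s := Z / X; pose t := Num.sqrt (Y / X - s ^+ 2).
have Xn0 : X != 0 by rewrite gt_eqF.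
have tE : t ^+ 2 = Y / X - s ^+ 2.
  rewrite sqr_sqrtr// subr_ge0 /s exprMn exprVn.
  rewrite ler_pdivrMr ?exprn_gt0// [leRHS](_ : _ = X * Y * (X / X)); last by ring.
  by rewrite divff// mulr1.
have := remainder_cst_le s t p2.
rewrite tE subrK => h.
have := ler_wpM2l (powR_ge0 X (p / 2)) h.
rewrite mulrCA -powRM ?divr_ge0//; try exact: ltW.
rewrite !mulrBr -powRM; try exact: ltW; last first.
  rewrite (_ : Y / X = t ^+ 2 + s ^+ 2); last by rewrite tE subrK.
  have E (u v : R) : u ^+ 2 + v ^+ 2 + 2 * v + 1 = u ^+ 2 + (v + 1) ^+ 2 by ring.
  by rewrite E addr_ge0// sqr_ge0.
rewrite mulrCA divff// mulr1.
rewrite (_ : X * (Y / X + 2 * s + 1) = X / X * Y + 2 * (X / X * Z) + X); last by rewrite /s; ring.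
rewrite divff// !mul1r mulr1.
rewrite (_ : X `^ (p / 2) * (p * s) = p * X `^ (p / 2 - 1) * Z).
  by rewrite (_ : Y + 2 * Z + X = X + 2 * Z + Y); [lra|ring].
rewrite /s -(mulr_powRB1 (ltW X0) q0).
rewrite [LHS](_ : _ = p * X `^ (p / 2 - 1) * (X / X * Z)); last by ring.
by rewrite divff// mul1r.
Qed.

(** For 0 < m < 1, (x+y)^2 <= x^2/m + y^2/(1-m). Convexity with weights m and 1-m, applied to X/m^2
    and Y/(1-m)^2, then bounds the q-th power with coefficient m^(1-2q) on X^q; m close to 1 makes
    it close to 1. *)
Lemma almost_convex (q eta : R) : 1 <= q -> 1 < eta -> exists al be C : R,
  [/\ 0 <= al, 0 <= be, 0 <= C,
      (forall x y : R, (x + y) ^+ 2 <= al * x ^+ 2 + be * y ^+ 2) &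
      (forall X Y, 0 <= X -> 0 <= Y ->
        (al * X + be * Y) `^ q <= eta * X `^ q + C * Y `^ q)].
Proof.
move=> q1 eta1; pose r := 2 * q - 1; have r0 : 0 < r by rewrite /r; lra.
(* The solution of m^(1-2q) = eta. *)
pose m := eta `^ (- r^-1).
have m0 : 0 < m by rewrite powR_gt0//; lra.
have m1 : m < 1.
  rewrite /m powRN invf_lt1 ?powR_gt0//; last lra.
  have ri : 0 < r^-1 by rewrite invr_gt0.
  have := gt0_ltr_powR ri (x := 1) (y := eta); rewrite powR1; apply=> //.
    by rewrite nnegrE.
  rewrite nnegrE; lra.
have n0 : 0 < 1 - m by lra.
have mE : m * (m ^- 2) `^ q = eta.
  rewrite -exprVn -powR_mulrn ?invr_ge0 ?ltW// -powRrM -powR_inv1 ?ltW// -powRrM.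
  rewrite -{1}(powRr1 (ltW m0)) -powRD; last by rewrite (gt_eqF m0) implybT.
  rewrite (_ : 1 + _ = - r); last by rewrite /r; ring.
  rewrite /m -powRrM mulrNN mulVf ?gt_eqF// powRr1//; lra.
exists m^-1, (1 - m)^-1, ((1 - m) * ((1 - m) ^- 2) `^ q); split.
- by rewrite invr_ge0 ltW.
- by rewrite invr_ge0 ltW.
- by rewrite mulr_ge0 ?powR_ge0// ltW.
- move=> x y; rewrite -subr_ge0.
  rewrite (_ : _ - _ = ((1 - m) * x - m * y) ^+ 2 / (m * (1 - m))).
    by rewrite divr_ge0 ?sqr_ge0// mulr_ge0// ltW.
  by field; rewrite !gt_eqF.
- move=> X Y X0 Y0.
  have := @powR_convex q (m ^- 2 * X) ((1 - m) ^- 2 * Y) m q1.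
  rewrite !mulr_ge0 ?invr_ge0 ?sqr_ge0//= => /(_ isT isT).
  rewrite (ltW m0) (ltW m1) => /(_ isT).
  rewrite !powRM ?invr_ge0 ?sqr_ge0// !mulrA mE.
  by rewrite -!exprVn !expr2 !mulrA !divff ?gt_eqF// !mul1r.
Qed.

End power_inequalities.

(** * The pointwise Hardy inequality *)

Section powR_calculus.
Context {R : realType}.

Lemma continuous_powR_nneg (T : topologicalType) (f : T -> R) (r : R) :
  0 <= r -> (forall x, 0 <= f x) -> continuous f ->
  continuous (fun x => f x `^ r).
Proof.
rewrite le_eqVlt => /predU1P[<-|r0] f0 cf.
  by under eq_fun do rewrite powRr0; exact: cst_continuous.
move=> x; have := f0 x; rewrite le_eqVlt => /predU1P[fx0|fx0]; last first.
  apply: (@continuous_comp _ _ _ f (fun t => t `^ r)); first exact: cf.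
  apply: derivable_continuous_at; exact: is_derive1_powR.
rewrite /continuous_at -fx0 powR0 ?gt_eqF//; apply/cvgrPdist_lt => e e0.
have er : 0 < e `^ r^-1 by rewrite powR_gt0.
have : \forall y \near x, f y < e `^ r^-1.
  by have /cvgr_lt/(_ (e `^ r^-1)) := cf x; rewrite -fx0; exact.
apply: filterS => y fy; rewrite sub0r normrN ger0_norm ?powR_ge0//.
rewrite (_ : e = (e `^ r^-1) `^ r); last first.
  by rewrite -powRrM mulVf ?gt_eqF// powRr1// ltW.
by apply: gt0_ltr_powR; rewrite ?nnegrE// ltW.
Qed.

(* At a zero of [N] both [N] and [N `^ q] reach a minimum. *)
Lemma is_derive_powR_nneg (V : normedModType R) (N : V -> R) (v x : V) (q : R) :
  1 <= q -> (forall y, 0 <= N y) -> (forall y, derivable N y v) ->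
  is_derive x v (fun y => N y `^ q) (q * N x `^ (q - 1) * 'D_v N x).
Proof.
move=> q1 N0 dN; have q0 : 0 < q by lra.
have := N0 x; rewrite le_eqVlt => /predU1P[Nx0|Nx0]; last first.
  apply: (is_derive_chain (g := fun t => t `^ q)); first exact: derivableP.
  exact: is_derive1_powR.
(* Restricted to the line through [x], the nonnegative [N] has an interior minimum at parameter
   0. *)
have DN0 : 'D_v N x = 0.
  have : is_derive (0 : R) 1 (fun h : R => N (h *: v + x)) 0.
    apply: (@derive1_at_min _ _ (-1) 1).
    - lra.
    - by move=> t _; rewrite derivable_shiftE.
    - by rewrite in_itv/=; lra.
    - by move=> t _; rewrite scale0r add0r -Nx0.
  by move=> [_]; rewrite derive_shiftE scale0r add0r.
rewrite DN0 mulr0.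
have [q_eq1|q_neq1] := eqVneq q 1.
  rewrite q_eq1 (_ : (fun y => _) = N); last by apply/funext => y; rewrite powRr1.
  by rewrite -DN0; exact: derivableP.
have q1' : 0 < q - 1 by rewrite lt_neqAle eq_sym subr_eq0 q_neq1/=; lra.
have cN : continuous (fun h : R => N (h *: v + x)).
  move=> h; apply: differentiable_continuous; apply/derivable1_diffP.
  by rewrite derivable_shiftE.
have h0 : (fun h : R => h^-1 *: (((fun y => N y `^ q) \o shift x) (h *: v)
    - N x `^ q)) @ 0^' --> (0 : R).
  have h1 : h^-1 *: ((N \o shift x) (h *: v) - N x) @[h --> 0^'] --> 'D_v N x.
    exact: (dN x).
  rewrite DN0 in h1.
  have h2 : N (h *: v + x) `^ (q - 1) @[h --> (0 : R)^'] --> (0 : R).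
    apply: cvg_within_filter.
    have := @continuous_powR_nneg _ (fun h : R => N (h *: v + x)) _ (ltW q1')
      (fun=> N0 _) cN 0.
    by rewrite /continuous_at scale0r add0r -Nx0 powR0// gt_eqF.
  (* As N vanishes at [x], the quotient of N^q is that of N times N^(q-1): the first factor tends to
     the derivative 0, the second to 0 because q > 1. *)
  rewrite (_ : (fun h : R => h^-1 *: _) = (fun h : R =>
      (h^-1 *: ((N \o shift x) (h *: v) - N x)) * N (h *: v + x) `^ (q - 1))).
    by rewrite -[X in _ --> X](mul0r (0 : R)); exact: cvgM h1 h2.
  apply/funext => h /=; rewrite -Nx0 powR0 ?gt_eqF// !subr0.
  by rewrite /GRing.scale/= -mulrA mulr_powRB1.
apply: DeriveDef; last exact: cvg_lim h0.
by apply/cvg_ex; exists 0.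
Qed.

End powR_calculus.

Section pointwise_hardy.
Context {R : realType} {d : nat}.
Implicit Types (x : 'rV[R]_d) (z : R[i]) (G : 'rV[R[i]]_d).
Local Notation Re := (@complex.Re _).
Local Notation Im := (@complex.Im _).

Definition csq z : R := Re z ^+ 2 + Im z ^+ 2.

Definition gsq G : R := \sum_j csq (G ord0 j).

(* [|G + k z x / |x|^2|^2], which is [|G|^2] at [x = 0] since [0^-1 = 0]. *)
Definition radial_sq (k : R) x z G : R := \sum_j
  ((Re (G ord0 j) + k * x ord0 j / sqnorm x * Re z) ^+ 2 +
   (Im (G ord0 j) + k * x ord0 j / sqnorm x * Im z) ^+ 2).

Lemma csq_ge0 z : 0 <= csq z.
Proof. by rewrite addr_ge0 ?sqr_ge0. Qed.

Lemma gsq_ge0 G : 0 <= gsq G.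
Proof. by apply: sumr_ge0 => j _; exact: csq_ge0. Qed.

Lemma radial_sq_ge0 k x z G : 0 <= radial_sq k x z G.
Proof. by apply: sumr_ge0 => j _; rewrite addr_ge0 ?sqr_ge0. Qed.

Lemma sqrt_powR (X p : R) : 0 <= X -> Num.sqrt X `^ p = X `^ (p / 2).
Proof. by move=> X0; rewrite -powR12_sqrt// -powRrM mulrC. Qed.

Lemma normc_powR z (p : R) :
  @complex.ComplexField.Normc.normc _ z `^ p = csq z `^ (p / 2).
Proof.
by rewrite -sqrt_powR ?csq_ge0//; case: z.
Qed.

Lemma cenorm_powR G (p : R) : cenorm G `^ p = gsq G `^ (p / 2).
Proof.
rewrite -sqrt_powR ?gsq_ge0// /cenorm; congr (Num.sqrt _ `^ _).
apply: eq_bigr => j _; case: (G ord0 j) => a b /=.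
by rewrite sqr_sqrtr// addr_ge0// sqr_ge0.
Qed.

(** The discriminant argument. For X = 0 a nonzero Z would make the affine function negative at t =
    -(Y+1)/(2Z). *)
Lemma cauchy_schwarz_quadratic (X Y Z : R) : 0 <= X ->
  (forall t, 0 <= X * t ^+ 2 + 2 * Z * t + Y) -> Z ^+ 2 <= X * Y.
Proof.
rewrite le_eqVlt => /predU1P[<-|X0] h.
  rewrite mul0r; have [->|Z0] := eqVneq Z 0; first by rewrite expr0n.
  have := h (- (Y + 1) / (2 * Z)); rewrite mul0r add0r.
  rewrite (_ : 2 * Z * _ = - (Y + 1)); last by field.
  lra.
have := h (- Z / X).
rewrite (_ : _ + _ = (X * Y - Z ^+ 2) / X); last by field; rewrite gt_eqF.
by rewrite pmulr_lge0 ?invr_gt0// subr_ge0.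
Qed.

(** The regularized weight (|x|^2 + e)^(-p/2) divided by the singular one |x|^(-p): the factor by
    which the vector inequality is multiplied. It is at most 1 and absorbs the singularity at the
    origin. *)
Definition hardy_weight (p e : R) x : R :=
  (sqnorm x / (sqnorm x + e)) `^ (p / 2).

(** The remainder and the Hardy term together. The remainder |x|^(p-d) |grad_A(u |x|^k)|^p appears
    in its unweighted form |grad_A u + k u x / |x|^2|^p. *)
Definition hardy_density (p : R) x z G : R :=
  let k := (d%:R - p) / p in
  remainder_cst p * radial_sq k x z G `^ (p / 2) +
  hardy_cst p d * (csq z / sqnorm x) `^ (p / 2).

(* The [j]-th term of the divergence of [|u|^p x (|x|^2 + e)^(-p/2)], with [z] the
   value of [u] and [Df], [Dg] the gradients of its real and imaginary parts. *)
Definition hardy_divergence (p e : R) x z (Df Dg : 'I_d -> R) (j : 'I_d) : R :=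
  p * csq z `^ (p / 2 - 1) * (Re z * Df j + Im z * Dg j)
    * (x ord0 j * (sqnorm x + e) `^ (- (p / 2))) +
  csq z `^ (p / 2) * ((sqnorm x + e) `^ (- (p / 2)) +
    x ord0 j * (- (p / 2) * (sqnorm x + e) `^ (- (p / 2) - 1) * (2 * x ord0 j))).

(** The vector inequality times [hardy_weight]. [Df] and [Dg] are the gradients of the real and
    imaginary parts, [a] the value of the potential, which enters through [G] only and not through
    the divergence. *)
Lemma pointwise_hardy (p e : R) x z (Df Dg a : 'I_d -> R) G :
  2 <= p -> p < d%:R -> 0 < e ->
  (forall j, G ord0 j = (Df j - a j * Im z) +i* (Dg j + a j * Re z)) ->
  hardy_weight p e x * hardy_density p x z G <=
  gsq G `^ (p / 2) + ((d%:R - p) / p) `^ (p - 1) *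
    \sum_j hardy_divergence p e x z Df Dg j.
Proof.
move=> p2 pd e0 GE.
have [k kE] : exists k, k = (d%:R - p) / p by eexists.
have [q qE] : exists q, q = p / 2 by eexists.
have pq : p = 2 * q by rewrite qE; field.
rewrite /hardy_weight /hardy_density /hardy_cst /hardy_divergence -!kE -!qE.
have p0 : 0 < p by lra.
have k0 : 0 < k by rewrite kE divr_gt0// subr_gt0.
have kp : d%:R = p * k + p by rewrite kE; field; rewrite gt_eqF.
have q1 : 1 <= q by lra.
have q0 : 0 < q by lra.
have [s sE] : exists s, s = sqnorm x by eexists.
have s0 : 0 <= s by rewrite sE sqnorm_ge0.
have [N NE] : exists N, N = csq z by eexists.
have N0 : 0 <= N by rewrite NE csq_ge0.
have [K KE] : exists K, K = \sum_j x ord0 j * (Re z * Df j + Im z * Dg j) by eexists.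
rewrite -!sE -!NE.
have {kE} E0 : 0 <= (s + e) `^ (- q) by exact: powR_ge0.
set S := \sum_j _.
have SE : S = (s + e) `^ (- q) * (p * N `^ (q - 1) * K + d%:R * N `^ q) -
    p * N `^ q * s * (s + e) `^ (- q - 1).
  rewrite {}/S; move: (_ `^ (- q)) (_ `^ (- q - 1)) => E E'.
  transitivity (\sum_j ((E * (p * N `^ (q - 1))) *
      (x ord0 j * (Re z * Df j + Im z * Dg j)) + N `^ q * E -
      p * N `^ q * E' * x ord0 j ^+ 2)).
    by apply: eq_bigr => j _; rewrite pq; ring.
  rewrite sumrB big_split/= -!mulr_sumr sumr_const card_ord -KE.
  rewrite -[\sum_(i < d) _]/(sqnorm x) -sE -mulr_natr; ring.
(* At the origin the weight is 0, and the divergence reduces to d N^q e^(-q) >= 0. *)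
have [s_eq0|s_neq0] := eqVneq s 0.
  have x0 j : x ord0 j = 0.
    apply/eqP; rewrite -sqrf_eq0; move: s_eq0; rewrite sE => /eqP.
    rewrite psumr_eq0 => [/allP h|i _]; last exact: sqr_ge0.
    exact: (h j (mem_index_enum _)).
  rewrite s_eq0 mul0r powR0 ?gt_eqF// mul0r.
  rewrite addr_ge0 ?powR_ge0// mulr_ge0 ?powR_ge0// SE s_eq0.
  have -> : K = 0 by rewrite KE big1// => j _; rewrite x0 mul0r.
  rewrite !mulr0 mul0r subr0 !add0r; apply: mulr_ge0; first exact: powR_ge0.
  by apply: mulr_ge0; [exact: ler0n|exact: powR_ge0].
have {s_neq0} s_gt0 : 0 < s by rewrite lt0r s_neq0.
have sn0 : s != 0 by rewrite gt_eqF.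
have se0 : 0 < s + e by rewrite addr_gt0.
have [w wE] : exists w, w = (s / (s + e)) `^ q by eexists.
have w0 : 0 <= w by rewrite wE powR_ge0.
have w1 : w <= 1.
  have := @powR1 R; move/(congr1 (@^~ q)) => <-; rewrite wE.
  apply: ge0_ler_powR; rewrite ?nnegrE ?divr_ge0 ?(ltW s_gt0) ?(ltW se0) ?(ltW q0)//.
  by rewrite ler_pdivrMr// mul1r lerDl ltW.
(* With a = - k z x / |x|^2 and b = G - a, the numbers X, Z, Y are |a|^2, Re(a.b) = Re(a.G) - |a|^2
   and |b|^2. In Re(a.G) the potential contributes Re z Im z twice with opposite signs, which leaves
   K. *)
pose X := k ^+ 2 * (N / s).
have X0 : 0 <= X by rewrite mulr_ge0 ?sqr_ge0// divr_ge0.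
pose Z := - (k / s) * K - k ^+ 2 * (N / s).
pose Y := radial_sq k x z G.
have Y0 : 0 <= Y by exact: radial_sq_ge0.
pose b1 j := Re (G ord0 j) + k * x ord0 j / s * Re z.
pose b2 j := Im (G ord0 j) + k * x ord0 j / s * Im z.
(* |b + t a|^2 as a polynomial in t: its nonnegativity yields Cauchy-Schwarz, and its value at t = 1
   is |G|^2. *)
have quad t : \sum_j ((b1 j - t * (k * x ord0 j / s * Re z)) ^+ 2 +
    (b2 j - t * (k * x ord0 j / s * Im z)) ^+ 2) = X * t ^+ 2 + 2 * Z * t + Y.
  transitivity (\sum_j (((b1 j) ^+ 2 + (b2 j) ^+ 2) + (t ^+ 2 - 2 * t) *
      (k ^+ 2 * N / s / s) * x ord0 j ^+ 2 - 2 * t * (k / s) *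
      (x ord0 j * (Re z * Df j + Im z * Dg j)))).
    apply: eq_bigr => j _; rewrite /b1 /b2 GE/= NE /csq.
    by move: (Re z) (Im z) (x ord0 j) (Df j) (Dg j) (a j) => *; field.
  rewrite sumrB big_split/= -!mulr_sumr -KE.
  rewrite (_ : \sum_(i < d) (b1 i ^+ 2 + b2 i ^+ 2) = Y); last by rewrite /Y /b1 /b2 sE.
  rewrite -[\sum_(i < d) _]/(sqnorm x) -sE /X /Z.
  by field.
have ZXY : Z ^+ 2 <= X * Y.
  apply: cauchy_schwarz_quadratic => // t; rewrite -quad.
  by apply: sumr_ge0 => j _; rewrite addr_ge0 ?sqr_ge0.
have XZY : X + 2 * Z + Y = gsq G.
  have := quad 1; rewrite expr1n !mulr1 => <-.
  apply: eq_bigr => j _; rewrite /b1 /b2 /csq !mul1r.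
  by rewrite !addrK.
have := vector_remainder p2 X0 Y0 ZXY; rewrite -qE XZY.
rewrite -/Y; move: (gsq G `^ q) (powR_ge0 (gsq G) q) => H H0 h.
have XqE : X `^ q = k `^ p * (N / s) `^ q.
  have -> : k `^ p = (k ^+ 2) `^ q.
    by rewrite -(powR_mulrn 2 (ltW k0)) -powRrM -pq.
  by apply: powRM; [exact: sqr_ge0|exact: divr_ge0].
rewrite -wE.
(* The factor w <= 1 is dropped on the side of |G|^p only. *)
have {h} h : w * (X `^ q + p * X `^ (q - 1) * Z + remainder_cst p * Y `^ q) <= H.
  by rewrite (le_trans (ler_wpM2l w0 h))// ler_piMl.
suff : - (w * (p * X `^ (q - 1) * Z)) <= k `^ (p - 1) * S.
  by rewrite -XqE; move: h; lra.
have wX : w * X `^ (q - 1) = k `^ (p - 1) / k * N `^ (q - 1) * s * (s + e) `^ (- q).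
  have kk : (k ^+ 2) `^ (q - 1) = k `^ (p - 1) / k.
    rewrite -(powR_mulrn 2 (ltW k0)) -powRrM (_ : 2 * (q - 1) = p - 1 - 1); last first.
      by rewrite pq; ring.
    rewrite powRB; last by rewrite (gt_eqF k0) implybT.
    by rewrite powRr1 ?(ltW k0).
  rewrite wE /X (powRM _ (sqr_ge0 k) (divr_ge0 N0 s0)) kk.
  rewrite !powRM ?invr_ge0 ?(ltW s_gt0) ?(ltW se0)//.
  rewrite -(powR_inv1 (ltW s_gt0)) -(powR_inv1 (ltW se0)) -!powRrM !mulN1r.
  rewrite -[X in _ = _ * X * _](powRr1 (ltW s_gt0)).
  rewrite (_ : s `^ 1 = s `^ q * s `^ (- (q - 1))); first by ring.
  rewrite -powRD; last by rewrite (gt_eqF s_gt0) implybT.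
  by congr (_ `^ _); ring.
have NqE : N * N `^ (q - 1) = N `^ q by rewrite mulr_powRB1.
have EE : (s + e) `^ (- q) = (s + e) * (s + e) `^ (- q - 1).
  rewrite powRB; last by rewrite (gt_eqF se0) implybT.
  by rewrite powRr1 ?(ltW se0)// mulrCA divff ?mulr1// gt_eqF.
rewrite (_ : w * (p * _ * _) = w * X `^ (q - 1) * (p * Z)); last by ring.
rewrite wX SE -NqE EE kp /Z.
move: (powR_ge0 k (p - 1)) (powR_ge0 N (q - 1)) (powR_ge0 (s + e) (- q - 1)).
move: (k `^ (p - 1)) (N `^ (q - 1)) ((s + e) `^ (- q - 1)) => kp1 Nq1 E1 kp10 Nq10 E10.
(* With d = p k + p everything cancels except a nonnegative multiple of e, the trace of the
   regularization. *)
rewrite -subr_ge0 (_ : _ - _ = kp1 * p * (N * Nq1) * E1 * e).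
  by rewrite !mulr_ge0// ltW.
by field; rewrite sn0 gt_eqF.
Qed.

End pointwise_hardy.

(** * Test functions *)

Section measurable_density.
Context {R : realType} {d : nat}.
Local Notation Re := (@complex.Re _).
Local Notation Im := (@complex.Im _).
Local Notation mu := (@lebesgue_rV R d).

Lemma measurable_sqnorm : measurable_fun setT (@sqnorm R d).
Proof.
by apply: continuous_measurable_rV; exact: (Ck_continuous (Ck_sqnorm d 0)).
Qed.

Lemma measurable_fun_inv (T : 'rV[R]_d -> R) : (forall x, 0 <= T x) ->
  measurable_fun setT T -> measurable_fun setT (fun x => (T x)^-1).
Proof.
move=> T0 mT; rewrite (_ : (fun x => _) = (fun x => T x `^ (-1))).
  exact: (measurableT_comp (measurable_powR (-1)) mT).
by apply/funext => x; rewrite powR_inv1.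
Qed.

Lemma measurable_fun_powR (T : 'rV[R]_d -> R) r :
  measurable_fun setT T -> measurable_fun setT (fun x => T x `^ r).
Proof. exact: (measurableT_comp (measurable_powR r)). Qed.

Lemma measurable_csq (u : 'rV[R]_d -> R[i]) : cmeasurable u ->
  measurable_fun setT (fun x => csq (u x)).
Proof.
by move=> [mr mi]; apply: measurable_funD; apply: measurable_funX.
Qed.

Lemma measurable_gsq (G : 'rV[R]_d -> 'rV[R[i]]_d) :
  (forall j, cmeasurable (fun x => G x ord0 j)) ->
  measurable_fun setT (fun x => gsq (G x)).
Proof. by move=> mG; apply: measurable_sum => j; exact: measurable_csq. Qed.

Lemma measurable_radial_sq k (u : 'rV[R]_d -> R[i]) (G : 'rV[R]_d -> 'rV[R[i]]_d) :
  cmeasurable u -> (forall j, cmeasurable (fun x => G x ord0 j)) ->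
  measurable_fun setT (fun x => radial_sq k x (u x) (G x)).
Proof.
move=> [mr mi] mG; apply: measurable_sum => j; have [mGr mGi] := mG j.
have mk : measurable_fun setT (fun x : 'rV[R]_d => k * x ord0 j / sqnorm x).
  apply: measurable_funM.
    by apply: measurable_funM => //; exact: measurable_coord.
  by apply: measurable_fun_inv; [exact: sqnorm_ge0|exact: measurable_sqnorm].
by apply: measurable_funD; apply: measurable_funX; apply: measurable_funD => //;
  apply: measurable_funM.
Qed.

Lemma measurable_hardy_weight p e : 0 <= e ->
  measurable_fun setT (@hardy_weight R d p e).
Proof.
move=> e0; apply: measurable_fun_powR; apply: measurable_funM.
  exact: measurable_sqnorm.
apply: measurable_fun_inv; first by move=> x; rewrite addr_ge0// sqnorm_ge0.
by apply: measurable_funD => //; exact: measurable_sqnorm.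
Qed.

Lemma measurable_hardy_density p (u : 'rV[R]_d -> R[i]) (G : 'rV[R]_d -> 'rV[R[i]]_d) :
  cmeasurable u -> (forall j, cmeasurable (fun x => G x ord0 j)) ->
  measurable_fun setT (fun x => hardy_density p x (u x) (G x)).
Proof.
move=> mu_ mG; apply: measurable_funD; apply: measurable_funM => //;
  apply: measurable_fun_powR; first exact: measurable_radial_sq.
apply: measurable_funM; first exact: measurable_csq.
by apply: measurable_fun_inv; [exact: sqnorm_ge0|exact: measurable_sqnorm].
Qed.

Lemma hardy_density_ge0 (p : R) x z (G : 'rV[R[i]]_d) : 2 <= p ->
  0 <= hardy_density p x z G.
Proof.
move=> p2; apply: addr_ge0; apply: mulr_ge0; rewrite ?powR_ge0//.
exact: ltW (remainder_cst_gt0 p2).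
Qed.

End measurable_density.

Section hardy_test_function.
Context {R : realType} {d : nat}.
Local Notation Re := (@complex.Re _).
Local Notation Im := (@complex.Im _).
Local Notation mu := (@lebesgue_rV R d).
Variables (A : 'rV[R]_d -> 'rV[R]_d) (phi : 'rV[R]_d -> R[i]).
Hypothesis cA : forall j, continuous (fun x => A x ord0 j).
Hypothesis tphi : test_function phi.

(** Built from the pointwise partial derivatives, unlike [mgrad], whose gradient is an arbitrary
    representative; for a test function only the former is known at every point. *)
Definition classical_mgrad (A : 'rV[R]_d -> 'rV[R]_d) (phi : 'rV[R]_d -> R[i])
    (x : 'rV[R]_d) : 'rV[R[i]]_d :=
  \row_j (cpartial j phi x + (0 +i* A x ord0 j) * phi x).

Let f := Re \o phi.
Let g := Im \o phi.
Let sf : smooth f. Proof. by have [[]] := tphi. Qed.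
Let sg : smooth g. Proof. by have [[]] := tphi. Qed.
Let cf : continuous f. Proof. exact: Ck_continuous (sf 0). Qed.
Let cg : continuous g. Proof. exact: Ck_continuous (sg 0). Qed.
Let df j x : derivable f x (delta_mx ord0 j).
Proof. by have [_ /(_ j)[]] := sf 1. Qed.
Let dg j x : derivable g x (delta_mx ord0 j).
Proof. by have [_ /(_ j)[]] := sg 1. Qed.
Let cdf j : continuous (partial j f).
Proof. by have [_ /(_ j)[_ []]] := sf 1. Qed.
Let cdg j : continuous (partial j g).
Proof. by have [_ /(_ j)[_ []]] := sg 1. Qed.

Let cD (F G : 'rV[R]_d -> R) : continuous F -> continuous G ->
  continuous (fun x => F x + G x).
Proof. by move=> cF cG x; apply: continuousD; [exact: cF|exact: cG]. Qed.

Let cM (F G : 'rV[R]_d -> R) : continuous F -> continuous G ->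
  continuous (fun x => F x * G x).
Proof. by move=> cF cG x; apply: continuousM; [exact: cF|exact: cG]. Qed.

Lemma classical_mgradE x j : classical_mgrad A phi x ord0 j =
  (partial j f x - A x ord0 j * g x) +i* (partial j g x + A x ord0 j * f x).
Proof.
rewrite mxE /cpartial /f /g /=; case: (phi x) => a b /=.
by congr (_ +i* _); rewrite /=; ring.
Qed.

Lemma is_derive_csq j x : is_derive x (delta_mx ord0 j) (fun x => csq (phi x))
  (2 * (f x * partial j f x + g x * partial j g x)).
Proof.
have hf := is_derive_mul (derivableP (@df j x)) (derivableP (@df j x)).
have hg := is_derive_mul (derivableP (@dg j x)) (derivableP (@dg j x)).
rewrite (_ : (fun x => _) = (fun x => f x * f x + g x * g x)); last first.
  by apply/funext => y; rewrite /csq !expr2.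
by apply: is_derive_eq; rewrite /partial; ring.
Qed.

Lemma continuous_csq : continuous (fun x => csq (phi x)).
Proof.
rewrite (_ : (fun x => _) = (fun x => f x * f x + g x * g x)); last first.
  by apply/funext => y; rewrite /csq !expr2.
by apply: cD; apply: cM.
Qed.

Lemma continuous_classical_mgrad :
  continuous (fun x => gsq (classical_mgrad A phi x)).
Proof.
rewrite (_ : (fun x => _) = (fun x => \sum_j
   ((partial j f x + -1 * (A x ord0 j * g x)) * (partial j f x + -1 * (A x ord0 j * g x)) +
    (partial j g x + A x ord0 j * f x) * (partial j g x + A x ord0 j * f x)))).
  move: (index_enum _) => s; elim: s => [|j s ih].
    by under eq_fun do rewrite big_nil; exact: cst_continuous.
  under eq_fun do rewrite big_cons; apply: cD ih.
  have c1 : continuous (fun x => partial j f x + -1 * (A x ord0 j * g x)).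
    by apply: cD => //; apply: cM; [exact: cst_continuous|exact: cM].
  have c2 : continuous (fun x => partial j g x + A x ord0 j * f x).
    by apply: cD => //; exact: cM.
  exact: (cD (cM c1 c1) (cM c2 c2)).
apply/funext => x; apply: eq_bigr => j _; rewrite classical_mgradE /csq/= !expr2.
by congr (_ + _); ring.
Qed.

Lemma classical_mgrad_support :
  exists M, (forall x, ~ cbox M x -> phi x = 0) /\
   (forall x, ~ cbox M x -> classical_mgrad A phi x = 0).
Proof.
have [M hM] := test_function_support tphi; exists M; split => // x xM.
have fM y : ~ cbox M y -> f y = 0 by move=> /hM; rewrite /f /= => ->.
have gM y : ~ cbox M y -> g y = 0 by move=> /hM; rewrite /g /= => ->.
apply/rowP => j; rewrite classical_mgradE fM// gM// !mulr0 subr0 addr0 mxE.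
by rewrite (partial_outside j fM xM) (partial_outside j gM xM).
Qed.

Lemma integrable_classical_mgrad p : 0 < p ->
  mu.-integrable setT (fun x => (gsq (classical_mgrad A phi x) `^ p)%:E).
Proof.
move=> p0; have [M [_ hM]] := classical_mgrad_support.
apply: (@integrable_continuous _ _ _ M).
  apply: continuous_powR_nneg; [exact: ltW|move=> x; exact: gsq_ge0|].
  exact: continuous_classical_mgrad.
move=> x /hM ->; rewrite /gsq big1 ?powR0 ?gt_eqF// => j _.
by rewrite mxE /csq/= !expr0n addr0.
Qed.

Variables (p e : R).
Hypotheses (p2 : 2 <= p) (pd : p < d%:R) (e0 : 0 < e).

Let F j (x : 'rV[R]_d) : R :=
  csq (phi x) `^ (p / 2) * (x ord0 j * (sqnorm x + e) `^ (- (p / 2))).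

Let divergence j x : R := hardy_divergence p e x (phi x)
  (fun j => partial j f x) (fun j => partial j g x) j.

Lemma is_derive_hardy_field j x :
  is_derive x (delta_mx ord0 j) (F j) (divergence j x).
Proof.
have q1 : 1 <= p / 2 by rewrite ler_pdivlMr// mul1r.
have h1 := is_derive_powR_nneg x q1 (fun y => csq_ge0 (phi y))
  (fun y => @ex_derive _ _ _ _ _ _ _ (is_derive_csq j y)).
have [_ E1] := is_derive_csq j x; rewrite E1 in h1.
have h2 := is_derive_powR_sqnorm j x (- (p / 2)) e0.
have h3 := is_derive_mul (is_derive_coord j j x) h2.
have [h4 h5] := is_derive_mul h1 h3; apply: DeriveDef; first exact: h4.
rewrite h5 /divergence /hardy_divergence eqxx /f /g /=.
move: (csq _ `^ (p / 2)) (csq _ `^ (p / 2 - 1)) => a b.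
move: (_ `^ (- (p / 2))) (_ `^ (- (p / 2) - 1)) => a' b'.
by move: (partial _ _ _) (partial _ _ _) => *; field.
Qed.

(** The power of |phi|^2 left after differentiation has exponent p/2 - 1 >= 0, so it stays
    continuous at the zeros of phi. *)
Lemma continuous_divergence j : continuous (divergence j).
Proof.
have q1 : 0 <= p / 2 - 1 by rewrite subr_ge0 ler_pdivlMr// mul1r.
have q0 : 0 <= p / 2 by rewrite divr_ge0// (le_trans _ p2).
have cs r : continuous (fun x : 'rV[R]_d => (sqnorm x + e) `^ r).
  exact: Ck_continuous (Ck_powR_sqnorm d 0 r e0).
have cc := @coord_continuous R 1 d ord0 j.
rewrite /divergence /hardy_divergence; apply: cD; last first.
  apply: cM.
    by apply: continuous_powR_nneg => //;
      [move=> x; exact: csq_ge0|exact: continuous_csq].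
  apply: cD; first exact: cs.
  apply: cM; first exact: cc.
  apply: cM; first by apply: cM; [exact: cst_continuous|exact: cs].
  by apply: cM; [exact: cst_continuous|exact: cc].
apply: cM; last by apply: cM; [exact: cc|exact: cs].
apply: cM; last by apply: cD; [exact: (cM cf (@cdf j))|exact: (cM cg (@cdg j))].
apply: cM; first exact: cst_continuous.
by apply: continuous_powR_nneg => //; [move=> x; exact: csq_ge0|exact: continuous_csq].
Qed.

Lemma integral_divergence j :
  mu.-integrable setT (fun x => (divergence j x)%:E) /\
  (\int[mu]_x (divergence j x)%:E = 0)%E.
Proof.
have q0 : 0 < p / 2 by rewrite divr_gt0// (lt_le_trans _ p2).
have DE : partial j (F j) = divergence j.
  by apply/funext => x; have [_] := is_derive_hardy_field j x.
have [M [hM _]] := classical_mgrad_support.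
have FM x : ~ cbox M x -> F j x = 0.
  by move=> /hM; rewrite /F => ->; rewrite /csq/= !expr0n addr0 powR0 ?gt_eqF ?mul0r.
split.
  apply: (@integrable_continuous _ _ _ M); first exact: continuous_divergence.
  by rewrite -DE; exact: partial_outside.
rewrite -DE; apply: (integral_partial (M := M)) => //.
  by move=> x; have [] := is_derive_hardy_field j x.
by rewrite DE; exact: continuous_divergence.
Qed.

Lemma cmeasurable_test : cmeasurable phi.
Proof. by split; exact: continuous_measurable_rV. Qed.

Lemma cmeasurable_classical_mgrad j :
  cmeasurable (fun x => classical_mgrad A phi x ord0 j).
Proof.
split.
  rewrite (_ : _ \o _ = (fun x => partial j f x + -1 * (A x ord0 j * g x))).
    apply: continuous_measurable_rV.
    by apply: cD => //; apply: cM; [exact: cst_continuous|exact: cM].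
  by apply/funext => x; rewrite /= classical_mgradE/= mulN1r.
rewrite (_ : _ \o _ = (fun x => partial j g x + A x ord0 j * f x)).
  by apply: continuous_measurable_rV; apply: cD => //; exact: cM.
by apply/funext => x; rewrite /= classical_mgradE.
Qed.

Lemma hardy_test_function :
  (\int[mu]_x (hardy_weight p e x *
      hardy_density p x (phi x) (classical_mgrad A phi x))%:E <=
   \int[mu]_x (gsq (classical_mgrad A phi x) `^ (p / 2))%:E)%E.
Proof.
have q0 : 0 < p / 2 by rewrite divr_gt0// (lt_le_trans _ p2).
pose H x := gsq (classical_mgrad A phi x) `^ (p / 2).
pose S x := ((d%:R - p) / p) `^ (p - 1) * \sum_j divergence j x.
have le x : hardy_weight p e x *
    hardy_density p x (phi x) (classical_mgrad A phi x) <= H x + S x.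
  apply: (@pointwise_hardy _ _ p e x (phi x) _ _ (fun j => A x ord0 j)) => // j.
  exact: classical_mgradE.
have iD : mu.-integrable setT (fun x => (\sum_j (divergence j x)%:E)%E).
  by apply: integrable_sum => // j _; have [] := integral_divergence j.
have SE : (fun x => (S x)%:E) = (fun x =>
    (((d%:R - p) / p) `^ (p - 1))%:E * (\sum_j (divergence j x)%:E))%E.
  by apply/funext => x; rewrite /S EFinM sumEFin.
have iS : mu.-integrable setT (fun x => (S x)%:E).
  by rewrite SE; exact: integrableZl.
have iH := integrable_classical_mgrad q0.
(* The divergence is added inside the right-hand integral, where it contributes 0, so that the
   pointwise inequality compares two nonnegative functions. *)
have -> : (\int[mu]_x (H x)%:E = \int[mu]_x (H x + S x)%:E)%E.
  under [RHS]eq_integral do rewrite EFinD.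
  rewrite integralD// SE integralZl// integral_sum//; last first.
    by move=> j; have [] := integral_divergence j.
  rewrite big1 ?mule0 ?adde0// => j _.
  by have [] := integral_divergence j.
have wQ0 x : 0 <= hardy_weight p e x *
    hardy_density p x (phi x) (classical_mgrad A phi x).
  by rewrite mulr_ge0 ?powR_ge0// hardy_density_ge0.
apply: ge0_le_integral => //.
- by move=> x _; rewrite lee_fin.
- apply/measurable_EFinP; apply: measurable_funM.
    by apply: measurable_hardy_weight; exact: ltW.
  apply: measurable_hardy_density; first exact: cmeasurable_test.
  exact: cmeasurable_classical_mgrad.
- have : mu.-integrable setT (fun x => (H x)%:E + (S x)%:E)%E.
    exact: integrableD.
  by move=> /integrableP[].
- by move=> x _; rewrite lee_fin.
Qed.

End hardy_test_function.

(** * Weak gradients *)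

Section weak_partial.
Context {R : realType} {d : nat}.
Local Notation mu := (@lebesgue_rV R d).
Implicit Types (h f : 'rV[R]_d -> R) (K : 'I_d -> 'rV[R]_d -> R).

Definition loc_int h := measurable_fun setT h /\
  forall M, mu.-integrable (cbox M) (EFin \o h).

(** The distributional gradient of a real function, tested on real functions only; complex weak
    gradients are handled through their two real parts. *)
Definition real_grad h K := loc_int h /\ forall j, loc_int (K j) /\
  forall f M, smooth f -> (forall x, ~ cbox M x -> f x = 0) ->
  \int[mu]_x (h x * partial j f x) = - \int[mu]_x (K j x * f x).

Lemma loc_int_le h (H : 'rV[R]_d -> R) : measurable_fun setT h -> loc_int H ->
  (forall x, `|h x| <= `|H x|) -> loc_int h.
Proof.
move=> mh [mH iH] hH; split => // M.
apply: le_integrable (iH M); first exact: measurable_cbox.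
  by apply: measurable_funTS; exact/measurable_EFinP.
by move=> x _; rewrite /= lee_fin.
Qed.

Lemma loc_intD h k : loc_int h -> loc_int k -> loc_int (fun x => h x + k x).
Proof.
move=> [mh ih] [mk ik]; split; first exact: measurable_funD.
by move=> M; apply: (integrableD _ (ih M) (ik M)); exact: measurable_cbox.
Qed.

Lemma loc_intB h k : loc_int h -> loc_int k -> loc_int (fun x => h x - k x).
Proof.
move=> [mh ih] [mk ik]; split; first exact: measurable_funB.
by move=> M; apply: (integrableB _ (ih M) (ik M)); exact: measurable_cbox.
Qed.

Lemma loc_int_norm h : loc_int h -> loc_int (fun x => `|h x|).
Proof.
move=> [mh ih]; split; first exact: measurableT_comp.
by move=> M; have := integrable_norm (ih M).
Qed.

Lemma loc_intM h k : loc_int h -> continuous k -> loc_int (fun x => h x * k x).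
Proof.
move=> [mh ih] ck; have mk := continuous_measurable_rV ck.
split; first exact: measurable_funM.
move=> M; have [C hC] := continuous_bounded_cbox M ck.
apply: (@le_integrable _ _ _ _ _ _ _ (fun x => C%:E * (h x)%:E)%E).
- exact: measurable_cbox.
- by apply: measurable_funTS; apply/measurable_EFinP; exact: measurable_funM.
- move=> x xM; rewrite -EFinM /= lee_fin !normrM mulrC ler_wpM2r//.
  by rewrite (le_trans (hC _ xM))// ler_norm.
- by apply: integrableZl; [exact: measurable_cbox|exact: ih].
Qed.

Lemma continuous_loc_int f : continuous f -> loc_int f.
Proof.
move=> cf; split; first exact: continuous_measurable_rV.
move=> M; apply: measurable_bounded_integrable.
- exact: measurable_cbox.
- exact: lebesgue_rV_cbox.
- by apply: measurable_funTS; exact: continuous_measurable_rV.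
- have [C hC] := continuous_bounded_cbox M cf.
  exists `|C|; split; first exact: num_real.
  by move=> y Cy x /= /hC /le_trans; apply; rewrite (le_trans (ler_norm _))// ltW.
Qed.

Lemma integrable_support h M : loc_int h -> (forall x, ~ cbox M x -> h x = 0) ->
  mu.-integrable setT (EFin \o h).
Proof.
move=> [mh ih] h0; have mM := @measurable_cbox R d M.
have /(integrable_mkcond _ mM).1 := ih M.
apply: eq_integrable => // x _; rewrite patchE; case: ifPn => // /negP xM /=.
by rewrite h0// => ?; apply: xM; rewrite inE.
Qed.

Lemma integrable_test h f M : loc_int h -> continuous f ->
  (forall x, ~ cbox M x -> f x = 0) ->
  mu.-integrable setT (EFin \o (fun x => h x * f x)).
Proof.
move=> lh cf f0; apply: (@integrable_support _ M); first exact: loc_intM.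
by move=> x /f0 ->; rewrite mulr0.
Qed.

Lemma smooth_continuous f : smooth f -> continuous f.
Proof. by move=> sf; exact: Ck_continuous (sf 0). Qed.

Lemma smooth_derivable f j x : smooth f -> derivable f x (delta_mx ord0 j).
Proof. by move=> /(_ 1)[_ /(_ j)[]]. Qed.

Lemma smooth_partial_continuous f j : smooth f -> continuous (partial j f).
Proof. by move=> /(_ 1)[_ /(_ j)[_ []]]. Qed.

(** The difference of two gradients annihilates all test functions, so the du Bois-Reymond lemma
    applies to each component. *)
Lemma real_grad_unique h K K' : real_grad h K -> real_grad h K' ->
  forall j, {ae mu, forall x, K j x = K' j x}.
Proof.
move=> [lh hK] [_ hK'] j; have [lK wK] := hK j; have [lK' wK'] := hK' j.
have [mB iB] := loc_intB lK lK'.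
have : {ae mu, forall x, K j x - K' j x = 0}.
  apply: du_bois_reymond => // f M sf f0.
  have cf := smooth_continuous sf.
  under eq_Rintegral do rewrite mulrBl.
  rewrite RintegralB//; [|exact: integrable_test cf f0..].
  have e1 := wK f M sf f0; have e2 := wK' f M sf f0.
  by apply/eqP; rewrite subr_eq0 -eqr_opp -e1 -e2.
by apply: filterS => x /eqP; rewrite subr_eq0 => /eqP.
Qed.

Lemma real_gradB h k K L : real_grad h K -> real_grad k L ->
  real_grad (fun x => h x - k x) (fun j x => K j x - L j x).
Proof.
move=> [lh hK] [lk kL]; split; first exact: loc_intB.
move=> j; have [lK wK] := hK j; have [lL wL] := kL j.
split; first exact: loc_intB.
move=> f M sf f0; have cf := smooth_continuous sf.
have cdf := smooth_partial_continuous (j := j) sf.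
have df0 := partial_outside j f0.
under eq_Rintegral do rewrite mulrBl.
under [in RHS]eq_Rintegral do rewrite mulrBl.
rewrite !RintegralB//; try by [exact: integrable_test cf f0 |
  exact: integrable_test cdf df0].
by rewrite (wK f M)// (wL f M)// opprB opprK addrC.
Qed.

Lemma test_real_grad f M : smooth f -> (forall x, ~ cbox M x -> f x = 0) ->
  real_grad f (fun j => partial j f).
Proof.
move=> sf f0; have cf := smooth_continuous sf.
split; first exact: continuous_loc_int.
move=> j; have cdf := smooth_partial_continuous (j := j) sf.
split; first exact: continuous_loc_int.
move=> g M' sg g0; have cg := smooth_continuous sg.
have cdg := smooth_partial_continuous (j := j) sg.
have dg0 := partial_outside j g0.
apply/eqP; rewrite -addr_eq0 -RintegralD//; last 2 first.
- by apply: integrable_test cdg dg0; exact: continuous_loc_int.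
- by apply: integrable_test cg g0; exact: continuous_loc_int.
rewrite /Rintegral (_ : (fun x => _) = (fun x => (partial j (fun x => f x * g x) x)%:E)).
  rewrite (@integral_partial _ _ _ _ M')//.
  - by move=> x; apply: derivableM; exact: smooth_derivable.
  - rewrite (_ : partial _ _ = (fun x => f x * partial j g x + g x * partial j f x)).
      move=> x; exact: (continuousD (continuousM (cf x) (cdg x))
        (continuousM (cg x) (cdf x))).
    by apply/funext => x; rewrite partialM//; exact: smooth_derivable.
  - by move=> x /g0 ->; rewrite mulr0.
apply/funext => x; rewrite partialM; [|exact: smooth_derivable..].
by rewrite [partial j f x * _]mulrC.
Qed.

End weak_partial.

Section weak_gradient.
Context {R : realType} {d : nat}.
Local Notation mu := (@lebesgue_rV R d).
Local Notation Re := (@complex.Re _).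
Local Notation Im := (@complex.Im _).
Local Notation normc := (@complex.ComplexField.Normc.normc _).
Implicit Types (u phi : 'rV[R]_d -> R[i]) (G : 'rV[R]_d -> 'rV[R[i]]_d).

Lemma normcE (z : R[i]) : normc z = Num.sqrt (csq z).
Proof. by case: z. Qed.

Lemma Re_le_normc (z : R[i]) : `|Re z| <= normc z.
Proof.
rewrite normcE -sqrtr_sqr; apply: ler_wsqrtr.
by rewrite /csq lerDl sqr_ge0.
Qed.

Lemma Im_le_normc (z : R[i]) : `|Im z| <= normc z.
Proof.
rewrite normcE -sqrtr_sqr; apply: ler_wsqrtr.
by rewrite /csq lerDr sqr_ge0.
Qed.

Lemma normc_le (z : R[i]) : normc z <= `|Re z| + `|Im z|.
Proof.
have h : 0 <= `|Re z| + `|Im z| by rewrite addr_ge0.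
rewrite normcE -(ger0_norm h) -sqrtr_sqr; apply: ler_wsqrtr.
rewrite /csq -(real_normK (num_real (Re z))) -(real_normK (num_real (Im z))).
by rewrite sqrrD -addrA lerD2l lerDr mulrn_wge0// mulr_ge0.
Qed.

Lemma measurable_normc u : cmeasurable u -> measurable_fun setT (fun x => normc (u x)).
Proof.
move=> mu_; rewrite (_ : (fun x => _) = (fun x => csq (u x) `^ 2^-1)).
  by apply: measurable_fun_powR; exact: measurable_csq.
by apply/funext => x; rewrite normcE powR12_sqrt// csq_ge0.
Qed.

Lemma clocally_integrableP u : clocally_integrable u <->
  loc_int (Re \o u) /\ loc_int (Im \o u).
Proof.
split.
  move=> [[mr mi] li]; have mn := measurable_normc (conj mr mi).
  have ln : loc_int (fun x => normc (u x)).
    split => // M; apply/integrableP; split.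
      by apply: measurable_funTS; exact/measurable_EFinP.
    apply: le_lt_trans (li _ (@compact_cbox R d M)).
    apply: ge0_le_integral => //; first exact: measurable_cbox.
    - by apply: measurable_funTS; apply/measurable_EFinP; exact: measurableT_comp.
    - by apply: measurable_funTS; exact/measurable_EFinP.
    - by move=> x _ /=; rewrite lee_fin ger0_norm// normcE sqrtr_ge0.
  split; apply: (loc_int_le _ ln) => // x /=; rewrite (le_trans _ (ler_norm _))//.
    exact: Re_le_normc.
  exact: Im_le_normc.
move=> [lr li]; have mu_ : cmeasurable u by split; [exact: lr.1|exact: li.1].
split => // K cK.
have [M KM] : exists M, K `<=` cbox M.
  have [M [_ hM]] := compact_bounded cK; exists (M + 1) => x Kx i.
  by rewrite (le_trans (norm_coord_le _ _))//; apply: hM => //; rewrite ltrDl.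
have mK : measurable K.
  by apply: closed_measurable_rV; apply: compact_closed => //; exact: norm_hausdorff.
have mM := @measurable_cbox R d M.
have := (loc_intD (loc_int_norm lr) (loc_int_norm li)).2 M => /integrableP[_].
have mn : measurable_fun setT (fun x => (normc (u x))%:E).
  by apply/measurable_EFinP; exact: measurable_normc.
have n0 (z : R[i]) : 0 <= normc z by rewrite normcE sqrtr_ge0.
apply: le_lt_trans; apply: (@le_trans _ _ (\int[mu]_(x in cbox M) (normc (u x))%:E)%E).
  apply: ge0_subset_integral => //; first exact: measurable_funTS.
  by move=> x _; rewrite lee_fin.
apply: ge0_le_integral => //.
- by move=> x _; rewrite lee_fin.
- exact: measurable_funTS.
- apply: measurable_funTS; apply: measurableT_comp => //; apply/measurable_EFinP.
  exact: (loc_intD (loc_int_norm lr) (loc_int_norm li)).1.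
- move=> x _; rewrite /= lee_fin (le_trans (normc_le _))//; exact: ler_norm.
Qed.

Lemma cintegralE (a b : 'rV[R]_d -> R) :
  cintegral (fun x => a x +i* b x) = (\int[mu]_x a x) +i* (\int[mu]_x b x).
Proof. by []. Qed.

(** Real test functions separate real and imaginary parts; conversely a complex test function
    expands into four real integrations by parts. *)
Lemma is_gradP u G : is_grad u G <->
  real_grad (Re \o u) (fun j x => Re (G x ord0 j)) /\
  real_grad (Im \o u) (fun j x => Im (G x ord0 j)).
Proof.
split.
  move=> [/clocally_integrableP[lr li] lG w].
  have lGr j := ((clocally_integrableP _).1 (lG j)).1.
  have lGi j := ((clocally_integrableP _).1 (lG j)).2.
  have key j f M : smooth f -> (forall x, ~ cbox M x -> f x = 0) ->
      (\int[mu]_x (Re (u x) * partial j f x) =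
        - (\int[mu]_x (Re (G x ord0 j) * f x))) /\
      (\int[mu]_x (Im (u x) * partial j f x) =
        - (\int[mu]_x (Im (G x ord0 j) * f x))).
    move=> sf f0; have := w _ j (test_function_real sf f0).
    rewrite (_ : (fun x => u x * _) = (fun x => (Re (u x) * partial j f x) +i*
        (Im (u x) * partial j f x))); last first.
      apply/funext => x; rewrite /cpartial (_ : Im \o _ = (fun=> 0))// partial_cst.
      by case: (u x) => a b /=; congr (_ +i* _); rewrite /=; ring.
    rewrite (_ : (fun x => G x ord0 j * _) = (fun x => (Re (G x ord0 j) * f x) +i*
        (Im (G x ord0 j) * f x))); last first.
      apply/funext => x; case: (G x ord0 j) => a b /=.
      by congr (_ +i* _); rewrite /=; ring.
    by rewrite !cintegralE => -[].
  split; split => // j; split; [exact: lGr| |exact: lGi|] => f M sf f0;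
    by have [] := key j f M sf f0.
move=> [[lr hr] [li hi]]; split.
- exact/clocally_integrableP.
- move=> j; apply/clocally_integrableP; have [? _] := hr j; have [? _] := hi j.
  by split.
move=> phi j tphi; have [M hM] := test_function_support tphi.
have [[sf sg] _] := tphi.
set f := Re \o phi in sf; set g := Im \o phi in sg.
have f0 x : ~ cbox M x -> f x = 0 by move=> /hM; rewrite /f /= => ->.
have g0 x : ~ cbox M x -> g x = 0 by move=> /hM; rewrite /g /= => ->.
have cf := smooth_continuous sf; have cg := smooth_continuous sg.
have cdf := smooth_partial_continuous (j := j) sf.
have cdg := smooth_partial_continuous (j := j) sg.
have df0 := partial_outside j f0; have dg0 := partial_outside j g0.
have [lGr wr] := hr j; have [lGi wi] := hi j.
rewrite (_ : (fun x => u x * _) = (fun x =>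
    (Re (u x) * partial j f x - Im (u x) * partial j g x) +i*
    (Re (u x) * partial j g x + Im (u x) * partial j f x))); last first.
  apply/funext => x; rewrite /cpartial -/f -/g; case: (u x) => a b /=.
  by congr (_ +i* _); rewrite /=; ring.
rewrite (_ : (fun x => G x ord0 j * _) = (fun x =>
    (Re (G x ord0 j) * f x - Im (G x ord0 j) * g x) +i*
    (Re (G x ord0 j) * g x + Im (G x ord0 j) * f x))); last first.
  apply/funext => x; rewrite /f /g /=; case: (phi x) => a b.
  case: (G x ord0 j) => a' b' /=.
  by congr (_ +i* _); rewrite /=; ring.
rewrite !cintegralE !RintegralB ?RintegralD//;
  try by [exact: integrable_test cf f0 | exact: integrable_test cg g0 |
  exact: integrable_test cdf df0 | exact: integrable_test cdg dg0].
have := wr f M sf f0; have := wi f M sf f0.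
have := wr g M sg g0; have := wi g M sg g0.
move=> /= -> -> -> ->.
by congr (_ +i* _); rewrite /=; ring.
Qed.

Lemma grad_is_grad u : weakly_differentiable u -> is_grad u (grad u).
Proof.
move=> uP; rewrite /grad; case: pselect => // uP'.
exact: projT2 (cid uP').
Qed.

Lemma is_grad_unique u G H : is_grad u G -> is_grad u H ->
  {ae mu, forall x, G x = H x}.
Proof.
move=> /is_gradP[Gr Gi] /is_gradP[Hr Hi].
have hr := real_grad_unique Gr Hr; have hi := real_grad_unique Gi Hi.
have h : {ae mu, forall x, forall j, G x ord0 j = H x ord0 j}.
  apply: filter_forall => j; have := hr j; have := hi j.
  apply: filterS2 => x /=; case: (G x ord0 j) => a b; case: (H x ord0 j) => a' b' /=.
  by move=> -> ->.
by apply: filterS h => x h; apply/rowP.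
Qed.

Lemma is_gradB u phi G : is_grad u G -> test_function phi ->
  is_grad (fun x => u x - phi x) (fun x => \row_j (G x ord0 j - cpartial j phi x)).
Proof.
move=> /is_gradP[Gr Gi] tphi; have [M hM] := test_function_support tphi.
have [[sf sg] _] := tphi.
have f0 x : ~ cbox M x -> (Re \o phi) x = 0 by move=> /hM /= ->.
have g0 x : ~ cbox M x -> (Im \o phi) x = 0 by move=> /hM /= ->.
apply/is_gradP; split.
  have := real_gradB Gr (test_real_grad sf f0).
  congr (real_grad _ _).
    by apply/funext => x /=; case: (u x) => a b; case: (phi x).
  by apply/funext => j; apply/funext => x; rewrite mxE; case: (G x ord0 j).
have := real_gradB Gi (test_real_grad sg g0).
congr (real_grad _ _).
  by apply/funext => x /=; case: (u x) => a b; case: (phi x).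
by apply/funext => j; apply/funext => x; rewrite mxE; case: (G x ord0 j).
Qed.

(** Only almost everywhere: [grad] of the difference is chosen independently of [grad u], and
    uniqueness alone relates them. *)
Lemma mgrad_subr (A : 'rV[R]_d -> 'rV[R]_d) u phi : weakly_differentiable u -> test_function phi ->
  {ae mu, forall x, mgrad A (fun x => u x - phi x) x =
    mgrad A u x - classical_mgrad A phi x}.
Proof.
move=> wu tphi; have gB := is_gradB (grad_is_grad wu) tphi.
have wB : weakly_differentiable (fun x => u x - phi x) by eexists; exact: gB.
have := is_grad_unique (grad_is_grad wB) gB.
apply: filterS => x E; apply/rowP => j; rewrite !mxE E mxE.
by rewrite mulrBr opprD addrACA.
Qed.

Lemma cmeasurable_mgrad (A : 'rV[R]_d -> 'rV[R]_d) u j : weakly_differentiable u ->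
  (forall j, continuous (fun x => A x ord0 j)) ->
  cmeasurable u /\ cmeasurable (fun x => mgrad A u x ord0 j).
Proof.
move=> /grad_is_grad /is_gradP[[[mr _] hr] [[mi _] hi]] cA.
have mA : measurable_fun setT (fun x => A x ord0 j).
  by apply: continuous_measurable_rV; exact: cA.
have [[mGr _] _] := hr j; have [[mGi _] _] := hi j.
split; first by split.
split.
  rewrite (_ : _ \o _ = (fun x => Re (grad u x ord0 j) - A x ord0 j * Im (u x))).
    by apply: measurable_funB => //; exact: measurable_funM.
  apply/funext => x; rewrite /= mxE; case: (grad u x ord0 j) => a b.
  by case: (u x) => a' b' /=; ring.
rewrite (_ : _ \o _ = (fun x => Im (grad u x ord0 j) + A x ord0 j * Re (u x))).
  by apply: measurable_funD => //; exact: measurable_funM.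
apply/funext => x; rewrite /= mxE; case: (grad u x ord0 j) => a b.
by case: (u x) => a' b' /=; ring.
Qed.

End weak_gradient.

(** * Approximation by test functions *)

Section hardy_density_convexity.
Context {R : realType} {d : nat}.
Local Notation Re := (@complex.Re _).
Local Notation Im := (@complex.Im _).
Implicit Types (x : 'rV[R]_d) (z : R[i]) (G : 'rV[R[i]]_d).

Lemma csqD (al be : R) : (forall a b : R, (a + b) ^+ 2 <= al * a ^+ 2 + be * b ^+ 2) ->
  forall z z' : R[i], csq (z + z') <= al * csq z + be * csq z'.
Proof.
move=> h z z'; have -> : csq (z + z') = (Re z + Re z') ^+ 2 + (Im z + Im z') ^+ 2.
  by case: z => a b; case: z'.
rewrite /csq !mulrDr addrACA; exact: lerD.
Qed.

Lemma gsqD (al be : R) : (forall a b : R, (a + b) ^+ 2 <= al * a ^+ 2 + be * b ^+ 2) ->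
  forall G G', gsq (G + G') <= al * gsq G + be * gsq G'.
Proof.
move=> h G G'; rewrite /gsq !mulr_sumr -big_split/=.
by apply: ler_sum => j _; rewrite mxE; exact: csqD.
Qed.

Lemma radial_sqD (al be k : R) :
  (forall a b : R, (a + b) ^+ 2 <= al * a ^+ 2 + be * b ^+ 2) ->
  forall x z z' G G', radial_sq k x (z + z') (G + G') <=
    al * radial_sq k x z G + be * radial_sq k x z' G'.
Proof.
move=> h x z z' G G'; rewrite /radial_sq !mulr_sumr -big_split/=.
apply: ler_sum => j _; rewrite mxE.
move: (k * _ / _) => r; case: z => a b; case: z' => a' b'.
case: (G ord0 j) => u v; case: (G' ord0 j) => u' v' /=.
rewrite (_ : u + u' + r * (a + a') = (u + r * a) + (u' + r * a')); last by ring.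
rewrite (_ : v + v' + r * (b + b') = (v + r * b) + (v' + r * b')); last by ring.
by rewrite !mulrDr [leRHS]addrACA; apply: lerD; exact: h.
Qed.

Lemma csqN z : csq (- z) = csq z.
Proof. by case: z => a b; rewrite /csq/= !sqrrN. Qed.

Lemma gsqN G : gsq (- G) = gsq G.
Proof. by apply: eq_bigr => j _; rewrite mxE csqN. Qed.

Lemma radial_sq_le k x z G :
  radial_sq k x z G <= 2 * gsq G + 2 * (k ^+ 2 * (csq z / sqnorm x)).
Proof.
have [s sE] : exists s, s = sqnorm x by eexists.
rewrite /radial_sq -sE.
apply: (@le_trans _ _ (\sum_j (2 * csq (G ord0 j) +
    2 * (k ^+ 2 / s ^+ 2 * csq z) * x ord0 j ^+ 2))).
  apply: ler_sum => j _; rewrite /csq.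
  move: (Re z) (Im z) (Re _) (Im _) (x ord0 j) => a b u v t.
  (* 2|g|^2 + 2|r|^2 - |g + r|^2 = |g - r|^2. *)
  rewrite -subr_ge0 [leRHS](_ : _ = (u - k * t / s * a) ^+ 2 + (v - k * t / s * b) ^+ 2).
    by rewrite addr_ge0// sqr_ge0.
  by rewrite -exprVn; ring.
rewrite big_split/= -!mulr_sumr lerD2l -[\sum_(i < d) _]/(sqnorm x) -sE.
have [->|s0] := eqVneq s 0; first by rewrite invr0 !mulr0.
by rewrite le_eqVlt; apply/orP; left; apply/eqP; field.
Qed.

(** 2X + 2Y is the mean of 4X and 4Y, whence the factor 4^q. *)
Lemma powR_le2 (q X Y Z : R) : 1 <= q -> 0 <= X -> 0 <= Y -> 0 <= Z ->
  Z <= 2 * X + 2 * Y -> Z `^ q <= 4 `^ q * (X `^ q + Y `^ q).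
Proof.
move=> q1 X0 Y0 Z0 ZXY; have q0 : 0 <= q by lra.
have h := @powR_convex _ q (4 * X) (4 * Y) 2^-1 q1.
have {}h : (2^-1 * (4 * X) + (1 - 2^-1) * (4 * Y)) `^ q <=
    2^-1 * (4 * X) `^ q + (1 - 2^-1) * (4 * Y) `^ q.
  by apply: h; [rewrite mulr_ge0|rewrite mulr_ge0|lra].
rewrite !powRM// in h.
apply: (@le_trans _ _ ((2^-1 * (4 * X) + (1 - 2^-1) * (4 * Y)) `^ q)).
  apply: (ge0_ler_powR q0); rewrite ?nnegrE//; lra.
apply: (le_trans h).
have := powR_ge0 X q; have := powR_ge0 Y q; have := powR_ge0 4 q.
move: (X `^ q) (Y `^ q) (4 `^ q) => X' Y' F F0 Y'0 X'0.
have := mulr_ge0 F0 Y'0; have := mulr_ge0 F0 X'0; lra.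
Qed.

Lemma almost_convex_power (q eta al be C X Y Z : R) : 1 <= q ->
  (forall X Y : R, 0 <= X -> 0 <= Y ->
        (al * X + be * Y) `^ q <= eta * X `^ q + C * Y `^ q) ->
  0 <= X -> 0 <= Y -> 0 <= Z -> Z <= al * X + be * Y ->
  Z `^ q <= eta * X `^ q + C * Y `^ q.
Proof.
move=> q1 h X0 Y0 Z0 ZXY; apply: le_trans (h _ _ X0 Y0).
apply: ge0_ler_powR => //; rewrite ?nnegrE//; [lra|exact: le_trans ZXY].
Qed.

(** Both densities are combinations of (p/2)-th powers of nonnegative quadratic forms in (z, G), for
    which the scalar inequality holds termwise; one constant C serves all. *)
Lemma hardy_density_almost_convex (p eta : R) : 2 <= p -> 1 < eta ->
  exists C : R, [/\ 0 <= C,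
   (forall x z z' G G', hardy_density p x (z + z') (G + G') <=
      eta * hardy_density p x z G + C * hardy_density p x z' G') &
   (forall G G', gsq (G + G') `^ (p / 2) <=
      eta * gsq G `^ (p / 2) + C * gsq G' `^ (p / 2))].
Proof.
move=> p2 eta1; have q1 : 1 <= p / 2 by lra.
have [al [be [C [al0 be0 C0 h1 h2]]]] := almost_convex q1 eta1.
exists C; split => //; last first.
  move=> G G'; apply: (almost_convex_power q1 h2); rewrite ?gsq_ge0//.
  exact: gsqD.
move=> x z z' G G'; rewrite /hardy_density.
have c0 := ltW (remainder_cst_gt0 p2).
have m0 : 0 <= hardy_cst p d by exact: powR_ge0.
set k := (d%:R - p) / p.
have e1 : radial_sq k x (z + z') (G + G') `^ (p / 2) <=
    eta * radial_sq k x z G `^ (p / 2) + C * radial_sq k x z' G' `^ (p / 2).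
  apply: (almost_convex_power q1 h2); rewrite ?radial_sq_ge0//.
  exact: radial_sqD.
have e2 : (csq (z + z') / sqnorm x) `^ (p / 2) <=
    eta * (csq z / sqnorm x) `^ (p / 2) + C * (csq z' / sqnorm x) `^ (p / 2).
  apply: (almost_convex_power q1 h2); rewrite ?divr_ge0 ?csq_ge0 ?sqnorm_ge0//.
  rewrite !mulrA -mulrDl ler_wpM2r ?invr_ge0 ?sqnorm_ge0//; exact: csqD.
have := lerD (ler_wpM2l c0 e1) (ler_wpM2l m0 e2).
by move=> h; apply: (le_trans h); rewrite le_eqVlt; apply/orP; left; apply/eqP; ring.
Qed.

Lemma hardy_weight_le1 (p e : R) x : 2 <= p -> 0 < e -> hardy_weight p e x <= 1.
Proof.
move=> p2 e0; have q0 : 0 <= p / 2 by lra.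
have se0 : 0 < sqnorm x + e by rewrite ltr_wpDl// sqnorm_ge0.
have := @powR1 R; move/(congr1 (@^~ (p / 2))) => <-.
apply: (ge0_ler_powR q0); rewrite ?nnegrE ?divr_ge0 ?sqnorm_ge0 ?(ltW se0)//.
by rewrite ler_pdivrMr// mul1r lerDl ltW.
Qed.

(** The weight cancels the singularity: |z|^2/|x|^2 times |x|^2/(|x|^2+e) is at most |z|^2/e. This
    makes the error term controllable by the norm of the domain, with a constant depending on e. *)
Lemma hardy_density_bound (p e : R) : 2 <= p -> 0 < e -> exists K : R, 0 <= K /\
  forall x z G, hardy_weight p e x * hardy_density p x z G <=
    K * (gsq G `^ (p / 2) + csq z `^ (p / 2)).
Proof.
move=> p2 e0; have q1 : 1 <= p / 2 by lra.
have q0 : 0 <= p / 2 by lra.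
set k := (d%:R - p) / p.
have c0 := ltW (remainder_cst_gt0 p2).
have m0 : 0 <= hardy_cst p d by exact: powR_ge0.
pose K1 := remainder_cst p * 4 `^ (p / 2).
pose K2 := (K1 * (k ^+ 2) `^ (p / 2) + hardy_cst p d) * e^-1 `^ (p / 2).
have K10 : 0 <= K1 by rewrite mulr_ge0 ?powR_ge0.
have K20 : 0 <= K2 by rewrite mulr_ge0 ?powR_ge0// addr_ge0// mulr_ge0 ?powR_ge0.
exists (K1 + K2); split; first by rewrite addr_ge0.
move=> x z G; have s0 := sqnorm_ge0 x.
have cs0 : 0 <= csq z / sqnorm x by rewrite divr_ge0// csq_ge0.
have h1 : radial_sq k x z G `^ (p / 2) <=
    4 `^ (p / 2) * (gsq G `^ (p / 2) + (k ^+ 2) `^ (p / 2) * (csq z / sqnorm x) `^ (p / 2)).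
  rewrite -powRM ?sqr_ge0//; apply: powR_le2; rewrite ?gsq_ge0 ?radial_sq_ge0//.
    by rewrite mulr_ge0// sqr_ge0.
  exact: radial_sq_le.
have w0 : 0 <= hardy_weight p e x by exact: powR_ge0.
have w1 := hardy_weight_le1 x p2 e0.
have h2 : hardy_weight p e x * (csq z / sqnorm x) `^ (p / 2) <=
    e^-1 `^ (p / 2) * csq z `^ (p / 2).
  have se0 : 0 < sqnorm x + e by rewrite ltr_wpDl.
  rewrite /hardy_weight -!powRM ?divr_ge0 ?invr_ge0 ?csq_ge0 ?(ltW e0) ?(ltW se0)//.
  apply: (ge0_ler_powR q0); rewrite ?nnegrE ?mulr_ge0 ?invr_ge0 ?csq_ge0
    ?(ltW e0) ?(ltW se0)//.
  have [->|s_neq0] := eqVneq (sqnorm x) 0.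
    by rewrite !mul0r mulr_ge0 ?invr_ge0 ?csq_ge0 ?(ltW e0).
  rewrite [leLHS](_ : _ = (sqnorm x + e)^-1 * csq z); last by field; rewrite s_neq0 gt_eqF.
  by rewrite ler_wpM2r ?csq_ge0// lef_pV2 ?posrE// lerDr.
have g0 := powR_ge0 (gsq G) (p / 2); have z0 := powR_ge0 (csq z) (p / 2).
move: h1 h2 g0 z0; rewrite /hardy_density -/k.
move: (hardy_weight _ _ _) w0 w1 => w w0 w1.
have kq0 := powR_ge0 (k ^+ 2) (p / 2).
move: ((csq z / _) `^ _) => S; move: (gsq G `^ _) (csq z `^ _) => A B.
move: (radial_sq _ _ _ _ `^ _) => T h1 h2 A0 B0.
have := ler_wpM2l w0 (ler_wpM2l c0 h1).
rewrite (_ : remainder_cst p * (4 `^ _ * _) = K1 * (A + (k ^+ 2) `^ (p / 2) * S)); last by rewrite /K1; ring.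
have hA : w * (K1 * A) <= K1 * A by rewrite ler_piMl// mulr_ge0.
have hS := ler_wpM2l (addr_ge0 (mulr_ge0 K10 kq0) m0) h2.
have hB : 0 <= K1 * B by rewrite mulr_ge0.
have hC : 0 <= K2 * A by rewrite mulr_ge0.
have EK : (K1 * (k ^+ 2) `^ (p / 2) + hardy_cst p d) * (e^-1 `^ (p / 2) * B) = K2 * B.
  by rewrite /K2; ring.
rewrite EK in hS; move: hA hS hB hC.
move: (K2) (K1) ((k ^+ 2) `^ (p / 2)) (hardy_cst p d) (remainder_cst p).
move=> K2' K1' a m c; rewrite !mulrDr !mulrDl !mulrA.
rewrite (_ : K1' * a * w * S = w * K1' * a * S); last by ring.
rewrite (_ : m * w * S = w * m * S); last by ring.
lra.
Qed.

End hardy_density_convexity.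

Section hardy_domain.
Context {R : realType} {d : nat}.
Local Notation Re := (@complex.Re _).
Local Notation Im := (@complex.Im _).
Local Notation normc := (@complex.ComplexField.Normc.normc _).
Local Notation mu := (@lebesgue_rV R d).
Implicit Types (A : 'rV[R]_d -> 'rV[R]_d) (p : R) (u : 'rV[R]_d -> R[i]).

Lemma mformE A p u :
  (mform A p u = \int[mu]_x (gsq (mgrad A u x) `^ (p / 2))%:E)%E.
Proof. by apply: eq_integral => x _; rewrite cenorm_powR. Qed.

Lemma normc_integralE p u :
  (\int[mu]_x (normc (u x) `^ p)%:E = \int[mu]_x (csq (u x) `^ (p / 2))%:E)%E.
Proof. by apply: eq_integral => x _; rewrite normc_powR. Qed.

Lemma poweR_inv_lt (y : \bar R) (p e : R) : 0 < p -> 0 < e -> (0 <= y)%E ->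
  (y `^ p^-1 < e%:E)%E -> (y < (e `^ p)%:E)%E.
Proof.
move=> p0 e0; case: y => [r| |]//.
- rewrite lee_fin => r0; rewrite poweR_EFin !lte_fin => h.
  rewrite (_ : r = (r `^ p^-1) `^ p); last first.
    by rewrite -powRrM mulVf ?gt_eqF// powRr1.
  by apply: gt0_ltr_powR; rewrite ?nnegrE ?powR_ge0// ltW.
- by rewrite poweRyr ?invr_neq0 ?gt_eqF.
Qed.

Lemma mform_domain_finite A p u : 0 < p -> mform_domain A p u ->
  (mform A p u < +oo)%E.
Proof.
move=> p0 [_ + _] => /lty_poweRy; rewrite invr_neq0 ?gt_eqF// => /(_ isT).
apply: le_lt_trans; apply: leeDl; apply: integral_ge0 => x _.
by rewrite lee_fin powR_ge0.
Qed.

Variables (A : 'rV[R]_d -> 'rV[R]_d) (p : R) (u : 'rV[R]_d -> R[i]).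
Hypothesis cA : forall j, continuous (fun x => A x ord0 j).
Hypotheses (p2 : 2 <= p) (pd : p < d%:R).
Hypothesis du : mform_domain A p u.

Let p0 : 0 < p. Proof. exact: lt_le_trans p2. Qed.
Let wu : weakly_differentiable u. Proof. by have [] := du. Qed.

Lemma mform_approx (dl : R) : 0 < dl -> exists2 phi, test_function phi &
  (\int[mu]_x (gsq (mgrad A (fun x => u x - phi x) x) `^ (p / 2) +
     csq (u x - phi x) `^ (p / 2))%:E <= dl%:E)%E.
Proof.
move=> dl0; have e0 : 0 < dl `^ p^-1 by rewrite powR_gt0.
have [_ _ /(_ _ e0)[phi tphi h]] := du; exists phi => //.
have wB : weakly_differentiable (fun x => u x - phi x).
  by eexists; exact: is_gradB (grad_is_grad wu) tphi.
have i0 (v : 'rV[R]_d -> R) q : (0 <= \int[mu]_x (v x `^ q)%:E)%E.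
  by apply: integral_ge0 => x _; rewrite lee_fin powR_ge0.
have m0 : (0 <= mform A p (fun x => (u x - phi x)%R))%E by rewrite mformE; exact: i0.
have n0 : (0 <= \int[mu]_x (normc (u x - phi x) `^ p)%:E)%E by exact: i0.
have := poweR_inv_lt p0 e0 (adde_ge0 m0 n0) h.
rewrite -powRrM mulVf ?gt_eqF// powRr1 ?(ltW dl0)// mformE normc_integralE.
move=> /ltW; apply: le_trans; rewrite -ge0_integralD//.
- by move=> x _; rewrite lee_fin powR_ge0.
- apply/measurable_EFinP; apply: measurable_fun_powR; apply: measurable_gsq => j.
  by have [] := cmeasurable_mgrad j wB cA.
- by move=> x _; rewrite lee_fin powR_ge0.
- apply/measurable_EFinP; apply: measurable_fun_powR; apply: measurable_csq.
  have [[[mr _] _] [[mi _] _]] := (is_gradP _ _).1 (grad_is_grad wB).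
  by split.
Qed.

Lemma cmeasurable_domain : cmeasurable u.
Proof.
by have [[[mr _] _] [[mi _] _]] := (is_gradP _ _).1 (grad_is_grad wu); split.
Qed.

Let w e x := @hardy_weight R d p e x.

(** Almost convexity is used twice, to pass from u to phi in the density and from phi back to u in
    the form, hence eta^2. The constant K is fixed before dl, so the error can then be sent to 0. *)
Lemma hardy_domain_almost (e eta : R) : 0 < e -> 1 < eta ->
  exists K : R, 0 <= K /\ forall dl : R, 0 < dl ->
  (\int[mu]_x (w e x * hardy_density p x (u x) (mgrad A u x))%:E <=
   (eta ^+ 2)%:E * mform A p u + (K * dl)%:E)%E.
Proof.
move=> e0 eta1; have eta0 : 0 <= eta by rewrite ltW// (lt_trans _ eta1).
have [C [C0 hQ hG]] := @hardy_density_almost_convex R d p eta p2 eta1.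
have [K [K0 hK]] := @hardy_density_bound R d p e p2 e0.
exists (C * K + eta * C); split; first by rewrite addr_ge0// mulr_ge0.
move=> dl dl0; have [phi tphi hphi] := mform_approx dl0.
have wB : weakly_differentiable (fun x => u x - phi x).
  by eexists; exact: is_gradB (grad_is_grad wu) tphi.
pose D := mgrad A (fun x => u x - phi x).
pose E x := gsq (D x) `^ (p / 2) + csq (u x - phi x) `^ (p / 2).
have E0 x : 0 <= E x by rewrite addr_ge0// powR_ge0.
have mD j : cmeasurable (fun x => D x ord0 j).
  by have [] := cmeasurable_mgrad j wB cA.
have mE : measurable_fun setT (fun x => (E x)%:E).
  apply/measurable_EFinP; apply: measurable_funD; apply: measurable_fun_powR.
    exact: measurable_gsq.
  apply: measurable_csq.
  have [[[mr _] _] [[mi _] _]] := (is_gradP _ _).1 (grad_is_grad wB).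
  by split.
have mw : measurable_fun setT (w e) by apply: measurable_hardy_weight; exact: ltW.
have mc j := cmeasurable_classical_mgrad cA tphi j.
have mu_ := cmeasurable_domain.
have mGu j : cmeasurable (fun x => mgrad A u x ord0 j).
  by have [] := cmeasurable_mgrad j wu cA.
have mQu : measurable_fun setT
    (fun x => (w e x * hardy_density p x (u x) (mgrad A u x))%:E).
  by apply/measurable_EFinP; apply: measurable_funM => //;
    exact: measurable_hardy_density.
have mQp : measurable_fun setT
    (fun x => (w e x * hardy_density p x (phi x) (classical_mgrad A phi x))%:E).
  apply/measurable_EFinP; apply: measurable_funM => //.
  by apply: measurable_hardy_density => //; exact: cmeasurable_test.
have Q0 x z (G : 'rV[R[i]]_d) : 0 <= w e x * hardy_density p x z G.
  by rewrite mulr_ge0 ?powR_ge0// hardy_density_ge0.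
have sub := mgrad_subr A wu tphi.
have g0 (v : 'rV[R[i]]_d) : 0 <= gsq v `^ (p / 2) by exact: powR_ge0.
have mgu : measurable_fun setT (fun x => (gsq (mgrad A u x) `^ (p / 2))%:E).
  by apply/measurable_EFinP; apply: measurable_fun_powR; exact: measurable_gsq.
have mgc : measurable_fun setT (fun x => (gsq (classical_mgrad A phi x) `^ (p / 2))%:E).
  by apply/measurable_EFinP; apply: measurable_fun_powR; exact: measurable_gsq.
have h1 : (\int[mu]_x (w e x * hardy_density p x (u x) (mgrad A u x))%:E <=
    eta%:E * \int[mu]_x (w e x *
      hardy_density p x (phi x) (classical_mgrad A phi x))%:E +
    (C * K)%:E * \int[mu]_x (E x)%:E)%E.
  rewrite -ge0_integralZl//; last first.
    by move=> x _; rewrite lee_fin.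
  rewrite -ge0_integralZl//; last 2 first.
    by move=> x _; rewrite lee_fin.
    by rewrite lee_fin mulr_ge0.
  rewrite -ge0_integralD//; last 4 first.
  - by move=> x _; rewrite -EFinM lee_fin mulr_ge0.
  - exact: measurable_funeM.
  - by move=> x _; rewrite -EFinM lee_fin !mulr_ge0.
  - exact: measurable_funeM.
  apply: ae_ge0_le_integral => //.
  - by move=> x _; rewrite lee_fin.
  - move=> x _; rewrite -!EFinM -EFinD lee_fin.
    by apply: addr_ge0; apply: mulr_ge0 => //; exact: mulr_ge0.
  - by apply: emeasurable_funD; exact: measurable_funeM.
  apply: filterS sub => x hx _; rewrite -!EFinM -EFinD lee_fin.
  have Eu : u x = phi x + (u x - phi x) by rewrite addrC subrK.
  have EG : mgrad A u x = classical_mgrad A phi x + D x by rewrite /D hx addrC subrK.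
  have hx1 := ler_wpM2l (powR_ge0 _ _ : 0 <= w e x)
    (hQ x (phi x) (u x - phi x) (classical_mgrad A phi x) (D x)).
  rewrite -Eu -EG in hx1; apply: (le_trans hx1).
  rewrite mulrDr mulrCA lerD2l mulrCA -mulrA ler_wpM2l//; exact: hK.
(* Here phi = u - (u - phi), so the error enters with the opposite sign, which [gsqN] removes. *)
have h2 : (\int[mu]_x (gsq (classical_mgrad A phi x) `^ (p / 2))%:E <=
    eta%:E * mform A p u + C%:E * \int[mu]_x (E x)%:E)%E.
  rewrite mformE -ge0_integralZl//; last by move=> x _; rewrite lee_fin.
  rewrite -ge0_integralZl//; last by move=> x _; rewrite lee_fin.
  rewrite -ge0_integralD//; last 4 first.
  - by move=> x _; rewrite -EFinM lee_fin mulr_ge0.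
  - exact: measurable_funeM.
  - by move=> x _; rewrite -EFinM lee_fin !mulr_ge0.
  - exact: measurable_funeM.
  apply: ae_ge0_le_integral => //.
  - by move=> x _; rewrite lee_fin.
  - by move=> x _; rewrite -!EFinM -EFinD lee_fin addr_ge0// !mulr_ge0.
  - by apply: emeasurable_funD; exact: measurable_funeM.
  apply: filterS sub => x hx _; rewrite -!EFinM -EFinD lee_fin.
  have -> : classical_mgrad A phi x = mgrad A u x + - D x.
    by rewrite /D hx opprB addrC subrK.
  rewrite (le_trans (hG _ _))// lerD2l ler_wpM2l// gsqN /E lerDl.
  exact: powR_ge0.
apply: (le_trans h1).
have h3 : (\int[mu]_x (w e x *
      hardy_density p x (phi x) (classical_mgrad A phi x))%:E <=
    eta%:E * mform A p u + C%:E * dl%:E)%E.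
  apply: (le_trans (hardy_test_function cA tphi p2 pd e0)).
  apply: (le_trans h2); rewrite leeD2l// lee_wpmul2l// lee_fin//.
have [I IE] : exists I, mform A p u = I%:E.
  have m0 : (0 <= mform A p u)%E by rewrite mformE; apply: integral_ge0 => x _; rewrite lee_fin.
  have := mform_domain_finite p0 du; move: m0.
  by case: (mform A p u) => // r _ _; exists r.
rewrite IE in h3 *.
apply: (@le_trans _ _ (eta%:E * (eta%:E * I%:E + C%:E * dl%:E) + (C * K)%:E * dl%:E)%E).
  by apply: leeD; apply: lee_wpmul2l => //; rewrite lee_fin// mulr_ge0.
rewrite -?EFinM -?EFinD -?EFinM -?EFinD lee_fin le_eqVlt; apply/orP; left; apply/eqP.
ring.
Qed.

Lemma hardy_domain_weight (e : R) : 0 < e ->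
  (\int[mu]_x (w e x * hardy_density p x (u x) (mgrad A u x))%:E <=
   mform A p u)%E.
Proof.
move=> e0.
have m0 : (0 <= mform A p u)%E.
  by rewrite mformE; apply: integral_ge0 => x _; rewrite lee_fin powR_ge0.
have [I IE] : exists I, mform A p u = I%:E.
  have := mform_domain_finite p0 du; move: m0.
  by case: (mform A p u) => // r _ _; exists r.
have I0 : 0 <= I by rewrite IE lee_fin in m0.
apply/lee_addgt0Pr => t t0.
have I1 : 0 < 6 * (I + 1) by rewrite mulr_gt0// ltr_wpDl.
(* With eta = 1 + a and a <= 1, (1+a)^2 I <= I + 3 a I <= I + t/2; the other half of t pays for K dl
   with dl = t / (2 (K+1)). *)
have [a [a0 a1 aI]] : exists a, [/\ 0 < a, a <= 1 & a * (6 * (I + 1)) <= t].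
  exists (Num.min 1 (t / (6 * (I + 1)))); split.
  - by rewrite lt_min ltr01/= divr_gt0.
  - by rewrite ge_min lexx.
  - by rewrite -ler_pdivlMr// ge_min lexx orbT.
have eta1 : 1 < 1 + a by rewrite ltrDl.
have [K [K0 hK]] := hardy_domain_almost e0 eta1.
have K1 : 0 < K + 1 by rewrite ltr_wpDl.
have t2 : 0 < t / 2 by rewrite divr_gt0.
have := hK _ (divr_gt0 t2 K1); rewrite IE => /le_trans; apply.
rewrite -EFinM -!EFinD lee_fin.
have h1 : K * (t / 2 / (K + 1)) <= t / 2.
  by rewrite mulrCA ler_piMr ?(ltW t2)// ler_pdivrMr// mul1r lerDl.
have h2 : a * a * I <= a * I.
  by rewrite ler_wpM2r// ler_piMl// ltW.
rewrite (_ : a * (6 * (I + 1)) = 6 * (a * I) + 6 * a) in aI; last by ring.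
rewrite (_ : (1 + a) ^+ 2 * I = I + 2 * (a * I) + a * a * I); last by ring.
move: h1 aI h2 a0 t0; move: (K * _) (a * I) (a * a * I) => KK aI aaI.
lra.
Qed.

End hardy_domain.

(** * Removing the regularization *)

Section hardy_limit.
Context {R : realType} {d : nat}.
Local Notation Re := (@complex.Re _).
Local Notation Im := (@complex.Im _).
Local Notation normc := (@complex.ComplexField.Normc.normc _).
Local Notation mu := (@lebesgue_rV R d).

Lemma cvg_powR_harmonic (s r : R) : 0 <= s -> 0 <= r ->
  (s + n.+1%:R^-1) `^ r @[n --> \oo] --> s `^ r.
Proof.
move=> s0 r0.
have c : continuous (fun t : R => (s + `|t|) `^ r).
  apply: continuous_powR_nneg => //; first by move=> t; rewrite addr_ge0.
  by move=> t; apply: continuousD; [exact: cst_continuous|exact: norm_continuous].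
have h : (s + `|n.+1%:R^-1|) `^ r @[n --> \oo] --> (s + `|0 : R|) `^ r.
  by apply: (continuous_cvg _ (c 0)); exact: cvg_harmonic.
rewrite normr0 addr0 in h; apply: cvg_trans h.
by apply: near_eq_cvg; apply: nearW => n; rewrite ger0_norm.
Qed.

Lemma cvg_harmonicD (s : R) : (s + n.+1%:R^-1) @[n --> \oo] --> s.
Proof.
by rewrite -[X in _ --> X]addr0; apply: cvgD; [exact: cvg_cst|exact: cvg_harmonic].
Qed.

Lemma cvg_hardy_weight (p : R) (x : 'rV[R]_d) : 0 < p ->
  hardy_weight p n.+1%:R^-1 x @[n --> \oo] --> ((sqnorm x != 0)%:R : R).
Proof.
move=> p0; have q0 : 0 < p / 2 by rewrite divr_gt0.
rewrite /hardy_weight; have [->|s0] := eqVneq (sqnorm x) 0.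
  by under eq_fun do rewrite mul0r powR0 ?gt_eqF//; exact: cvg_cst.
have h : sqnorm x / (sqnorm x + n.+1%:R^-1) @[n --> \oo] --> sqnorm x / sqnorm x.
  apply: cvgM; first exact: cvg_cst.
  by apply: cvgV => //; exact: cvg_harmonicD.
rewrite divff// in h.
rewrite [X in _ --> X](_ : _ = 1 `^ (p / 2)); last by rewrite powR1.
apply: (@continuous_cvg _ _ _ _ _ _ (fun t => t `^ (p / 2))); last exact: h.
by apply: derivable_continuous_at; exact: is_derive1_powR.
Qed.

Variables (A : 'rV[R]_d -> 'rV[R]_d) (p : R) (u : 'rV[R]_d -> R[i]).
Hypothesis cA : forall j, continuous (fun x => A x ord0 j).
Hypotheses (p2 : 2 <= p) (pd : p < d%:R).
Hypothesis du : mform_domain A p u.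

Let p0 : 0 < p. Proof. exact: lt_le_trans p2. Qed.
Let wu : weakly_differentiable u. Proof. by have [] := du. Qed.

Definition punctured_radial (p : R) (A : 'rV[R]_d -> 'rV[R]_d) u (x : 'rV[R]_d) : R :=
  (sqnorm x != 0)%:R *
  radial_sq ((d%:R - p) / p) x (u x) (mgrad A u x) `^ (p / 2).

Lemma measurable_punctured_radial :
  measurable_fun setT (punctured_radial p A u).
Proof.
apply: measurable_funM.
  (* The convention [0^-1 = 0] writes the indicator of the complement of the origin as a product of
     measurable functions. *)
  rewrite (_ : (fun x => _) = (fun x => (sqnorm x * (sqnorm x)^-1) `^ 1)).
    apply: measurable_fun_powR; apply: measurable_funM; first exact: measurable_sqnorm.
    by apply: measurable_fun_inv; [exact: sqnorm_ge0|exact: measurable_sqnorm].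
  apply/funext => x; have [->|s0] := eqVneq (sqnorm x) 0.
    by rewrite mul0r powR0// oner_eq0.
  by rewrite divff// powR1.
apply: measurable_fun_powR; apply: measurable_radial_sq.
  exact: cmeasurable_domain du.
by move=> j; have [] := cmeasurable_mgrad j wu cA.
Qed.

Lemma measurable_hardy_term :
  measurable_fun setT (fun x => (csq (u x) / sqnorm x) `^ (p / 2)).
Proof.
apply: measurable_fun_powR; apply: measurable_funM.
  by apply: measurable_csq; exact: cmeasurable_domain du.
by apply: measurable_fun_inv; [exact: sqnorm_ge0|exact: measurable_sqnorm].
Qed.

(** Fatou along e = 1/(n+1): the integrands converge at every point, the origin included, and their
    integrals are bounded by [mform A p u]. *)
Lemma hardy_domain_limit :
  ((remainder_cst p)%:E * \int[mu]_x (punctured_radial p A u x)%:E +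
   (hardy_cst p d)%:E * \int[mu]_x ((csq (u x) / sqnorm x) `^ (p / 2))%:E <=
   mform A p u)%E.
Proof.
have q0 : 0 < p / 2 by rewrite divr_gt0.
have c0 := ltW (remainder_cst_gt0 p2).
have m0 : 0 <= hardy_cst p d by exact: powR_ge0.
have r0 x : 0 <= punctured_radial p A u x by rewrite mulr_ge0// powR_ge0.
rewrite -ge0_integralZl//; last 2 first.
- by apply/measurable_EFinP; exact: measurable_punctured_radial.
- by move=> x _; rewrite lee_fin.
rewrite -ge0_integralZl//; last 2 first.
- by apply/measurable_EFinP; exact: measurable_hardy_term.
- by move=> x _; rewrite lee_fin powR_ge0.
rewrite -ge0_integralD//; last 4 first.
- by move=> x _; rewrite -EFinM lee_fin mulr_ge0.
- by apply: measurable_funeM; apply/measurable_EFinP; exact: measurable_punctured_radial.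
- by move=> x _; rewrite -EFinM lee_fin mulr_ge0// powR_ge0.
- by apply: measurable_funeM; apply/measurable_EFinP; exact: measurable_hardy_term.
pose F n x := (hardy_weight p n.+1%:R^-1 x *
   hardy_density p x (u x) (mgrad A u x))%:E.
have mF n : measurable_fun setT (F n).
  apply/measurable_EFinP; apply: measurable_funM.
    by apply: measurable_hardy_weight; rewrite invr_ge0.
  apply: measurable_hardy_density; first exact: cmeasurable_domain du.
  by move=> j; have [] := cmeasurable_mgrad j wu cA.
have F0 n x : setT x -> (0 <= F n x)%E.
  by move=> _; rewrite lee_fin mulr_ge0 ?powR_ge0// hardy_density_ge0.
apply: (@le_trans _ _ (\int[mu]_x limn_einf (F ^~ x))%E).
  rewrite le_eqVlt; apply/orP; left; apply/eqP; apply: eq_integral => x _.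
  apply/esym; apply: (cvg_limn_einf_sup _).1; rewrite -!EFinM -EFinD.
  apply: cvg_EFin; first exact: nearW.
  have h := cvgM (@cvg_hardy_weight p x p0)
    (@cvg_cst _ (hardy_density p x (u x) (mgrad A u x)) _ (\oo : set_system nat) _).
  rewrite [X in _ --> X](_ : _ = (sqnorm x != 0)%:R *
      hardy_density p x (u x) (mgrad A u x)); first exact: h.
  rewrite /punctured_radial /hardy_density; have [s0|s0] := eqVneq (sqnorm x) 0.
    by rewrite s0 invr0 !mulr0 !mul0r powR0 ?gt_eqF// !mulr0 addr0.
  by rewrite !mul1r.
apply: (le_trans (fatou _ measurableT mF F0)).
rewrite limn_einf_lim; apply: lime_le; first exact: is_cvg_einfs.
apply: nearW => n; apply: (@le_trans _ _ (\int[mu]_x F n x)%E).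
  by apply: ereal_inf_lbound; exists n => /=.
by apply: hardy_domain_weight => //; rewrite invr_gt0.
Qed.

(** The Hardy constant is positive because p < d, and the other term is nonnegative, so the finite
    form bounds the Hardy integral. *)
Lemma hardy_term_finite :
  (\int[mu]_x ((csq (u x) / sqnorm x) `^ (p / 2))%:E < +oo)%E.
Proof.
have m0 : 0 < hardy_cst p d by rewrite powR_gt0// divr_gt0// subr_gt0.
have := le_lt_trans hardy_domain_limit (mform_domain_finite p0 du).
have i0 : (0 <= \int[mu]_x (punctured_radial p A u x)%:E)%E.
  by apply: integral_ge0 => x _; rewrite lee_fin mulr_ge0// powR_ge0.
have : (0 <= \int[mu]_x ((csq (u x) / sqnorm x) `^ (p / 2))%:E)%E.
  by apply: integral_ge0 => x _; rewrite lee_fin powR_ge0.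
case: (\int[mu]_x ((csq (u x) / sqnorm x) `^ (p / 2))%:E)%E => // [r _ _|_].
  by rewrite ltry.
rewrite gt0_muley// ?lte_fin// addey//.
apply/eqP => E; have := @mule_ge0 _ (remainder_cst p)%:E _ _ i0.
by rewrite E lee_fin (ltW (remainder_cst_gt0 p2)) => /(_ isT).
Qed.

Lemma integrable_hardy_term :
  mu.-integrable setT (fun x => ((csq (u x) / sqnorm x) `^ (p / 2))%:E).
Proof.
apply/integrableP; split; first by apply/measurable_EFinP; exact: measurable_hardy_term.
apply: le_lt_trans hardy_term_finite.
rewrite le_eqVlt; apply/orP; left; apply/eqP; apply: eq_integral => x _.
by rewrite gee0_abs// lee_fin powR_ge0.
Qed.

(** Meant for the real and imaginary parts of u: |u|/|x| <= 1 + (|u|/|x|)^p, and both terms are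
    locally integrable. *)
Lemma loc_int_hardy (h : 'rV[R]_d -> R) : measurable_fun setT h ->
  (forall x, h x ^+ 2 <= csq (u x)) -> loc_int (fun x => `|h x| * (Num.sqrt (sqnorm x))^-1).
Proof.
move=> mh hu.
have li : loc_int (fun x => 1 + (csq (u x) / sqnorm x) `^ (p / 2)).
  apply: loc_intD; first by apply: continuous_loc_int; exact: cst_continuous.
  split; first exact: measurable_hardy_term.
  by move=> M; apply: integrableS integrable_hardy_term => //; exact: measurable_cbox.
apply: (loc_int_le _ li).
  apply: measurable_funM; first exact: measurableT_comp.
  apply: measurable_fun_inv; first by move=> x; exact: sqrtr_ge0.
  under eq_fun do rewrite -powR12_sqrt ?sqnorm_ge0//.
  by apply: measurable_fun_powR; exact: measurable_sqnorm.
move=> x; set t := csq (u x) / sqnorm x.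
have t0 : 0 <= t by rewrite divr_ge0 ?csq_ge0// sqnorm_ge0.
have st : `| `|h x| * (Num.sqrt (sqnorm x))^-1| <= Num.sqrt t.
  rewrite ger0_norm ?mulr_ge0 ?invr_ge0 ?sqrtr_ge0// /t sqrtrM ?csq_ge0//.
  rewrite sqrtrV ?sqnorm_ge0// ler_wpM2r ?invr_ge0 ?sqrtr_ge0//.
  by rewrite -sqrtr_sqr; apply: ler_wsqrtr.
apply: (le_trans st); rewrite ger0_norm ?addr_ge0 ?powR_ge0//.
have [t1|t1] := leP t 1.
  apply: (@le_trans _ _ (Num.sqrt 1)); first exact: ler_wsqrtr.
  by rewrite sqrtr1 lerDl powR_ge0.
rewrite -powR12_sqrt// ler_wpDl//; apply: ler_powR; first exact: ltW.
by rewrite -[leLHS]mul1r ler_wpM2r// (le_trans _ p2)// ler1n.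
Qed.

End hardy_limit.

(** * Weak product rule with the weight |x|^g *)

Section radial_weight.
Context {R : realType} {d : nat}.
Local Notation mu := (@lebesgue_rV R d).

Lemma Rintegral_dominated0 (F : nat -> 'rV[R]_d -> R) (F' G : 'rV[R]_d -> R) :
  (forall n, measurable_fun setT (F n)) -> measurable_fun setT F' ->
  (forall x, F n x @[n --> \oo] --> F' x) ->
  (forall n x, `|F n x| <= G x) -> mu.-integrable setT (EFin \o G) ->
  (forall n, \int[mu]_x F n x = 0) -> \int[mu]_x F' x = 0.
Proof.
move=> mF mF' FF' FG iG F0.
have mEF n : measurable_fun setT (EFin \o F n) by exact/measurable_EFinP.
have mEF' : measurable_fun setT (EFin \o F') by exact/measurable_EFinP.
have cE x : (EFin \o F n) x @[n --> \oo] --> (EFin \o F') x.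
  by apply: cvg_EFin; [exact: nearW|exact: FF'].
have GE n x : (`|(EFin \o F n) x| <= (EFin \o G) x)%E by rewrite /= lee_fin.
have [iF' _ h] := dominated_convergence measurableT mEF mEF'
  (aeW _ (fun x _ => cE x)) iG (aeW _ (fun x n _ => GE n x)).
have F0' n : (\int[mu]_x (EFin \o F n) x = 0)%E.
  rewrite -[LHS]fineK; first by rewrite -[fine _]/(\int[mu]_x F n x) F0.
  apply: integrable_fin_num => //; apply: le_integrable iG => // x _ /=.
  by rewrite lee_fin (le_trans (FG n x))// ler_norm.
move: h; rewrite (_ : (fun n => _) = fun=> 0%E); last by apply/funext => n; exact: F0'.
move=> /cvg_lim h; rewrite /Rintegral -[X in fine X]h// lim_cst//.
Qed.

Variables (g : R) (h : 'rV[R]_d -> R) (K : 'I_d -> 'rV[R]_d -> R).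
Hypotheses (g0 : 0 < g) (hK : real_grad h K).
Hypothesis lh : loc_int (fun x => `|h x| * (Num.sqrt (sqnorm x))^-1).

Let wt (x : 'rV[R]_d) : R := sqnorm x `^ (g / 2).
Let cwt : continuous wt.
Proof.
apply: continuous_powR_nneg; first by rewrite divr_ge0// ltW.
  exact: sqnorm_ge0.
exact: (Ck_continuous (Ck_sqnorm d 0)).
Qed.

Lemma coord_sqrt_sqnorm (x : 'rV[R]_d) j : `|x ord0 j| <= Num.sqrt (sqnorm x).
Proof.
rewrite -sqrtr_sqr; apply: ler_wsqrtr; rewrite /sqnorm (bigD1 j)//= lerDl.
by apply: sumr_ge0 => i _; exact: sqr_ge0.
Qed.

(** Uniform in e >= 0 and valid at x = 0, where both sides are 0; this is what dominates the
    derivatives of the regularized weights. *)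
Lemma coord_div_sqnorm (x : 'rV[R]_d) j (e : R) : 0 <= e ->
  `|x ord0 j| / (sqnorm x + e) <= (Num.sqrt (sqnorm x))^-1.
Proof.
move=> e0; have := sqnorm_ge0 x; rewrite le_eqVlt => /predU1P[s0|s0].
  have := coord_sqrt_sqnorm x j; rewrite -s0 sqrtr0 normr_le0 => /eqP ->.
  by rewrite normr0 mul0r invr0.
have s0' : 0 < Num.sqrt (sqnorm x) by rewrite sqrtr_gt0.
rewrite ler_pdivrMr; last by rewrite ltr_wpDr.
rewrite (le_trans (coord_sqrt_sqnorm x j))//.
rewrite mulrC ler_pdivlMr// -expr2 sqr_sqrtr ?sqnorm_ge0//.
by rewrite lerDl.
Qed.

Let wgrad j x := K j x * wt x + g * x ord0 j / sqnorm x * wt x * h x.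

Lemma loc_int_wgrad j : loc_int (wgrad j).
Proof.
have [[mh ih] /(_ j)[lK _]] := hK.
apply: loc_intD; first exact: loc_intM.
have lH : loc_int (fun x => `|h x| * (Num.sqrt (sqnorm x))^-1 * (g * wt x)).
  apply: loc_intM => //.
  by move=> x; apply: continuousM; [exact: cst_continuous|exact: cwt].
apply: (loc_int_le _ lH).
  apply: measurable_funM => //; apply: measurable_funM; last first.
    exact: continuous_measurable_rV.
  apply: measurable_funM.
    by apply: measurable_funM => //; exact: measurable_coord.
  by apply: measurable_fun_inv; [exact: sqnorm_ge0|exact: measurable_sqnorm].
move=> x; rewrite [leRHS]ger0_norm; last first.
  by rewrite !mulr_ge0 ?invr_ge0 ?sqrtr_ge0 ?powR_ge0// ltW.
rewrite !normrM (ger0_norm (ltW g0)) (ger0_norm (powR_ge0 _ _)).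
rewrite [`|_^-1|]ger0_norm ?invr_ge0 ?sqnorm_ge0//.
have := coord_div_sqnorm x j (lexx 0); rewrite addr0 => hx.
rewrite [leLHS](_ : _ = (`|x ord0 j| / sqnorm x) * (g * wt x * `|h x|)); last by rewrite /wt; ring.
rewrite [leRHS](_ : _ = (Num.sqrt (sqnorm x))^-1 * (g * wt x * `|h x|)); last by ring.
by rewrite ler_wpM2r// !mulr_ge0 ?powR_ge0// ltW.
Qed.

(** |x|^g need not be smooth at 0, so it cannot be moved onto the test function. Its regularization
    (|x|^2 + e)^(g/2) can, and e tends to 0 by dominated convergence, the singular factor |h|/|x|
    being locally integrable by [lh]. *)
Lemma real_grad_radial_weight : real_grad (fun x => h x * wt x) wgrad.
Proof.
have [lh0 hK'] := hK; have [mh _] := lh0.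
split; first exact: loc_intM.
move=> j; split; first exact: loc_int_wgrad.
move=> f M sf f0; have [lK wK] := hK' j; have [mK _] := lK.
have cf := smooth_continuous sf.
have cdf := smooth_partial_continuous (j := j) sf.
have df0 := partial_outside j f0.
have g2 : 0 <= g / 2 by rewrite divr_ge0// ltW.
pose e n : R := n.+1%:R^-1.
have e0 n : 0 < e n by rewrite invr_gt0.
have e1 n : e n <= 1 by rewrite invf_le1// ler1n.
pose om n (x : 'rV[R]_d) := (sqnorm x + e n) `^ (g / 2).
pose dom n (x : 'rV[R]_d) := g / 2 * (sqnorm x + e n) `^ (g / 2 - 1) * (2 * x ord0 j).
have omD n x : is_derive x (delta_mx ord0 j) (om n) (dom n x).
  exact: is_derive_powR_sqnorm.
have som n : smooth (om n) by move=> k; exact: Ck_powR_sqnorm.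
have com n := smooth_continuous (som n).
have cdom n : continuous (dom n).
  have := smooth_partial_continuous (j := j) (som n).
  by rewrite (_ : partial _ _ = dom n)//; apply/funext => x; have [_] := omD n x.
pose F n x := h x * (f x * dom n x + om n x * partial j f x) + K j x * (f x * om n x).
pose F' x := h x * (f x * (g * x ord0 j / sqnorm x * wt x) + wt x * partial j f x)
  + K j x * (f x * wt x).
pose s1 (x : 'rV[R]_d) : R := (sqnorm x + 1) `^ (g / 2).
have cs1 : continuous s1 by exact: Ck_continuous (Ck_powR_sqnorm d 0 (g / 2) ltr01).
pose G x := `|h x| * (Num.sqrt (sqnorm x))^-1 * (g * s1 x * `|f x|) +
  `|h x| * (s1 x * `|partial j f x|) + `|K j x| * (s1 x * `|f x|).
have cM (a b : 'rV[R]_d -> R) : continuous a -> continuous b ->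
    continuous (fun x => a x * b x).
  by move=> ca cb x; apply: continuousM; [exact: ca|exact: cb].
have cN (a : 'rV[R]_d -> R) : continuous a -> continuous (fun x => `|a x|).
  move=> ca x; apply: continuous_comp; [exact: ca|exact: norm_continuous].
have iG : mu.-integrable setT (EFin \o G).
  apply: (@integrable_support _ _ _ M); last first.
    by move=> x xM; rewrite /G f0// df0// normr0 !mulr0 !addr0.
  apply: loc_intD; first apply: loc_intD.
  - apply: loc_intM => //; apply: (cM); last exact: cN.
    by apply: (cM) => //; exact: cst_continuous.
  - by apply: loc_intM; [exact: loc_int_norm|apply: (cM) => //; exact: cN].
  - by apply: loc_intM; [exact: loc_int_norm|apply: (cM) => //; exact: cN].
have mF n : measurable_fun setT (F n).
  apply: measurable_funD; apply: measurable_funM => //; apply: continuous_measurable_rV.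
    move=> x; exact: (continuousD (cM _ _ cf (cdom n) x) (cM _ _ (com n) cdf x)).
  exact: (cM _ _ cf (com n)).
have mwt := continuous_measurable_rV cwt.
have mf := continuous_measurable_rV cf; have mdf := continuous_measurable_rV cdf.
have mF' : measurable_fun setT F'.
  apply: measurable_funD; apply: measurable_funM => //; last exact: measurable_funM.
  apply: measurable_funD; last exact: measurable_funM.
  apply: measurable_funM => //; apply: measurable_funM => //; apply: measurable_funM.
    by apply: measurable_funM => //; exact: measurable_coord.
  by apply: measurable_fun_inv; [exact: sqnorm_ge0|exact: measurable_sqnorm].
have domE n x : dom n x = g * x ord0 j / (sqnorm x + e n) * om n x.
  have se0 : 0 < sqnorm x + e n by rewrite ltr_wpDl// sqnorm_ge0.
  rewrite /dom /om powRB; last by rewrite (gt_eqF se0) implybT.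
  by rewrite powRr1 ?(ltW se0)//; field; rewrite gt_eqF.
have cvgom x : om n x @[n --> \oo] --> wt x.
  by apply: cvg_powR_harmonic => //; exact: sqnorm_ge0.
have cvgdom x : dom n x @[n --> \oo] --> g * x ord0 j / sqnorm x * wt x.
  under eq_fun do rewrite domE.
  have [s0|s0] := eqVneq (sqnorm x) 0.
    have -> : x ord0 j = 0.
      by have := coord_sqrt_sqnorm x j; rewrite s0 sqrtr0 normr_le0 => /eqP.
    by under eq_fun do rewrite mulr0 !mul0r; rewrite mulr0 !mul0r; exact: cvg_cst.
  apply: cvgM => //; apply: cvgM; first exact: cvg_cst.
  by apply: cvgV => //; exact: cvg_harmonicD.
have FF' x : F n x @[n --> \oo] --> F' x.
  apply: cvgD; apply: cvgM; try exact: cvg_cst.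
    by apply: cvgD; apply: cvgM => //; exact: cvg_cst.
  by apply: cvgM => //; exact: cvg_cst.
have om_le n x : om n x <= s1 x.
  apply: (ge0_ler_powR g2); rewrite ?nnegrE ?addr_ge0 ?sqnorm_ge0 ?(ltW (e0 n))//.
  by rewrite lerD2l.
have om0 n x : 0 <= om n x by exact: powR_ge0.
have FG n x : `|F n x| <= G x.
  have hd : `|dom n x| <= (Num.sqrt (sqnorm x))^-1 * (g * s1 x).
    have se0 : 0 <= sqnorm x + e n by rewrite addr_ge0 ?sqnorm_ge0// ltW.
    rewrite domE !normrM (ger0_norm (ltW g0)) (ger0_norm (om0 n x)).
    rewrite [`|_^-1|]ger0_norm ?invr_ge0//.
    rewrite [leLHS](_ : _ = (`|x ord0 j| / (sqnorm x + e n)) * (g * om n x)); last by ring.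
    apply: ler_pM; rewrite ?mulr_ge0 ?invr_ge0 ?(ltW g0)//.
      by apply: coord_div_sqnorm; exact: ltW.
    by rewrite ler_wpM2l// ltW.
  apply: (le_trans (ler_normD _ _)); apply: lerD; last first.
    rewrite !normrM ler_wpM2l// mulrC ler_wpM2r//.
    by rewrite (ger0_norm (om0 n x)).
  rewrite normrM (_ : _ + _ = `|h x| * ((Num.sqrt (sqnorm x))^-1 * (g * s1 x) * `|f x| +
     s1 x * `|partial j f x|)); last by ring.
  rewrite ler_wpM2l//; apply: (le_trans (ler_normD _ _)).
  rewrite (normrM (f x)) (normrM (om n x)); apply: lerD.
    by rewrite mulrC ler_wpM2r.
  by rewrite ler_wpM2r// (ger0_norm (om0 n x)).
have Fint n : \int[mu]_x F n x = 0.
  have fom0 x : ~ cbox M x -> f x * om n x = 0 by move=> /f0 ->; rewrite mul0r.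
  (* The product of [f] with the smooth weight is again a test function on the same box, so the weak
     gradient of [h] applies to it. *)
  have sfom : smooth (fun x => f x * om n x) by move=> k; apply: CkM; [exact: sf|exact: (som n)].
  have pE x : partial j (fun x => f x * om n x) x = f x * dom n x + om n x * partial j f x.
    rewrite partialM; [|exact: smooth_derivable|exact: smooth_derivable].
    by have [_ <-] := omD n x.
  have := wK _ M sfom fom0.
  under eq_Rintegral do rewrite pE.
  move=> E; rewrite /F RintegralD//; first by rewrite E addrC subrr.
  - have cp : continuous (fun x => f x * dom n x + om n x * partial j f x).
      move=> x; exact: (continuousD (cM _ _ cf (cdom n) x) (cM _ _ (com n) cdf x)).
    apply: (@integrable_test _ _ _ _ M) => //.
    by move=> x xM; rewrite f0// df0// mul0r mulr0 addr0.
  - by apply: (@integrable_test _ _ _ _ M) => //; exact: cM.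
have := Rintegral_dominated0 mF mF' FF' FG iG Fint.
rewrite (_ : (fun x => _) = (fun x => (h x * wt x) * partial j f x + wgrad j x * f x)); last first.
  by apply/funext => x; rewrite /F' /wgrad; ring.
rewrite RintegralD//; last 2 first.
- by apply: (@integrable_test _ _ _ _ M) => //; exact: loc_intM.
- by apply: (@integrable_test _ _ _ _ M) => //; exact: loc_int_wgrad.
by move/eqP; rewrite addr_eq0 => /eqP.
Qed.

End radial_weight.

(** * The weighted function *)

Section weighted_function.
Context {R : realType} {d : nat}.
Local Notation Re := (@complex.Re _).
Local Notation Im := (@complex.Im _).
Local Notation mu := (@lebesgue_rV R d).
Variables (A : 'rV[R]_d -> 'rV[R]_d) (p : R) (u : 'rV[R]_d -> R[i]).
Hypothesis cA : forall j, continuous (fun x => A x ord0 j).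
Hypotheses (p2 : 2 <= p) (pd : p < d%:R).
Hypothesis du : mform_domain A p u.

Let p0 : 0 < p. Proof. exact: lt_le_trans p2. Qed.
Let wu : weakly_differentiable u. Proof. by have [] := du. Qed.
Let k : R := (d%:R - p) / p.
Let k0 : 0 < k. Proof. by rewrite divr_gt0// subr_gt0. Qed.
Let v x := u x * (enorm x `^ k)%:C.

Lemma enorm_powR (x : 'rV[R]_d) r : enorm x `^ r = sqnorm x `^ (r / 2).
Proof. by rewrite -sqrt_powR ?sqnorm_ge0. Qed.

Lemma Re_csq (z : R[i]) : Re z ^+ 2 <= csq z.
Proof. by rewrite lerDl sqr_ge0. Qed.

Lemma Im_csq (z : R[i]) : Im z ^+ 2 <= csq z.
Proof. by rewrite lerDr sqr_ge0. Qed.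

Let vgrad x : 'rV[R[i]]_d := \row_j
  (grad u x ord0 j * (sqnorm x `^ (k / 2))%:C +
   (k * x ord0 j / sqnorm x * sqnorm x `^ (k / 2))%:C * u x).

Lemma is_grad_weighted : is_grad v vgrad.
Proof.
have /is_gradP[Gr Gi] := grad_is_grad wu.
have [mr mi] := cmeasurable_domain du.
have lr := @loc_int_hardy _ _ _ _ _ cA p2 pd du (Re \o u) mr.
have li := @loc_int_hardy _ _ _ _ _ cA p2 pd du (Im \o u) mi.
have {}lr := lr (fun x => Re_csq (u x)); have {}li := li (fun x => Im_csq (u x)).
apply/is_gradP; split.
  rewrite (_ : Re \o v = fun x => (Re \o u) x * sqnorm x `^ (k / 2)); last first.
    by apply/funext => x; rewrite /v /= enorm_powR; case: (u x) => a b /=; ring.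
  rewrite (_ : (fun j x => _) = fun j x => Re (grad u x ord0 j) * sqnorm x `^ (k / 2) +
      k * x ord0 j / sqnorm x * sqnorm x `^ (k / 2) * (Re \o u) x).
    exact: real_grad_radial_weight.
  apply/funext => j; apply/funext => x; rewrite mxE /=.
  by case: (grad u x ord0 j) => a b; case: (u x) => a' b' /=; ring.
rewrite (_ : Im \o v = fun x => (Im \o u) x * sqnorm x `^ (k / 2)); last first.
  by apply/funext => x; rewrite /v /= enorm_powR; case: (u x) => a b /=; ring.
rewrite (_ : (fun j x => _) = fun j x => Im (grad u x ord0 j) * sqnorm x `^ (k / 2) +
    k * x ord0 j / sqnorm x * sqnorm x `^ (k / 2) * (Im \o u) x).
  exact: real_grad_radial_weight.
apply/funext => j; apply/funext => x; rewrite mxE /=.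
by case: (grad u x ord0 j) => a b; case: (u x) => a' b' /=; ring.
Qed.

Lemma weakly_differentiable_weighted : weakly_differentiable v.
Proof. by exists vgrad; exact: is_grad_weighted. Qed.

(* [k p + p - d = 0], so the two weights cancel. *)
Lemma weighted_integrand x : grad v x = vgrad x ->
  cenorm (mgrad A v x) `^ p * enorm x `^ (p - d%:R) = punctured_radial p A u x.
Proof.
move=> gv; have [s sE] : exists s, s = sqnorm x by eexists.
have [t tE] : exists t, t = s `^ (k / 2) by eexists.
have s0 : 0 <= s by rewrite sE sqnorm_ge0.
rewrite cenorm_powR enorm_powR /punctured_radial -/k -sE.
have -> : gsq (mgrad A v x) = t ^+ 2 * radial_sq k x (u x) (mgrad A u x).
  rewrite /gsq /radial_sq mulr_sumr; apply: eq_bigr => j _.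
  rewrite mxE gv mxE /v enorm_powR -sE -tE mxE.
  case: (grad u x ord0 j) => a b; case: (u x) => a' b'; rewrite /csq /=.
  by move: (k * _ / _) (A x ord0 j) => r c; ring.
rewrite powRM ?sqr_ge0 ?radial_sq_ge0//.
(* At the origin the exponent (p - d)/2 is nonzero, so the power of 0 is 0, as the indicator in
   [punctured_radial] requires. *)
have [s_eq0|s_neq0] := eqVneq s 0.
  rewrite s_eq0 powR0 ?mulr0 ?mul0r//.
  by rewrite mulf_neq0// ?invr_neq0// subr_eq0 lt_eqF.
rewrite mul1r mulrAC (_ : (t ^+ 2) `^ (p / 2) * s `^ ((p - d%:R) / 2) = 1) ?mul1r//.
have t0 : 0 <= t by rewrite tE powR_ge0.
rewrite -(powR_mulrn 2 t0) -powRrM tE -powRrM -powRD; last by rewrite s_neq0 implybT.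
rewrite (_ : _ + _ = 0) ?powRr0// /k; field.
by rewrite gt_eqF.
Qed.

(** The pointwise identity holds where [grad v] agrees with the product-rule gradient, hence almost
    everywhere by uniqueness. *)
Lemma integral_weighted :
  (\int[mu]_x (cenorm (mgrad A v x) `^ p * enorm x `^ (p - d%:R))%:E =
   \int[mu]_x (punctured_radial p A u x)%:E)%E.
Proof.
have wv := weakly_differentiable_weighted.
apply: ge0_ae_eq_integral => //.
- apply/measurable_EFinP; apply: measurable_funM.
    under eq_fun do rewrite cenorm_powR.
    apply: measurable_fun_powR; apply: measurable_gsq => j.
    by have [] := cmeasurable_mgrad j wv cA.
  under eq_fun do rewrite enorm_powR.
  by apply: measurable_fun_powR; exact: measurable_sqnorm.
- by apply/measurable_EFinP; exact: measurable_punctured_radial.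
- by move=> x _; rewrite lee_fin mulr_ge0// powR_ge0.
- by move=> x _; rewrite lee_fin mulr_ge0// powR_ge0.
- have := is_grad_unique (grad_is_grad wv) is_grad_weighted.
  by apply: filterS => x gv _; rewrite weighted_integrand.
Qed.

Lemma integral_hardy_term :
  (\int[mu]_x (@complex.ComplexField.Normc.normc _ (u x) `^ p / enorm x `^ p)%:E =
   \int[mu]_x ((csq (u x) / sqnorm x) `^ (p / 2))%:E)%E.
Proof.
apply: eq_integral => x _; rewrite normc_powR enorm_powR.
rewrite powRM ?csq_ge0 ?invr_ge0 ?sqnorm_ge0//.
by rewrite -(powR_inv1 (sqnorm_ge0 x)) -powRrM mulN1r powRN.
Qed.

End weighted_function.

Theorem theorem1p2 (R : realType) (d : nat) (p : R)
    (B : 'rV[R]_d -> 'M[R]_d) :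
  (2 <= d)%N -> 2 <= p -> p < d%:R ->
  magnetic_field B -> closed_field B -> (exists x, B x <> 0) ->
  exists c : R, [/\ c = remainder_cst p, 0 < c, c <= 1 &
    forall A : 'rV[R]_d -> 'rV[R]_d, magnetic_potential B A ->
    forall u : 'rV[R]_d -> R[i], mform_domain A p u ->
    let v := fun x => u x * (enorm x `^ ((d%:R - p) / p))%:C in
    weakly_differentiable v /\
    (c%:E * \int[@lebesgue_rV R d]_x
        (cenorm (mgrad A v x) `^ p * enorm x `^ (p - d%:R))%:E
     <= \int[@lebesgue_rV R d]_x (cenorm (mgrad A u x) `^ p)%:E
        - (hardy_cst p d)%:E * \int[@lebesgue_rV R d]_x
            (normc (u x) `^ p / enorm x `^ p)%:E)%E].
Proof.
move=> _ p2 pd _ _ _; exists (remainder_cst p); split => //.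
- exact: remainder_cst_gt0.
- exact: remainder_cst_le1.
move=> A [sA _] u du v.
have cA j : continuous (fun x => A x ord0 j) by exact: smooth_continuous (sA j).
split; first exact: weakly_differentiable_weighted du.
have p0 : 0 < p := lt_le_trans (ltr0n _ 2) p2.
rewrite (integral_weighted cA p2 pd du) (integral_hardy_term p).
(* In [\bar R] the subtracted term may change sides because it is finite, which is
   [integrable_hardy_term]. *)
rewrite leeBrDr; first exact: hardy_domain_limit.
apply: fin_numM => //; apply: integrable_fin_num => //.
exact: integrable_hardy_term du.
Qed.
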